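(* Let $\Omega$ be a circularly symmetric, simply connected, proper subdomain of $\mathbb{C}$ containing $0$. Let $f$ be the unique conformal mapping of $\mathbb{D}$ onto $\Omega$ satisfying $f(0)=0$ and $f'(0)>0$. Then $f|_{[0,1)}$ is real-valued, positive on $(0,1)$, strictly increasing on $[0,1)$, and convex on $[0,1)$. Moreover, $f$ is strictly convex on $[0,1)$ unless $\Omega$ is a disk with centre $0$.
   Context: $\mathbb{D}=\{z\in\mathbb{C}:|z|<1\}$. A domain is a nonempty connected open subset of $\mathbb{C}$; a conformal mapping of $\mathbb{D}$ onto $\Omega$ is a holomorphic bijection $\mathbb{D}\to\Omega$. A plane domain $\Omega$ is called circularly symmetric (about $0$) if its intersection with each circle centred at the origin is either empty, or the whole circle, or consists of a subarc of the circle centred on the positive $x$-axis (i.e. a subarc whose midpoint lies on the positive real axis). *)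

(* Defs.v *)
From Stdlib Require Import Reals.
From Coquelicot Require Import Coquelicot.

Open Scope R_scope.

Definition unit_disk (z : C) : Prop := Cmod z < 1.

Definition connected (A : C -> Prop) : Prop :=
  forall U V : C -> Prop,
    open U -> open V ->
    (forall z, A z -> U z \/ V z) ->
    (exists z, A z /\ U z) ->
    (exists z, A z /\ V z) ->
    exists z, A z /\ U z /\ V z.

Definition domain (A : C -> Prop) : Prop :=
  (exists z, A z) /\ open A /\ connected A.

Definition loop_in (A : C -> Prop) (gamma : R -> C) : Prop :=
  continuous_on (fun t => 0 <= t <= 1) gamma /\
  (forall t, 0 <= t <= 1 -> A (gamma t)) /\
  gamma 0 = gamma 1.

Definition null_homotopic_in (A : C -> Prop) (gamma : R -> C) : Prop :=
  exists H : R * R -> C,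
    continuous_on (fun p => 0 <= fst p <= 1 /\ 0 <= snd p <= 1) H /\
    (forall s t, 0 <= s <= 1 -> 0 <= t <= 1 -> A (H (s, t))) /\
    (forall t, 0 <= t <= 1 -> H (0, t) = gamma t) /\
    (forall t, 0 <= t <= 1 -> H (1, t) = gamma 0) /\
    (forall s, 0 <= s <= 1 -> H (s, 0) = gamma 0 /\ H (s, 1) = gamma 0).

Definition simply_connected_domain (A : C -> Prop) : Prop :=
  domain A /\ forall gamma : R -> C, loop_in A gamma -> null_homotopic_in A gamma.

Definition proper (A : C -> Prop) : Prop := exists z, ~ A z.

Definition polar (r t : R) : C := (r * cos t, r * sin t).

(* An arc may contain both, one or none of its endpoints.  When alpha = PI the
   endpoints coincide and the open arc is the circle minus the point -r. *)
Definition centred_arc (r : R) (A : C -> Prop) : Prop :=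
  exists alpha : R,
    0 < alpha <= PI /\
    (forall t, Rabs t < alpha -> A (polar r t)) /\
    (forall z, A z -> exists t, Rabs t <= alpha /\ z = polar r t).

Definition circularly_symmetric (A : C -> Prop) : Prop :=
  forall r : R, 0 < r ->
    (forall z, Cmod z = r -> ~ A z) \/
    (forall z, Cmod z = r -> A z) \/
    centred_arc r (fun z => Cmod z = r /\ A z).

(* Holomorphy: the derivative is taken over C_AbsRing, i.e. it is the complex
   derivative.  Values of f outside the unit disk are irrelevant. *)
Definition holomorphic_on (A : C -> Prop) (f : C -> C) : Prop :=
  forall z, A z -> ex_derive (K := C_AbsRing) (V := C_NormedModule) f z.

Definition conformal_map (f : C -> C) (A B : C -> Prop) : Prop :=
  holomorphic_on A f /\
  (forall z, A z -> B (f z)) /\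
  (forall z1 z2, A z1 -> A z2 -> f z1 = f z2 -> z1 = z2) /\
  (forall w, B w -> exists z, A z /\ f z = w).

Definition disk_centred_at_0 (A : C -> Prop) : Prop :=
  exists rho : R, 0 < rho /\ forall z, A z <-> Cmod z < rho.

Definition strictly_increasing_on (I : R -> Prop) (g : R -> R) : Prop :=
  forall x y, I x -> I y -> x < y -> g x < g y.

Definition convex_on (I : R -> Prop) (g : R -> R) : Prop :=
  forall x y t, I x -> I y -> 0 <= t <= 1 ->
    g ((1 - t) * x + t * y) <= (1 - t) * g x + t * g y.

Definition strictly_convex_on (I : R -> Prop) (g : R -> R) : Prop :=
  forall x y t, I x -> I y -> x <> y -> 0 < t < 1 ->
    g ((1 - t) * x + t * y) < (1 - t) * g x + t * g y.

(* Main.v *)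
(* Let F be the inverse of f.  Reflection across a line through 0 sends the part
   of Omega lying on the far side of the line from the positive axis into Omega,
   so the maximum principle applied to the quotient of F at the reflected point
   by F shows that |F| is smallest at the positive point of each circle; hence
   |f z| <= f |z|.  Thus the second derivative of |f (r e^{i t})|^2 in t is
   nonpositive at t = 0, which says exactly that r f'(r) / f(r) is nondecreasing;
   as this function tends to 1 at 0, it is at least 1, and then f'' >= 0.  If f'
   takes the same value twice then r f'(r) / f(r) = 1 near 0, so f is linear there
   and, by the identity theorem, on the whole disk. *)
Require Import Defs.
From Stdlib Require Import Reals Ranalysis5 Lra Lia List Classical ClassicalEpsilon.
From Coquelicot Require Import Coquelicot.

Open Scope R_scope.

(** * Continuity and complex differentiability *)

(** Reflection across the line at angle [phi] is antiholomorphic, so the quotient is taken at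
    [e^{-2 i phi} w], the conjugate of the reflected point. Since [F] commutes with conjugation, its
    modulus is the same there, and the quotient becomes holomorphic. Nothing is known about the
    boundary of [Omega]; hence the comparison is carried to the unit disk by [w = f z], and the
    maximum principle asks only for upper limits at boundary points. Near the unit circle the bound
    comes from [|F| < 1], on the preimage of the line the quotient has modulus one, and at the
    origin it tends to a number of modulus one. The function theory rests on the mean value property
    of circles, including circles around a removable singularity. Applied to difference quotients it
    gives Cauchy's estimate and the differentiability of [f']; the maximum principle then yields
    orders of zeros, [f' <> 0] and the inverse function, with no power series or winding numbers.
    The second derivative of [|f (r e^{i t})|^2] at [t = 0] is [2 (r^2 f'^2 - r f f' - r^2 f f'')],
    which is [-2 f^2] times [r (r f' / f)']. *)

Definition near (z : C) (P : C -> Prop) : Prop :=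
  exists d : R, 0 < d /\ forall y, Cmod (y - z) < d -> P y.

Lemma near_and (z : C) (P Q : C -> Prop) :
  near z P -> near z Q -> near z (fun y => P y /\ Q y).
Proof.
  intros [d [Hd HP]] [e [He HQ]].
  exists (Rmin d e); split; [now apply Rmin_pos|].
  intros y Hy; split; [apply HP | apply HQ];
    eapply Rlt_le_trans; eauto using Rmin_l, Rmin_r.
Qed.

Lemma near_impl (z : C) (P Q : C -> Prop) :
  (forall y, P y -> Q y) -> near z P -> near z Q.
Proof. intros H [d [Hd HP]]; exists d; split; auto. Qed.

Tactic Notation "near_from" uconstr(H) := eapply near_impl; [|exact H]; cbv beta.

Lemma near_at (z : C) (P : C -> Prop) : near z P -> P z.
Proof.
  intros [d [Hd HP]]; apply HP.
  replace (z - z)%C with (RtoC 0) by ring; rewrite Cmod_0; exact Hd.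
Qed.

Lemma near_ball (c : C) (r : R) (z : C) :
  Cmod (z - c) < r -> near z (fun y => Cmod (y - c) < r).
Proof.
  intros H; exists (r - Cmod (z - c)); split; [lra|].
  intros y Hy.
  replace (y - c)%C with ((y - z) + (z - c))%C by ring.
  eapply Rle_lt_trans; [apply Cmod_triangle|]; lra.
Qed.

Lemma near_ball_self (c : C) (r : R) :
  0 < r -> near c (fun y => Cmod (y - c) < r).
Proof. intros H; exists r; auto. Qed.

Lemma near_open (A : C -> Prop) (z : C) : open A -> A z -> near z A.
Proof.
  intros HA Hz; specialize (HA z Hz).
  apply locally_C in HA; destruct HA as [d Hd].
  exists d; split; [apply cond_pos|].
  intros y Hy; apply Hd; exact Hy.
Qed.

Definition ccont (f : C -> C) (z : C) : Prop :=
  forall eps, 0 < eps -> near z (fun y => Cmod (f y - f z) < eps).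

(* Caratheodory's form of differentiability, for which the product, chain and
   inverse function rules are algebraic identities. *)
Definition cderiv (f : C -> C) (z l : C) : Prop :=
  exists phi, ccont phi z /\ phi z = l /\
    near z (fun y => f y = f z + phi y * (y - z))%C.

Lemma ccont_ext (f g : C -> C) (z : C) :
  near z (fun y => f y = g y) -> ccont f z -> ccont g z.
Proof.
  intros H Hf eps He.
  assert (E := near_at _ _ H).
  near_from (near_and _ _ _ H (Hf eps He)).
  intros y [H1 H2]; rewrite <- H1, <- E; exact H2.
Qed.

Lemma ccont_const (c z : C) : ccont (fun _ => c) z.
Proof.
  intros eps He; exists 1; split; [lra|]; intros y _.
  replace (c - c)%C with (RtoC 0) by ring; rewrite Cmod_0; exact He.
Qed.

Lemma ccont_id (z : C) : ccont (fun y => y) z.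
Proof. intros eps He; exists eps; split; auto. Qed.

Lemma ccont_conj (z : C) : ccont Cconj z.
Proof.
  intros eps He; exists eps; split; auto; intros y Hy.
  rewrite <- Cminus_conj, Cmod_conj; exact Hy.
Qed.

Lemma ccont_plus (f g : C -> C) (z : C) :
  ccont f z -> ccont g z -> ccont (fun y => f y + g y)%C z.
Proof.
  intros Hf Hg eps He.
  near_from (near_and _ _ _ (Hf (eps / 2) ltac:(lra)) (Hg (eps / 2) ltac:(lra))).
  intros y [H1 H2].
  replace (f y + g y - (f z + g z))%C with ((f y - f z) + (g y - g z))%C by ring.
  eapply Rle_lt_trans; [apply Cmod_triangle|]; lra.
Qed.

Lemma ccont_mult (f g : C -> C) (z : C) :
  ccont f z -> ccont g z -> ccont (fun y => f y * g y)%C z.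
Proof.
  intros Hf Hg eps He.
  set (A := Cmod (f z)); set (B := Cmod (g z)).
  assert (HA : 0 <= A) by apply Cmod_ge_0.
  assert (HB : 0 <= B) by apply Cmod_ge_0.
  (* The error of the product is at most [e * e + e * B + A * e], and [e <= 1] turns this into
     [e (A + B + 1) < eps]. *)
  set (e := Rmin 1 (eps / (A + B + 2))).
  assert (He' : 0 < eps / (A + B + 2)) by (apply Rdiv_lt_0_compat; lra).
  assert (e0 : 0 < e) by (apply Rmin_pos; lra).
  assert (e1 : e <= 1) by apply Rmin_l.
  assert (e2 : e * (A + B + 2) <= eps).
  { apply Rle_trans with (eps / (A + B + 2) * (A + B + 2)).
    - apply Rmult_le_compat_r; [lra | apply Rmin_r].
    - right; field; lra. }
  near_from (near_and _ _ _ (Hf e e0) (Hg e e0)).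
  intros y [H1 H2].
  replace (f y * g y - f z * g z)%C
    with ((f y - f z) * (g y - g z) + (f y - f z) * g z + f z * (g y - g z))%C by ring.
  eapply Rle_lt_trans; [apply Cmod_triangle|].
  eapply Rle_lt_trans; [apply Rplus_le_compat_r, Cmod_triangle|].
  rewrite !Cmod_mult; fold A B.
  assert (H3 := Cmod_ge_0 (f y - f z)); assert (H4 := Cmod_ge_0 (g y - g z)).
  nra.
Qed.

Lemma ccont_near_neq (f : C -> C) (z a : C) :
  ccont f z -> f z <> a -> near z (fun y => f y <> a).
Proof.
  intros Hf Hz.
  assert (Hp : 0 < Cmod (f z - a)).
  { apply Cmod_gt_0; intros E; apply Hz.
    replace (f z) with (f z - a + a)%C by ring; rewrite E; ring. }
  near_from (Hf _ Hp).
  intros y Hy E; rewrite E in Hy.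
  replace (a - f z)%C with (- (f z - a))%C in Hy by ring.
  rewrite Cmod_opp in Hy; lra.
Qed.

Lemma ccont_mod_lt (f : C -> C) (z : C) (b : R) :
  ccont f z -> Cmod (f z) < b -> near z (fun y => Cmod (f y) < b).
Proof.
  intros Hf Hz.
  near_from (Hf (b - Cmod (f z)) ltac:(lra)).
  intros y Hy.
  replace (f y) with ((f y - f z) + f z)%C by ring.
  eapply Rle_lt_trans; [apply Cmod_triangle|]; lra.
Qed.

Lemma ccont_mod_gt (f : C -> C) (z : C) (b : R) :
  ccont f z -> b < Cmod (f z) -> near z (fun y => b < Cmod (f y)).
Proof.
  intros Hf Hz.
  near_from (Hf (Cmod (f z) - b) ltac:(lra)).
  intros y Hy.
  assert (H := Cmod_triangle (f z - f y) (f y)).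
  replace (f z - f y + f y)%C with (f z) in H by ring.
  replace (f z - f y)%C with (- (f y - f z))%C in H by ring.
  rewrite Cmod_opp in H; lra.
Qed.

Lemma ccont_inv (f : C -> C) (z : C) :
  ccont f z -> f z <> 0%C -> ccont (fun y => / f y)%C z.
Proof.
  intros Hf Hz eps He.
  assert (Hp : 0 < Cmod (f z)) by now apply Cmod_gt_0.
  set (m := Cmod (f z)) in *.
  (* With [|f y| > m / 2] nearby, the difference of the inverses stays below
     [(eps m^2 / 2) / (m / 2 * m) = eps]. *)
  assert (Hq : 0 < eps * m * m / 2) by (assert (0 < m * m) by nra; nra).
  assert (N := near_and _ _ _ (Hf _ Hq)
    (near_and _ _ _ (ccont_mod_gt _ _ (m / 2) Hf ltac:(fold m; lra))
                    (ccont_near_neq _ _ _ Hf Hz))).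
  near_from N.
  intros y [H1 [H2 H3]].
  replace (/ f y - / f z)%C with ((f z - f y) / (f y * f z))%C by (field; auto).
  rewrite Cmod_div by (now apply Cmult_neq_0).
  rewrite Cmod_mult; fold m.
  replace (f z - f y)%C with (- (f y - f z))%C by ring.
  rewrite Cmod_opp.
  assert (0 < Cmod (f y) * m) by nra.
  apply Rmult_lt_reg_r with (Cmod (f y) * m); [nra|].
  unfold Rdiv; rewrite Rmult_assoc, Rinv_l by lra.
  assert (m / 2 * m < Cmod (f y) * m) by nra. nra.
Qed.

Lemma near_comp (f : C -> C) (z : C) (P : C -> Prop) :
  ccont f z -> near (f z) P -> near z (fun y => P (f y)).
Proof. intros Hf [d [Hd HP]]. near_from (Hf d Hd); auto. Qed.

Lemma ccont_comp (f g : C -> C) (z : C) :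
  ccont f z -> ccont g (f z) -> ccont (fun y => g (f y)) z.
Proof. intros Hf Hg eps He; exact (near_comp _ _ _ Hf (Hg eps He)). Qed.

Lemma ccont_minus (f g : C -> C) (z : C) :
  ccont f z -> ccont g z -> ccont (fun y => f y - g y)%C z.
Proof.
  intros Hf Hg.
  assert (H := ccont_plus _ _ _ Hf (ccont_mult _ _ _ (ccont_const (- (1))%C z) Hg)).
  revert H; apply ccont_ext; exists 1; split; [lra|]; intros; ring.
Qed.

Lemma cderiv_ccont (f : C -> C) (z l : C) : cderiv f z l -> ccont f z.
Proof.
  intros [phi [H1 [_ H3]]].
  apply ccont_ext with (fun y => f z + phi y * (y - z))%C.
  - near_from H3; auto.
  - apply ccont_plus; [apply ccont_const|].
    apply ccont_mult; [exact H1|]; apply ccont_minus; [apply ccont_id | apply ccont_const].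
Qed.

Lemma cderiv_ext (f g : C -> C) (z l : C) :
  near z (fun y => f y = g y) -> cderiv f z l -> cderiv g z l.
Proof.
  intros H [phi [H1 [H2 H3]]]; exists phi; repeat split; auto.
  assert (E := near_at _ _ H).
  near_from (near_and _ _ _ H H3).
  intros y [E1 E2]; rewrite <- E1, <- E; exact E2.
Qed.

Lemma cderiv_const (c z : C) : cderiv (fun _ => c) z 0.
Proof.
  exists (fun _ => RtoC 0); repeat split; [apply ccont_const|].
  exists 1; split; [lra|]; intros; ring.
Qed.

Lemma cderiv_id (z : C) : cderiv (fun y => y) z 1.
Proof.
  exists (fun _ => RtoC 1); repeat split; [apply ccont_const|].
  exists 1; split; [lra|]; intros; ring.
Qed.

Lemma cderiv_plus (f g : C -> C) (z l m : C) :
  cderiv f z l -> cderiv g z m -> cderiv (fun y => f y + g y)%C z (l + m)%C.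
Proof.
  intros [p [p1 [p2 p3]]] [q [q1 [q2 q3]]].
  exists (fun y => p y + q y)%C; repeat split.
  - now apply ccont_plus.
  - now rewrite p2, q2.
  - near_from (near_and _ _ _ p3 q3).
    intros y [E1 E2]; rewrite E1, E2; ring.
Qed.

Lemma cderiv_mult (f g : C -> C) (z l m : C) :
  cderiv f z l -> cderiv g z m ->
  cderiv (fun y => f y * g y)%C z (l * g z + f z * m)%C.
Proof.
  intros Hf Hg; assert (Cg := cderiv_ccont _ _ _ Hg).
  destruct Hf as [p [p1 [p2 p3]]]; destruct Hg as [q [q1 [q2 q3]]].
  exists (fun y => p y * g y + f z * q y)%C; repeat split.
  - apply ccont_plus; apply ccont_mult; auto using ccont_const.
  - now rewrite p2, q2.
  - near_from (near_and _ _ _ p3 q3).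
    intros y [E1 E2]; rewrite E1, E2; ring.
Qed.

Lemma cderiv_scal (a : C) (f : C -> C) (z l : C) :
  cderiv f z l -> cderiv (fun y => a * f y)%C z (a * l)%C.
Proof.
  intros Hf; assert (H := cderiv_mult _ _ _ _ _ (cderiv_const a z) Hf).
  replace (a * l)%C with (0 * f z + a * l)%C by ring; exact H.
Qed.

Lemma cderiv_minus (f g : C -> C) (z l m : C) :
  cderiv f z l -> cderiv g z m -> cderiv (fun y => f y - g y)%C z (l - m)%C.
Proof.
  intros Hf Hg.
  assert (H := cderiv_plus _ _ _ _ _ Hf (cderiv_scal (- (1))%C _ _ _ Hg)).
  replace (l - m)%C with (l + - (1) * m)%C by ring.
  revert H; apply cderiv_ext; exists 1; split; [lra|]; intros; ring.
Qed.

Lemma cderiv_inv (f : C -> C) (z l : C) :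
  cderiv f z l -> f z <> 0%C -> cderiv (fun y => / f y)%C z (- l / (f z * f z))%C.
Proof.
  intros Hf Hz; assert (Cf := cderiv_ccont _ _ _ Hf).
  destruct Hf as [p [p1 [p2 p3]]].
  exists (fun y => (- (1) * p y) * / (f y * f z))%C; repeat split.
  - apply ccont_mult.
    + apply ccont_mult; auto using ccont_const.
    + apply ccont_inv; [apply ccont_mult; auto using ccont_const|].
      now apply Cmult_neq_0.
  - rewrite p2; field; auto.
  - near_from (near_and _ _ _ p3 (ccont_near_neq _ _ _ Cf Hz)).
    intros y [E1 E2].
    assert (E3 : (p y * (y - z) = f y - f z)%C) by (rewrite E1; ring).
    replace (- (1) * p y * / (f y * f z) * (y - z))%C
      with (- (p y * (y - z)) * / (f y * f z))%C by (field; auto).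
    rewrite E3; field; auto.
Qed.

Lemma cderiv_comp (f g : C -> C) (z l m : C) :
  cderiv f z l -> cderiv g (f z) m -> cderiv (fun y => g (f y)) z (m * l)%C.
Proof.
  intros Hf [q [q1 [q2 q3]]]; assert (Cf := cderiv_ccont _ _ _ Hf).
  destruct Hf as [p [p1 [p2 p3]]].
  exists (fun y => q (f y) * p y)%C; repeat split.
  - apply ccont_mult; auto. now apply ccont_comp.
  - now rewrite p2, q2.
  - near_from (near_and _ _ _ p3 (near_comp _ _ _ Cf q3)).
    intros y [E1 E2]; rewrite E2.
    replace (f y - f z)%C with (p y * (y - z))%C by (rewrite E1; ring). ring.
Qed.

Lemma cderiv_conj (f : C -> C) (z l : C) :
  cderiv f (Cconj z) l -> cderiv (fun y => Cconj (f (Cconj y))) z (Cconj l).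
Proof.
  intros [p [p1 [p2 p3]]].
  exists (fun y => Cconj (p (Cconj y))); repeat split.
  - apply ccont_comp with (f := fun y => p (Cconj y)); [|apply ccont_conj].
    apply ccont_comp; auto; apply ccont_conj.
  - now rewrite p2.
  - near_from (near_comp _ _ _ (ccont_conj z) p3).
    intros y E; simpl in E; rewrite E.
    rewrite Cplus_conj, Cmult_conj, Cminus_conj, !Cconj_conj; reflexivity.
Qed.

Lemma Cmod_minus_sym (a b : C) : Cmod (a - b) = Cmod (b - a).
Proof. replace (a - b)%C with (- (b - a))%C by ring; apply Cmod_opp. Qed.

Lemma Cminus_eq_0 (a b : C) : (a - b = 0)%C -> a = b.
Proof. intros E; replace a with (a - b + b)%C by ring; rewrite E; ring. Qed.

Lemma Cminus_neq_0 (a b : C) : a <> b -> (a - b <> 0)%C.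
Proof. intros H E; now apply H, Cminus_eq_0. Qed.

(** The passage to the little-o form, in which estimates are made. For the converse, [phi] is the
    difference quotient with the value [l] filled in at [z]. *)
Lemma cderiv_eps (f : C -> C) (z l : C) :
  cderiv f z l <->
  forall eps, 0 < eps ->
    near z (fun y => Cmod (f y - f z - l * (y - z)) <= eps * Cmod (y - z)).
Proof.
  split.
  - intros [p [p1 [p2 p3]]] eps He.
    near_from (near_and _ _ _ p3 (p1 eps He)).
    intros y [E1 E2]; rewrite p2 in E2.
    replace (f y - f z - l * (y - z))%C with ((p y - l) * (y - z))%C by (rewrite E1; ring).
    rewrite Cmod_mult; apply Rmult_le_compat_r; [apply Cmod_ge_0 | lra].
  - intros H.
    assert (Hd : forall y, {y = z} + {y <> z}) by (intros; apply excluded_middle_informative).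
    exists (fun y => if Hd y then l else ((f y - f z) / (y - z))%C); repeat split.
    + intros eps He.
      near_from (H (eps / 2) ltac:(lra)).
      intros y Hy; cbv beta in Hy.
      destruct (Hd z) as [_|n]; [|congruence].
      destruct (Hd y) as [->|n].
      * replace (l - l)%C with (RtoC 0) by ring; rewrite Cmod_0; lra.
      * assert (n' := Cminus_neq_0 _ _ n).
        replace ((f y - f z) / (y - z) - l)%C with ((f y - f z - l * (y - z)) / (y - z))%C
          by (field; auto).
        rewrite Cmod_div by auto.
        assert (0 < Cmod (y - z)) by now apply Cmod_gt_0.
        apply Rle_lt_trans with (eps / 2); [|lra].
        apply Rmult_le_reg_r with (Cmod (y - z)); [lra|].
        unfold Rdiv at 1; rewrite Rmult_assoc, Rinv_l; lra.
    + destruct (Hd z); congruence.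
    + exists 1; split; [lra|]; intros y _.
      destruct (Hd y) as [->|n]; [ring|].
      field; now apply Cminus_neq_0.
Qed.

Lemma cderiv_unique (f : C -> C) (z l m : C) : cderiv f z l -> cderiv f z m -> l = m.
Proof.
  intros Hl Hm; apply NNPP; intros Hn.
  assert (Hp : 0 < Cmod (l - m)) by now apply Cmod_gt_0, Cminus_neq_0.
  destruct (near_and _ _ _ (proj1 (cderiv_eps _ _ _) Hl (Cmod (l - m) / 4) ltac:(lra))
      (proj1 (cderiv_eps _ _ _) Hm (Cmod (l - m) / 4) ltac:(lra))) as [d [Hd H]].
  set (h := RtoC (d / 2)).
  assert (Eh : Cmod h = d / 2) by (unfold h; rewrite Cmod_R, Rabs_pos_eq; lra).
  destruct (H (z + h)%C) as [H1 H2].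
  { replace (z + h - z)%C with h by ring; lra. }
  replace (z + h - z)%C with h in H1, H2 by ring.
  assert (T := Cmod_triangle (f (z + h)%C - f z - m * h) (- (f (z + h)%C - f z - l * h))).
  rewrite Cmod_opp in T.
  replace (f (z + h)%C - f z - m * h + - (f (z + h)%C - f z - l * h))%C
    with ((l - m) * h)%C in T by ring.
  rewrite Cmod_mult in T.
  nra.
Qed.

Lemma is_derive_cderiv (f : C -> C) (z l : C) :
  is_derive (K := C_AbsRing) (V := C_NormedModule) f z l -> cderiv f z l.
Proof.
  intros [_ H]; apply cderiv_eps; intros eps He.
  specialize (H z (fun P HP => HP) (mkposreal eps He)).
  destruct H as [d Hd].
  exists d; split; [apply cond_pos|].
  intros y Hy; specialize (Hd y Hy).
  change (Cmod (f y - f z - (y - z) * l) <= eps * Cmod (y - z)) in Hd.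
  rewrite (Cmult_comm l); exact Hd.
Qed.

Lemma im_le_Cmod (c : C) : Rabs (Im c) <= Cmod c.
Proof. eapply Rle_trans; [apply Rmax_r | apply Rmax_Cmod]. Qed.

Lemma Cmod_le_abs (c : C) : Cmod c <= Rabs (Re c) + Rabs (Im c).
Proof.
  replace c with (RtoC (Re c) + Ci * RtoC (Im c))%C at 1.
  - eapply Rle_trans; [apply Cmod_triangle|].
    rewrite Cmod_mult, Cmod_Ci, !Cmod_R; lra.
  - destruct c; unfold RtoC, Ci, Cmult, Cplus, Re, Im; simpl; f_equal; ring.
Qed.

Lemma C_ext (a b : C) : Re a = Re b -> Im a = Im b -> a = b.
Proof. destruct a, b; unfold Re, Im; simpl; congruence. Qed.

Lemma is_derive_eps (f : R -> R) (t l : R) :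
  is_derive f t l <->
  forall eps, 0 < eps -> exists d, 0 < d /\ forall s, Rabs (s - t) < d ->
    Rabs (f s - f t - l * (s - t)) <= eps * Rabs (s - t).
Proof.
  split.
  - intros [_ H] eps He.
    destruct (H t (fun P HP => HP) (mkposreal eps He)) as [d Hd].
    exists d; split; [apply cond_pos|].
    intros s Hs; specialize (Hd s Hs).
    change (Rabs (f s - f t - (s - t) * l) <= eps * Rabs (s - t)) in Hd.
    rewrite (Rmult_comm l); exact Hd.
  - intros H; split; [apply is_linear_scal_l|].
    intros x Hx eps.
    assert (E : t = x) by exact (is_filter_lim_locally_unique (V := R_NormedModule) t x Hx).
    subst x.
    destruct (H eps (cond_pos eps)) as [d [Hd Hs]].
    exists (mkposreal d Hd); intros s Es.
    change (Rabs (f s - f t - (s - t) * l) <= eps * Rabs (s - t)).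
    rewrite (Rmult_comm _ l); apply Hs; exact Es.
Qed.

(** * Differentiation along curves *)

(** Stated by components, so that the real mean value theorem applies to real parts; [rderiv_eps]
    recovers the complex form that the chain rule needs. *)
Definition rderiv (gamma : R -> C) (t : R) (v : C) : Prop :=
  is_derive (fun s => Re (gamma s)) t (Re v) /\
  is_derive (fun s => Im (gamma s)) t (Im v).

Lemma rderiv_eps (gamma : R -> C) (t : R) (v : C) :
  rderiv gamma t v <->
  forall eps, 0 < eps -> exists d, 0 < d /\ forall s, Rabs (s - t) < d ->
    Cmod (gamma s - gamma t - v * RtoC (s - t)) <= eps * Rabs (s - t).
Proof.
  assert (ER : forall s, Re (gamma s - gamma t - v * RtoC (s - t)) =
                         Re (gamma s) - Re (gamma t) - Re v * (s - t)).
  { intros s; unfold RtoC, Cmult, Cminus, Cplus, Copp, Re, Im; simpl; ring. }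
  assert (EI : forall s, Im (gamma s - gamma t - v * RtoC (s - t)) =
                         Im (gamma s) - Im (gamma t) - Im v * (s - t)).
  { intros s; unfold RtoC, Cmult, Cminus, Cplus, Copp, Re, Im; simpl; ring. }
  split.
  - intros [HR HI] eps He.
    destruct (proj1 (is_derive_eps _ _ _) HR (eps / 2) ltac:(lra)) as [d [d0 Hd]].
    destruct (proj1 (is_derive_eps _ _ _) HI (eps / 2) ltac:(lra)) as [e [e0 Hee]].
    exists (Rmin d e); split; [now apply Rmin_pos|].
    intros s Hs.
    specialize (Hd s (Rlt_le_trans _ _ _ Hs (Rmin_l _ _))).
    specialize (Hee s (Rlt_le_trans _ _ _ Hs (Rmin_r _ _))).
    eapply Rle_trans; [apply Cmod_le_abs|].
    rewrite ER, EI; lra.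
  - intros H; split; apply is_derive_eps; intros eps He;
      destruct (H eps He) as [d [d0 Hd]]; exists d; split; auto; intros s Hs;
      specialize (Hd s Hs).
    + rewrite <- ER; eapply Rle_trans; [apply re_le_Cmod | exact Hd].
    + rewrite <- EI; eapply Rle_trans; [apply im_le_Cmod | exact Hd].
Qed.

Lemma rderiv_comp (f : C -> C) (gamma : R -> C) (t : R) (l v : C) :
  cderiv f (gamma t) l -> rderiv gamma t v ->
  rderiv (fun s => f (gamma s)) t (l * v)%C.
Proof.
  intros Hf Hg; apply rderiv_eps; intros eps He.
  assert (Hg' := proj1 (rderiv_eps _ _ _) Hg).
  set (A := Cmod l); set (B := Cmod v).
  assert (HA : 0 <= A) by apply Cmod_ge_0.
  assert (HB : 0 <= B) by apply Cmod_ge_0.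
  (* The error splits into that of [f], taken on a displacement of at most [(B + 1) |s - t|], and
     [l] times that of [gamma]; [e1] and [e2] give each of them [eps / 2]. *)
  set (e1 := eps / (2 * (B + 1))).
  assert (p1 : 0 < e1) by (apply Rdiv_lt_0_compat; lra).
  assert (q1 : e1 * (B + 1) = eps / 2) by (unfold e1; field; lra).
  set (e2 := Rmin 1 (eps / (2 * (A + 1)))).
  assert (p2 : 0 < e2) by (apply Rmin_pos; [lra | apply Rdiv_lt_0_compat; lra]).
  assert (q2 : e2 <= 1) by apply Rmin_l.
  assert (q3 : e2 * (A + 1) <= eps / 2).
  { apply Rle_trans with (eps / (2 * (A + 1)) * (A + 1)).
    - apply Rmult_le_compat_r; [lra | apply Rmin_r].
    - right; field; lra. }
  destruct (proj1 (cderiv_eps _ _ _) Hf e1 p1) as [d [d0 Hd]].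
  destruct (Hg' e2 p2) as [k [k0 Hk]].
  assert (d1 : 0 < d / (B + 1)) by (apply Rdiv_lt_0_compat; lra).
  exists (Rmin k (d / (B + 1))); split; [now apply Rmin_pos|].
  intros s Hs.
  specialize (Hk s (Rlt_le_trans _ _ _ Hs (Rmin_l _ _))).
  assert (Hs2 := Rlt_le_trans _ _ _ Hs (Rmin_r _ _)).
  assert (Hs3 : Rabs (s - t) * (B + 1) < d).
  { apply Rmult_lt_compat_r with (r := B + 1) in Hs2; [|lra].
    replace (d / (B + 1) * (B + 1)) with d in Hs2 by (field; lra). exact Hs2. }
  assert (Hn : 0 <= Rabs (s - t)) by apply Rabs_pos.
  assert (HG : Cmod (gamma s - gamma t) <= (B + e2) * Rabs (s - t)).
  { replace (gamma s - gamma t)%C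
      with ((gamma s - gamma t - v * RtoC (s - t)) + v * RtoC (s - t))%C by ring.
    eapply Rle_trans; [apply Cmod_triangle|].
    rewrite Cmod_mult, Cmod_R; fold B; lra. }
  assert (HG2 : Cmod (gamma s - gamma t) <= (B + 1) * Rabs (s - t)) by nra.
  specialize (Hd (gamma s) ltac:(lra)).
  replace (f (gamma s) - f (gamma t) - l * v * RtoC (s - t))%C
    with ((f (gamma s) - f (gamma t) - l * (gamma s - gamma t))
          + l * (gamma s - gamma t - v * RtoC (s - t)))%C by ring.
  eapply Rle_trans; [apply Cmod_triangle|].
  rewrite Cmod_mult; fold A.
  assert (X1 : e1 * Cmod (gamma s - gamma t) <= e1 * ((B + 1) * Rabs (s - t)))
    by (apply Rmult_le_compat_l; lra).
  assert (X2 : A * Cmod (gamma s - gamma t - v * RtoC (s - t)) <= A * (e2 * Rabs (s - t)))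
    by (apply Rmult_le_compat_l; lra).
  replace (e1 * ((B + 1) * Rabs (s - t))) with (eps / 2 * Rabs (s - t)) in X1
    by (rewrite <- q1; ring).
  nra.
Qed.

Lemma rderiv_segment (a v : C) (t : R) : rderiv (fun s => a + RtoC s * v)%C t v.
Proof.
  split.
  - apply is_derive_ext with (fun s => Re a + s * Re v).
    + intros s; unfold RtoC, Cmult, Cplus, Re, Im; simpl; ring.
    + auto_derive; auto; ring.
  - apply is_derive_ext with (fun s => Im a + s * Im v).
    + intros s; unfold RtoC, Cmult, Cplus, Re, Im; simpl; ring.
    + auto_derive; auto; ring.
Qed.

Lemma is_derive_continuity_pt (f : R -> R) (x l : R) :
  is_derive f x l -> continuity_pt f x.
Proof.
  intros H; apply continuity_pt_filterlim.
  apply (ex_derive_continuous f); now exists l.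
Qed.

(** The real mean value theorem is applied along the segment to the real part of
    [conj (f b - f a) * f]. Its increment is [|f b - f a|^2], its derivative at most
    [|f b - f a| K |b - a|], and one factor cancels. *)
Lemma Cmvt (f f' : C -> C) (a b : C) (K : R) :
  (forall t, 0 <= t <= 1 ->
     let z := (a + RtoC t * (b - a))%C in cderiv f z (f' z) /\ Cmod (f' z) <= K) ->
  Cmod (f b - f a) <= K * Cmod (b - a).
Proof.
  intros H.
  set (u := Cconj (f b - f a)).
  set (r := fun t : R => Re (u * f (a + RtoC t * (b - a))%C)).
  set (dr := fun t : R => Re (u * f' (a + RtoC t * (b - a)) * (b - a))%C).
  assert (Hr : forall t, 0 <= t <= 1 -> is_derive r t (dr t)).
  { intros t Ht; destruct (H t Ht) as [H1 _].
    refine (proj1 (rderiv_comp (fun z => u * f z)%C (fun s => a + RtoC s * (b - a))%C t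
             (u * f' (a + RtoC t * (b - a)))%C (b - a)%C _ _)).
    - now apply cderiv_scal.
    - apply rderiv_segment. }
  destruct (MVT_gen r 0 1 dr) as [c [Hc E]].
  - rewrite Rmin_left, Rmax_right by lra; intros x Hx; apply Hr; lra.
  - rewrite Rmin_left, Rmax_right by lra; intros x Hx.
    eapply is_derive_continuity_pt; apply Hr; lra.
  - rewrite Rmin_left, Rmax_right in Hc by lra.
    destruct (H c Hc) as [_ HK].
    set (m := Cmod (f b - f a)) in *.
    assert (m0 : 0 <= m) by apply Cmod_ge_0.
    assert (E2 : r 1 - r 0 = m * m).
    { unfold r.
      replace (a + RtoC 1 * (b - a))%C with b by ring.
      replace (a + RtoC 0 * (b - a))%C with a by ring.
      assert (E3 : Re (u * (f b - f a)) = m * m).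
      { unfold u. rewrite Cmult_comm, <- Cmod2_conj, re_RtoC; fold m; ring. }
      rewrite <- E3.
      replace (u * (f b - f a))%C with (u * f b - u * f a)%C by ring.
      unfold Cminus; rewrite re_plus, re_opp; ring. }
    assert (E4 : m * m <= m * (K * Cmod (b - a))).
    { rewrite <- E2, E.
      eapply Rle_trans; [apply Rle_abs|].
      unfold dr; rewrite Rabs_mult.
      rewrite (Rabs_pos_eq (1 - 0)) by lra.
      rewrite Rminus_0_r, Rmult_1_r.
      eapply Rle_trans; [apply re_le_Cmod|].
      rewrite !Cmod_mult; unfold u; rewrite Cmod_conj; fold m.
      rewrite Rmult_assoc.
      apply Rmult_le_compat_l; auto.
      apply Rmult_le_compat_r; auto using Cmod_ge_0. }
    destruct (Req_dec m 0) as [Z|Z].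
    + rewrite Z.
      assert (0 <= K) by (eapply Rle_trans; [apply Cmod_ge_0 | exact HK]).
      apply Rmult_le_pos; auto using Cmod_ge_0.
    + apply Rmult_le_reg_l with m; lra.
Qed.

Lemma ball_segment (c a b : C) (r t : R) :
  Cmod (a - c) < r -> Cmod (b - c) < r -> 0 <= t <= 1 ->
  Cmod (a + RtoC t * (b - a) - c) < r.
Proof.
  intros Ha Hb Ht.
  replace (a + RtoC t * (b - a) - c)%C
    with (RtoC (1 - t) * (a - c) + RtoC t * (b - c))%C by (rewrite RtoC_minus; ring).
  eapply Rle_lt_trans; [apply Cmod_triangle|].
  rewrite !Cmod_mult, !Cmod_R, !Rabs_pos_eq by lra.
  destruct (Req_dec t 0) as [->|]; [lra|]. nra.
Qed.

(** * The complex exponential *)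

Definition cexp (z : C) : C := (exp (Re z) * cos (Im z), exp (Re z) * sin (Im z)).

Lemma cexp_plus (z w : C) : cexp (z + w) = (cexp z * cexp w)%C.
Proof.
  unfold cexp; rewrite re_plus.
  replace (Im (z + w)) with (Im z + Im w) by reflexivity.
  rewrite exp_plus, cos_plus, sin_plus.
  unfold Cmult; simpl; f_equal; ring.
Qed.

Lemma Cmod_cexp (z : C) : Cmod (cexp z) = exp (Re z).
Proof.
  unfold cexp, Cmod; simpl.
  replace (_ + _) with (exp (Re z) * exp (Re z) * (Rsqr (sin (Im z)) + Rsqr (cos (Im z))))
    by (unfold Rsqr; ring).
  rewrite sin2_cos2, Rmult_1_r, sqrt_square; auto.
  left; apply exp_pos.
Qed.

Lemma cexp_0 : cexp 0 = 1%C.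
Proof. unfold cexp; simpl. rewrite exp_0, cos_0, sin_0. apply C_ext; simpl; ring. Qed.

(** At 0 the derivative is assembled from those of the real [exp], [cos] and [sin]; the functional
    equation carries it to every other point. *)
Lemma cderiv_cexp (z : C) : cderiv cexp z (cexp z).
Proof.
  assert (H0 : cderiv cexp 0 1).
  { apply cderiv_eps; intros eps He.
    (* The real part will contribute an error of at most [4 e m] and the imaginary part [5 e m],
       where [m = |y|]. *)
    set (e := Rmin 1 (eps / 10)).
    assert (e0 : 0 < e) by (apply Rmin_pos; lra).
    assert (e1 : e <= 1) by apply Rmin_l.
    assert (e2 : e <= eps / 10) by apply Rmin_r.
    destruct (proj1 (is_derive_eps exp 0 1)
      ltac:(auto_derive; auto; rewrite exp_0; ring) e e0) as [d1 [p1 H1]].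
    destruct (proj1 (is_derive_eps cos 0 0)
      ltac:(auto_derive; auto; rewrite sin_0; ring) e e0) as [d2 [p2 H2]].
    destruct (proj1 (is_derive_eps sin 0 1)
      ltac:(auto_derive; auto; rewrite cos_0; ring) e e0) as [d3 [p3 H3]].
    exists (Rmin e (Rmin d1 (Rmin d2 d3))); split.
    { do 3 (apply Rmin_pos; [assumption|]); assumption. }
    intros y Hy.
    replace (y - 0)%C with y in * by ring.
    assert (Hye : Cmod y < e) by (eapply Rlt_le_trans; [exact Hy | apply Rmin_l]).
    assert (Hy1 := Rlt_le_trans _ _ _ Hy (Rmin_r _ _)).
    assert (Hyd1 := Rlt_le_trans _ _ _ Hy1 (Rmin_l _ _)).
    assert (Hy2 := Rlt_le_trans _ _ _ Hy1 (Rmin_r _ _)).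
    assert (Hyd2 := Rlt_le_trans _ _ _ Hy2 (Rmin_l _ _)).
    assert (Hyd3 := Rlt_le_trans _ _ _ Hy2 (Rmin_r _ _)).
    assert (HR := re_le_Cmod y); assert (HI := im_le_Cmod y).
    set (m := Cmod y) in *; set (x := Re y) in *; set (w := Im y) in *.
    specialize (H1 x ltac:(rewrite Rminus_0_r; lra)).
    specialize (H2 w ltac:(rewrite Rminus_0_r; lra)).
    specialize (H3 w ltac:(rewrite Rminus_0_r; lra)).
    rewrite exp_0, Rminus_0_r in H1; rewrite cos_0, Rminus_0_r in H2;
      rewrite sin_0, !Rminus_0_r in H3.
    assert (R0 := Rabs_pos x); assert (I0 := Rabs_pos w).
    assert (B1 : Rabs (exp x - 1) <= 2 * m).
    { replace (exp x - 1) with ((exp x - 1 - 1 * x) + x) by ring.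
      eapply Rle_trans; [apply Rabs_triang|]; nra. }
    assert (B2 : exp x <= 3).
    { assert (T := Rle_abs (exp x - 1)). lra. }
    assert (B3 := exp_pos x).
    rewrite cexp_0.
    eapply Rle_trans; [apply Cmod_le_abs|].
    replace (Re (cexp y - 1 - 1 * y)) with ((exp x - 1 - 1 * x) + exp x * (cos w - 1 - 0 * w))
      by (unfold x, w, cexp, Cminus, Cplus, Copp, Cmult, RtoC, Re, Im; simpl; ring).
    replace (Im (cexp y - 1 - 1 * y)) with (exp x * (sin w - 1 * w) + (exp x - 1) * w)
      by (unfold x, w, cexp, Cminus, Cplus, Copp, Cmult, RtoC, Re, Im; simpl; ring).
    assert (C1 : Rabs (exp x - 1 - 1 * x + exp x * (cos w - 1 - 0 * w)) <= 4 * e * m).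
    { eapply Rle_trans; [apply Rabs_triang|]. rewrite Rabs_mult, (Rabs_pos_eq (exp x)) by lra.
      assert (exp x * Rabs (cos w - 1 - 0 * w) <= 3 * (e * m)).
      { apply Rmult_le_compat; try lra; [apply Rabs_pos|]. nra. }
      nra. }
    assert (C2 : Rabs (exp x * (sin w - 1 * w) + (exp x - 1) * w) <= 5 * e * m).
    { eapply Rle_trans; [apply Rabs_triang|].
      rewrite !Rabs_mult, (Rabs_pos_eq (exp x)) by lra.
      assert (exp x * Rabs (sin w - 1 * w) <= 3 * (e * m)).
      { apply Rmult_le_compat; try lra; [apply Rabs_pos|]. nra. }
      assert (Rabs (exp x - 1) * Rabs w <= (2 * m) * e).
      { apply Rmult_le_compat; try lra; apply Rabs_pos. }
      nra. }
    assert (0 <= m) by apply Cmod_ge_0.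
    assert (9 * e * m <= eps * m) by nra.
    lra. }
  assert (H1 : cderiv (fun y => y - z)%C z 1).
  { replace (RtoC 1) with (1 - 0)%C by ring.
    apply cderiv_minus; [apply cderiv_id | apply cderiv_const]. }
  replace (RtoC 0) with (z - z)%C in H0 by ring.
  assert (H := cderiv_scal (cexp z) _ _ _ (cderiv_comp _ _ _ _ _ H1 H0)).
  replace (cexp z * (1 * 1))%C with (cexp z) in H by ring.
  revert H; apply cderiv_ext; exists 1; split; [lra|]; intros y _.
  rewrite <- cexp_plus; f_equal; ring.
Qed.

(** * Integrals of complex-valued functions *)

Definition rcont (phi : R -> C) (t : R) : Prop :=
  forall eps, 0 < eps -> exists d, 0 < d /\ forall s, Rabs (s - t) < d ->
    Cmod (phi s - phi t) < eps.

Lemma rcont_comp (f : C -> C) (gamma : R -> C) (t : R) :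
  rcont gamma t -> ccont f (gamma t) -> rcont (fun s => f (gamma s)) t.
Proof.
  intros Hg Hf eps He. destruct (Hf eps He) as [d [d0 Hd]].
  destruct (Hg d d0) as [k [k0 Hk]]; exists k; split; auto.
Qed.

Lemma rderiv_rcont (gamma : R -> C) (t : R) (v : C) : rderiv gamma t v -> rcont gamma t.
Proof.
  intros H eps He.
  destruct (proj1 (rderiv_eps _ _ _) H 1 Rlt_0_1) as [d [d0 Hd]].
  assert (B0 := Cmod_ge_0 v).
  assert (p : 0 < eps / (Cmod v + 1)) by (apply Rdiv_lt_0_compat; lra).
  exists (Rmin d (eps / (Cmod v + 1))); split; [now apply Rmin_pos|].
  intros s Hs.
  specialize (Hd s (Rlt_le_trans _ _ _ Hs (Rmin_l _ _))).
  assert (Hs2 := Rlt_le_trans _ _ _ Hs (Rmin_r _ _)).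
  apply Rmult_lt_compat_r with (r := Cmod v + 1) in Hs2; [|lra].
  replace (eps / (Cmod v + 1) * (Cmod v + 1)) with eps in Hs2 by (field; lra).
  replace (gamma s - gamma t)%C
    with ((gamma s - gamma t - v * RtoC (s - t)) + v * RtoC (s - t))%C by ring.
  eapply Rle_lt_trans; [apply Cmod_triangle|].
  rewrite Cmod_mult, Cmod_R. lra.
Qed.

Lemma rcont_continuous (phi : R -> C) (t : R) :
  rcont phi t ->
  continuous (fun s => Re (phi s)) t /\ continuous (fun s => Im (phi s)) t.
Proof.
  intros H; split; apply filterlim_locally; intros eps;
    destruct (H eps (cond_pos eps)) as [d [d0 Hd]];
    exists (mkposreal d d0); intros s Hs; specialize (Hd s Hs).
  - change (Rabs (Re (phi s) - Re (phi t)) < eps).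
    eapply Rle_lt_trans; [|exact Hd].
    eapply Rle_trans; [|apply re_le_Cmod]. right; reflexivity.
  - change (Rabs (Im (phi s) - Im (phi t)) < eps).
    eapply Rle_lt_trans; [|exact Hd].
    eapply Rle_trans; [|apply im_le_Cmod]. right; reflexivity.
Qed.

Definition cintegrable (phi : R -> C) : Prop :=
  ex_RInt (fun t => Re (phi t)) 0 1 /\ ex_RInt (fun t => Im (phi t)) 0 1.

Definition CI (phi : R -> C) : C :=
  (RInt (fun t => Re (phi t)) 0 1, RInt (fun t => Im (phi t)) 0 1).

Lemma rcont_cintegrable (phi : R -> C) :
  (forall t, 0 <= t <= 1 -> rcont phi t) -> cintegrable phi.
Proof.
  intros H; split; apply (ex_RInt_continuous (V := R_CompleteNormedModule));
    intros t Ht; rewrite Rmin_left, Rmax_right in Ht by lra;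
    now apply rcont_continuous, H.
Qed.

Lemma CI_ext (phi psi : R -> C) :
  (forall t, 0 <= t <= 1 -> phi t = psi t) -> CI phi = CI psi.
Proof.
  intros H; unfold CI; f_equal; apply RInt_ext; intros t Ht;
    rewrite Rmin_left, Rmax_right in Ht by lra; rewrite H; auto; lra.
Qed.

Lemma CI_const (c : C) : CI (fun _ => c) = c.
Proof.
  unfold CI; rewrite !RInt_const; destruct c; unfold scal, Re, Im; simpl.
  unfold mult; simpl; f_equal; ring.
Qed.

Lemma cintegrable_const (c : C) : cintegrable (fun _ => c).
Proof. split; apply ex_RInt_const. Qed.

Lemma cintegrable_plus (phi psi : R -> C) :
  cintegrable phi -> cintegrable psi -> cintegrable (fun t => phi t + psi t)%C.
Proof.
  intros [a b] [c d]; split.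
  - exact (ex_RInt_plus (V := R_NormedModule) _ _ _ _ a c).
  - exact (ex_RInt_plus (V := R_NormedModule) _ _ _ _ b d).
Qed.

Lemma CI_plus (phi psi : R -> C) :
  cintegrable phi -> cintegrable psi ->
  CI (fun t => phi t + psi t)%C = (CI phi + CI psi)%C.
Proof.
  intros [a b] [c d]; apply C_ext.
  - exact (RInt_plus (V := R_CompleteNormedModule) _ _ _ _ a c).
  - exact (RInt_plus (V := R_CompleteNormedModule) _ _ _ _ b d).
Qed.

Lemma is_RInt_scal_CI (u : C) (phi : R -> C) :
  cintegrable phi ->
  is_RInt (fun t => Re (u * phi t)) 0 1 (Re (u * CI phi)) /\
  is_RInt (fun t => Im (u * phi t)) 0 1 (Im (u * CI phi)).
Proof.
  intros [a b].
  assert (A := RInt_correct (V := R_CompleteNormedModule) _ _ _ a).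
  assert (B := RInt_correct (V := R_CompleteNormedModule) _ _ _ b).
  split.
  - exact (is_RInt_minus (V := R_NormedModule) _ _ _ _ _ _
      (is_RInt_scal (V := R_NormedModule) _ _ _ (Re u) _ A)
      (is_RInt_scal (V := R_NormedModule) _ _ _ (Im u) _ B)).
  - exact (is_RInt_plus (V := R_NormedModule) _ _ _ _ _ _
      (is_RInt_scal (V := R_NormedModule) _ _ _ (Re u) _ B)
      (is_RInt_scal (V := R_NormedModule) _ _ _ (Im u) _ A)).
Qed.

Lemma cintegrable_scal (u : C) (phi : R -> C) :
  cintegrable phi -> cintegrable (fun t => u * phi t)%C.
Proof.
  intros H; destruct (is_RInt_scal_CI u phi H); split; eexists; eassumption.
Qed.

Lemma CI_scal (u : C) (phi : R -> C) :
  cintegrable phi -> CI (fun t => u * phi t)%C = (u * CI phi)%C.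
Proof.
  intros H; destruct (is_RInt_scal_CI u phi H) as [A B].
  apply (is_RInt_unique (V := R_CompleteNormedModule)) in A.
  apply (is_RInt_unique (V := R_CompleteNormedModule)) in B.
  apply C_ext; [exact A | exact B].
Qed.

(** Multiplying by the conjugate of the integral makes the integral real: its value [m^2] is the
    integral of a real part that is at most [m M]. *)
Lemma CI_bound (phi : R -> C) (M : R) :
  cintegrable phi -> (forall t, 0 <= t <= 1 -> Cmod (phi t) <= M) -> Cmod (CI phi) <= M.
Proof.
  intros H HM.
  set (m := Cmod (CI phi)).
  assert (m0 : 0 <= m) by apply Cmod_ge_0.
  destruct (is_RInt_scal_CI (Cconj (CI phi)) phi H) as [A _].
  replace (Re (Cconj (CI phi) * CI phi)) with (m * m) in A.
  2:{ rewrite Cmult_comm, <- Cmod2_conj, re_RtoC; fold m; ring. }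
  assert (L : m * m <= m * M).
  { apply (is_RInt_le _ (fun _ => m * M) 0 1 _ _ ltac:(lra) A).
    - assert (B := is_RInt_const (V := R_NormedModule) 0 1 (m * M)).
      change (is_RInt (fun _ : R => m * M) 0 1 ((1 - 0) * (m * M))) in B.
      replace ((1 - 0) * (m * M)) with (m * M) in B by ring; exact B.
    - intros t Ht. eapply Rle_trans; [apply Rle_abs|].
      eapply Rle_trans; [apply re_le_Cmod|].
      rewrite Cmod_mult, Cmod_conj; fold m.
      apply Rmult_le_compat_l; auto. apply HM; lra. }
  destruct (Req_dec m 0) as [Z|Z].
  - rewrite Z; eapply Rle_trans; [apply Cmod_ge_0 | apply (HM 0); lra].
  - apply Rmult_le_reg_l with m; lra.
Qed.

Lemma CI_reverse (phi : R -> C) :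
  cintegrable phi -> CI (fun t => phi (1 - t)) = CI phi.
Proof.
  assert (K : forall F : R -> R, ex_RInt F 0 1 -> RInt (fun t => F (1 - t)) 0 1 = RInt F 0 1).
  { intros F HF.
    assert (HF' : ex_RInt F 1 0) by now apply ex_RInt_swap.
    assert (E := RInt_comp_lin (V := R_CompleteNormedModule) F (-1) 1 0 1).
    replace (-1 * 0 + 1) with 1 in E by ring; replace (-1 * 1 + 1) with 0 in E by ring.
    specialize (E HF').
    assert (E2 := is_RInt_swap (V := R_NormedModule) _ _ _ _
                    (RInt_correct (V := R_CompleteNormedModule) _ _ _ HF)).
    apply (is_RInt_unique (V := R_CompleteNormedModule)) in E2; rewrite E2 in E.
    assert (E3 : ex_RInt (fun y => F (-1 * y + 1)) 0 1).
    { assert (X := ex_RInt_comp_lin (V := R_NormedModule) F (-1) 1 0 1).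
      replace (-1 * 0 + 1) with 1 in X by ring; replace (-1 * 1 + 1) with 0 in X by ring.
      specialize (X HF').
      apply (ex_RInt_scal (V := R_NormedModule) _ _ _ (-1)) in X.
      revert X; apply ex_RInt_ext; intros; unfold scal; simpl; unfold mult; simpl; ring. }
    rewrite (RInt_scal (V := R_CompleteNormedModule) _ _ _ (-1)) in E by exact E3.
    replace (RInt (fun t => F (1 - t)) 0 1) with (RInt (fun y => F (-1 * y + 1)) 0 1).
    - unfold scal, opp in E; simpl in E; unfold mult in E; simpl in E. lra.
    - apply RInt_ext; intros; f_equal; ring. }
  intros [a b]; unfold CI; f_equal; apply (K (fun t => _ (phi t))); assumption.
Qed.

(** Each half of the interval is stretched to [[0, 1]], which doubles its contribution; this is what
    splits a segment integral at the midpoint. *)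
Lemma CI_halves (phi : R -> C) :
  cintegrable phi ->
  (CI (fun t => phi (t / 2)%R) + CI (fun t => phi ((t + 1) / 2)%R) = 2 * CI phi)%C.
Proof.
  assert (K : forall F : R -> R, ex_RInt F 0 1 ->
    RInt (fun t => F (t / 2)) 0 1 + RInt (fun t => F ((t + 1) / 2)) 0 1 = 2 * RInt F 0 1).
  { intros F HF.
    assert (H1 : ex_RInt F 0 (1 / 2)).
    { apply (ex_RInt_Chasles_1 (V := R_CompleteNormedModule)) with 1; [lra | exact HF]. }
    assert (H2 : ex_RInt F (1 / 2) 1).
    { apply (ex_RInt_Chasles_2 (V := R_CompleteNormedModule)) with 0; [lra | exact HF]. }
    assert (G : forall v, ex_RInt F (1 / 2 * 0 + v) (1 / 2 * 1 + v) ->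
       RInt (fun y => F (1 / 2 * y + v)) 0 1 = 2 * RInt F (1 / 2 * 0 + v) (1 / 2 * 1 + v)).
    { intros v Hv.
      assert (E := RInt_comp_lin (V := R_CompleteNormedModule) F (1 / 2) v 0 1 Hv).
      assert (X := ex_RInt_comp_lin (V := R_NormedModule) F (1 / 2) v 0 1 Hv).
      assert (X' : ex_RInt (fun y => F (1 / 2 * y + v)) 0 1).
      { apply (ex_RInt_scal (V := R_NormedModule) _ _ _ 2) in X.
        revert X; apply ex_RInt_ext; intros; unfold scal; simpl; unfold mult; simpl; field. }
      rewrite (RInt_scal (V := R_CompleteNormedModule) _ _ _ (1 / 2)) in E by exact X'.
      unfold scal in E; simpl in E; unfold mult in E; simpl in E. lra. }
    rewrite <- (RInt_Chasles (V := R_CompleteNormedModule) F 0 (1 / 2) 1 H1 H2).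
    assert (G1 := G 0); assert (G2 := G (1 / 2)).
    replace (1 / 2 * 0 + 0) with 0 in G1 by field;
      replace (1 / 2 * 1 + 0) with (1 / 2) in G1 by field.
    replace (1 / 2 * 0 + 1 / 2) with (1 / 2) in G2 by field;
      replace (1 / 2 * 1 + 1 / 2) with 1 in G2 by field.
    specialize (G1 H1); specialize (G2 H2).
    rewrite (RInt_ext (fun t => F (t / 2)) (fun y => F (1 / 2 * y + 0)))
      by (intros; f_equal; field).
    rewrite (RInt_ext (fun t => F ((t + 1) / 2)) (fun y => F (1 / 2 * y + 1 / 2)))
      by (intros; f_equal; field).
    rewrite G1, G2; unfold plus; simpl; ring. }
  intros [a b].
  assert (A := K _ a); assert (B := K _ b); cbv beta in A, B.
  apply C_ext.
  - etransitivity; [exact A|]. unfold CI, RtoC, Cmult, Re, Im; simpl; ring.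
  - etransitivity; [exact B|]. unfold CI, RtoC, Cmult, Re, Im; simpl; ring.
Qed.

(** * Goursat's theorem *)

Definition segment_integral (f : C -> C) (a b : C) : C :=
  ((b - a) * CI (fun t => f (a + RtoC t * (b - a))))%C.

(** Left half-planes are the preimages of punctured discs under the exponential, and the only
    domains on which Goursat's theorem is used. Being convex, they contain every triangle spanned by
    their points. *)
Definition left_of (s : R) (z : C) : Prop := Re z < s.

Lemma re_segment (a b : C) (t : R) :
  Re (a + RtoC t * (b - a)) = (1 - t) * Re a + t * Re b.
Proof. unfold RtoC, Cmult, Cminus, Cplus, Copp, Re, Im; simpl; ring. Qed.

Lemma re_segment_le (a b : C) (t m : R) :
  Re a <= m -> Re b <= m -> 0 <= t <= 1 -> Re (a + RtoC t * (b - a)) <= m.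
Proof. intros Ha Hb Ht; rewrite re_segment; nra. Qed.

Lemma left_of_segment (s : R) (a b : C) (t : R) :
  left_of s a -> left_of s b -> 0 <= t <= 1 -> left_of s (a + RtoC t * (b - a)).
Proof.
  unfold left_of; intros Ha Hb Ht.
  apply Rle_lt_trans with (Rmax (Re a) (Re b)).
  - apply re_segment_le; auto using Rmax_l, Rmax_r.
  - now apply Rmax_lub_lt.
Qed.

Lemma segment_cintegrable (f : C -> C) (a b : C) :
  (forall t, 0 <= t <= 1 -> ccont f (a + RtoC t * (b - a))) ->
  cintegrable (fun t => f (a + RtoC t * (b - a))%C).
Proof.
  intros H; apply rcont_cintegrable; intros t Ht.
  apply (rcont_comp f (fun s => a + RtoC s * (b - a))%C).
  - eapply rderiv_rcont, rderiv_segment.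
  - now apply H.
Qed.

Lemma segment_integral_swap (f : C -> C) (a b : C) :
  (forall t, 0 <= t <= 1 -> ccont f (a + RtoC t * (b - a))) ->
  (segment_integral f b a = - segment_integral f a b)%C.
Proof.
  intros H; unfold segment_integral.
  rewrite <- (CI_reverse _ (segment_cintegrable f a b H)).
  rewrite (CI_ext (fun t => f (b + RtoC t * (a - b))%C)
             (fun t => f (a + RtoC (1 - t) * (b - a))%C)).
  - ring.
  - intros t _; f_equal; rewrite RtoC_minus; ring.
Qed.

Lemma segment_integral_midpoint (f : C -> C) (a b : C) :
  (forall t, 0 <= t <= 1 -> ccont f (a + RtoC t * (b - a))) ->
  (segment_integral f a b =
   segment_integral f a ((a + b) / 2) + segment_integral f ((a + b) / 2) b)%C.
Proof.
  intros H; unfold segment_integral.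
  assert (E := CI_halves _ (segment_cintegrable f a b H)); cbv beta in E.
  assert (n2 : RtoC 2 <> 0%C) by (intros X; apply RtoC_inj in X; lra).
  rewrite (CI_ext (fun t => f (a + RtoC t * ((a + b) / 2 - a))%C)
             (fun t => f (a + RtoC (t / 2) * (b - a))%C)).
  2:{ intros t _; f_equal; rewrite RtoC_div by lra; field; auto. }
  rewrite (CI_ext (fun t => f ((a + b) / 2 + RtoC t * (b - (a + b) / 2))%C)
             (fun t => f (a + RtoC ((t + 1) / 2) * (b - a))%C)).
  2:{ intros t _; f_equal; rewrite RtoC_div, RtoC_plus by lra; field; auto. }
  set (X := CI (fun t => f (a + RtoC t * (b - a))%C)) in *.
  set (Y := CI (fun t => f (a + RtoC (t / 2) * (b - a))%C)) in *.
  set (Z := CI (fun t => f (a + RtoC ((t + 1) / 2) * (b - a))%C)) in *.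
  replace X with ((2 * X) / 2)%C by (field; auto).
  rewrite <- E; field; auto.
Qed.

(** The value is the increment of the primitive [al z + be z^2 / 2], so the integrals of an affine
    function around a triangle telescope to zero. *)
Lemma segment_integral_affine (al be a b : C) :
  (segment_integral (fun z => al + be * z) a b =
   al * (b - a) + be * (b * b - a * a) / 2)%C.
Proof.
  assert (n2 : RtoC 2 <> 0%C) by (intros X; apply RtoC_inj in X; lra).
  assert (Eid : (CI RtoC = / 2)%C).
  { assert (I : is_RInt (fun t : R => t) 0 1 (1 ^ 2 / 2 - 0 ^ 2 / 2)).
    { apply (is_RInt_derive (V := R_CompleteNormedModule) (fun t => t ^ 2 / 2) (fun t => t)).
      - intros; auto_derive; auto; field.
      - intros; apply continuous_id. }
    apply (is_RInt_unique (V := R_CompleteNormedModule)) in I.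
    assert (J := RInt_const (V := R_CompleteNormedModule) 0 1 (0 : R)).
    unfold CI, RtoC; cbn [Re Im fst snd]. unfold Re, Im; cbn [fst snd].
    rewrite I, J.
    apply C_ext; unfold scal; simpl; unfold mult; simpl; field. }
  assert (Hid : cintegrable RtoC).
  { apply rcont_cintegrable; intros t _ eps He; exists eps; split; auto.
    intros s Hs; rewrite <- RtoC_minus, Cmod_R; exact Hs. }
  unfold segment_integral.
  rewrite (CI_ext _ (fun t => (al + be * a) + (be * (b - a)) * RtoC t)%C) by (intros; ring).
  rewrite CI_plus, CI_const, CI_scal, Eid;
    auto using cintegrable_const, cintegrable_scal.
  field; auto.
Qed.

Definition triangle : Type := (C * C * C)%type.

Definition triangle_integral (f : C -> C) (T : triangle) : C :=
  let '(a, b, c) := T in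
  (segment_integral f a b + segment_integral f b c + segment_integral f c a)%C.

Definition perimeter (T : triangle) : R :=
  let '(a, b, c) := T in Cmod (b - a) + Cmod (c - b) + Cmod (a - c).

Definition triangle_in (P : C -> Prop) (T : triangle) : Prop :=
  let '(a, b, c) := T in P a /\ P b /\ P c.

Definition corner (T : triangle) : C := fst (fst T).

(** The medial subdivision. The order of the vertices preserves orientation, so that each edge of
    the middle triangle [sub3] is run through in the opposite direction by one corner triangle. *)
Definition sub0 (T : triangle) : triangle :=
  let '(a, b, c) := T in (a, (a + b) / 2, (a + c) / 2)%C.
Definition sub1 (T : triangle) : triangle :=
  let '(a, b, c) := T in ((a + b) / 2, b, (b + c) / 2)%C.
Definition sub2 (T : triangle) : triangle :=
  let '(a, b, c) := T in ((a + c) / 2, (b + c) / 2, c)%C.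
Definition sub3 (T : triangle) : triangle :=
  let '(a, b, c) := T in ((a + b) / 2, (b + c) / 2, (a + c) / 2)%C.

Lemma C2_neq_0 : RtoC 2 <> 0%C.
Proof. intros X; apply RtoC_inj in X; lra. Qed.

Lemma Cmod_half (z : C) : Cmod (z / 2) = Cmod z / 2.
Proof. rewrite Cmod_div, Cmod_R, Rabs_pos_eq by (auto using C2_neq_0; lra); reflexivity. Qed.

Lemma triangle_integral_split (s : R) (f : C -> C) (T : triangle) :
  (forall z, left_of s z -> ccont f z) -> triangle_in (left_of s) T ->
  (triangle_integral f T =
   triangle_integral f (sub0 T) + triangle_integral f (sub1 T) +
   triangle_integral f (sub2 T) + triangle_integral f (sub3 T))%C.
Proof.
  destruct T as [[a b] c]; intros Hf [Ha [Hb Hc]]; simpl.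
  assert (HM : forall x y, left_of s x -> left_of s y -> left_of s ((x + y) / 2)).
  { intros x y Hx Hy.
    replace ((x + y) / 2)%C with (x + RtoC (1 / 2) * (y - x))%C.
    - apply left_of_segment; auto; lra.
    - rewrite RtoC_div by lra; field; apply C2_neq_0. }
  assert (HS : forall x y, left_of s x -> left_of s y ->
     forall t, 0 <= t <= 1 -> ccont f (x + RtoC t * (y - x))).
  { intros; apply Hf, left_of_segment; auto. }
  rewrite (segment_integral_midpoint f a b), (segment_integral_midpoint f b c),
    (segment_integral_midpoint f c a) by auto.
  replace ((c + a) / 2)%C with ((a + c) / 2)%C by (f_equal; ring).
  rewrite (segment_integral_swap f ((a + b) / 2) ((a + c) / 2)) by auto.
  rewrite (segment_integral_swap f ((a + b) / 2) ((b + c) / 2)) by auto.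
  rewrite (segment_integral_swap f ((b + c) / 2) ((a + c) / 2)) by auto.
  ring.
Qed.

(** A piece carrying at least a quarter of the integral. [sub3] serves as default: when the other
    three fall short, the sum over the four pieces forces it to qualify. *)
Definition quarter (f : C -> C) (T : triangle) : triangle :=
  let ok T' := Rle_dec (Cmod (triangle_integral f T)) (4 * Cmod (triangle_integral f T')) in
  if ok (sub0 T) then sub0 T else if ok (sub1 T) then sub1 T
  else if ok (sub2 T) then sub2 T else sub3 T.

Lemma quarter_ind (P : triangle -> Prop) (f : C -> C) (T : triangle) :
  P (sub0 T) -> P (sub1 T) -> P (sub2 T) -> P (sub3 T) -> P (quarter f T).
Proof. intros; unfold quarter; repeat destruct Rle_dec; auto. Qed.

Lemma quarter_integral (s : R) (f : C -> C) (T : triangle) :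
  (forall z, left_of s z -> ccont f z) -> triangle_in (left_of s) T ->
  Cmod (triangle_integral f T) <= 4 * Cmod (triangle_integral f (quarter f T)).
Proof.
  intros Hf HT; unfold quarter.
  destruct Rle_dec as [|n0]; [assumption|]. destruct Rle_dec as [|n1]; [assumption|].
  destruct Rle_dec as [|n2]; [assumption|].
  assert (E := triangle_integral_split s f T Hf HT).
  set (t0 := triangle_integral f (sub0 T)) in *; set (t1 := triangle_integral f (sub1 T)) in *;
  set (t2 := triangle_integral f (sub2 T)) in *; set (t3 := triangle_integral f (sub3 T)) in *.
  assert (B : Cmod (triangle_integral f T) <= Cmod t0 + Cmod t1 + Cmod t2 + Cmod t3).
  { rewrite E; eapply Rle_trans; [apply Cmod_triangle|]; apply Rplus_le_compat_r.
    eapply Rle_trans; [apply Cmod_triangle|]; apply Rplus_le_compat_r, Cmod_triangle. }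
  lra.
Qed.

Lemma quarter_perimeter (f : C -> C) (T : triangle) :
  perimeter (quarter f T) = perimeter T / 2.
Proof.
  assert (n2 := C2_neq_0).
  (* Every side of a piece is, up to sign, half of a side of [T]; the alternatives below find which
     one. *)
  destruct T as [[a b] c]; apply quarter_ind; simpl;
    match goal with |- Cmod ?x + Cmod ?y + Cmod ?z = _ =>
      first [ replace x with ((b - a) / 2)%C by (field; auto)
            | replace x with ((c - a) / 2)%C by (field; auto)
            | replace x with ((c - b) / 2)%C by (field; auto)
            | replace x with ((a - b) / 2)%C by (field; auto)
            | replace x with (- ((a - c) / 2))%C by (field; auto) ];
      first [ replace y with ((c - b) / 2)%C by (field; auto)
            | replace y with ((a - b) / 2)%C by (field; auto)
            | replace y with ((c - a) / 2)%C by (field; auto) ];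
      first [ replace z with ((a - c) / 2)%C by (field; auto)
            | replace z with ((b - c) / 2)%C by (field; auto)
            | replace z with ((b - a) / 2)%C by (field; auto)
            | replace z with ((a - b) / 2)%C by (field; auto) ]
    end; rewrite ?Cmod_opp, !Cmod_half;
    rewrite ?(Cmod_minus_sym a b), ?(Cmod_minus_sym b c), ?(Cmod_minus_sym c a); lra.
Qed.

Lemma quarter_re_le (f : C -> C) (m : R) (T : triangle) :
  triangle_in (fun z => Re z <= m) T -> triangle_in (fun z => Re z <= m) (quarter f T).
Proof.
  assert (M : forall x y, Re x <= m -> Re y <= m -> Re ((x + y) / 2) <= m).
  { intros x y Hx Hy.
    replace ((x + y) / 2)%C with (x + RtoC (1 / 2) * (y - x))%C.
    - apply re_segment_le; auto; lra.
    - rewrite RtoC_div by lra; field; apply C2_neq_0. }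
  destruct T as [[a b] c]; intros [Ha [Hb Hc]]; apply quarter_ind; repeat split; auto.
Qed.

Lemma quarter_corner (f : C -> C) (T : triangle) :
  Cmod (corner (quarter f T) - corner T) <= perimeter T.
Proof.
  assert (n2 := C2_neq_0).
  destruct T as [[a b] c].
  assert (H1 := Cmod_ge_0 (b - a)); assert (H2 := Cmod_ge_0 (c - b));
    assert (H3 := Cmod_ge_0 (a - c)).
  assert (HB : Cmod ((a + b) / 2 - a) <= perimeter (a, b, c)).
  { replace ((a + b) / 2 - a)%C with ((b - a) / 2)%C by (field; auto).
    rewrite Cmod_half; simpl; lra. }
  apply quarter_ind; unfold corner; simpl fst; try exact HB.
  - replace (a - a)%C with (RtoC 0) by ring; rewrite Cmod_0; simpl; lra.
  - replace ((a + c) / 2 - a)%C with (- ((a - c) / 2))%C by (field; auto).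
    rewrite Cmod_opp, Cmod_half; simpl; lra.
Qed.

(** The intervals of radius [2 d / 2^n] around [x n], the sum of the remaining steps, are nested;
    the limit is the supremum of their left endpoints. *)
Lemma geometric_limit_R (x : nat -> R) (d : R) :
  (forall n, Rabs (x (S n) - x n) <= d / 2 ^ n) ->
  exists p, forall n, Rabs (x n - p) <= 2 * d / 2 ^ n.
Proof.
  intros H.
  assert (P2 : forall n, 0 < 2 ^ n) by (intros; apply pow_lt; lra).
  assert (E2 : forall n, 2 * d / 2 ^ S n = d / 2 ^ n).
  { intros n; simpl; field; assert (T := P2 n); lra. }
  assert (E3 : forall n, 2 * d / 2 ^ n = 2 * (d / 2 ^ n)).
  { intros n; field; assert (T := P2 n); lra. }
  assert (A : forall n k, x n - 2 * d / 2 ^ n <= x (n + k)%nat - 2 * d / 2 ^ (n + k)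
                /\ x (n + k)%nat + 2 * d / 2 ^ (n + k) <= x n + 2 * d / 2 ^ n).
  { intros n k; induction k as [|k IH].
    - rewrite Nat.add_0_r; lra.
    - replace (n + S k)%nat with (S (n + k)) by lia.
      rewrite E2. rewrite (E3 (n + k)%nat) in IH.
      assert (T := H (n + k)%nat); apply Rabs_le_between in T; lra. }
  assert (D0 : forall n, 0 <= d / 2 ^ n).
  { intros n; eapply Rle_trans; [apply Rabs_pos | apply H]. }
  assert (B : forall m n, x m - 2 * d / 2 ^ m <= x n + 2 * d / 2 ^ n).
  { intros m n.
    destruct (A m n) as [A1 _]; destruct (A n m) as [_ A2].
    rewrite (Nat.add_comm n m) in A2.
    assert (T := D0 (m + n)%nat); assert (T' := E3 (m + n)%nat); lra. }
  destruct (completeness (fun y => exists n, y = x n - 2 * d / 2 ^ n)) as [p [Hp1 Hp2]].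
  - exists (x 0%nat + 2 * d / 2 ^ 0); intros y [n ->]; apply B.
  - exists (x 0%nat - 2 * d / 2 ^ 0); now exists 0%nat.
  - exists p; intros n; apply Rabs_le_between; split.
    + assert (T : p <= x n + 2 * d / 2 ^ n) by (apply Hp2; intros y [m ->]; apply B). lra.
    + assert (T : x n - 2 * d / 2 ^ n <= p) by (apply Hp1; now exists n). lra.
Qed.

Lemma geometric_limit (x : nat -> C) (d : R) :
  (forall n, Cmod (x (S n) - x n) <= d / 2 ^ n) ->
  exists p, forall n, Cmod (x n - p) <= 4 * d / 2 ^ n.
Proof.
  intros H.
  destruct (geometric_limit_R (fun n => Re (x n)) d) as [p Hp].
  { intros n; eapply Rle_trans; [|apply (H n)]. eapply Rle_trans; [|apply re_le_Cmod].
    right; reflexivity. }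
  destruct (geometric_limit_R (fun n => Im (x n)) d) as [q Hq].
  { intros n; eapply Rle_trans; [|apply (H n)]. eapply Rle_trans; [|apply im_le_Cmod].
    right; reflexivity. }
  exists (p, q); intros n.
  eapply Rle_trans; [apply Cmod_le_abs|].
  assert (A := Hp n); assert (B := Hq n).
  replace (4 * d / 2 ^ n) with (2 * d / 2 ^ n + 2 * d / 2 ^ n)
    by (field; apply pow_nonzero; lra).
  apply Rplus_le_compat; assumption.
Qed.

Lemma segment_integral_close (f : C -> C) (al be a b : C) (e : R) :
  (forall t, 0 <= t <= 1 -> ccont f (a + RtoC t * (b - a))) ->
  (forall t, 0 <= t <= 1 -> let z := (a + RtoC t * (b - a))%C in
     Cmod (f z - (al + be * z)) <= e) ->
  Cmod (segment_integral f a b - segment_integral (fun z => al + be * z)%C a b)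
    <= Cmod (b - a) * e.
Proof.
  intros H1 H2; unfold segment_integral.
  assert (Ca : forall z, ccont (fun z => al + be * z)%C z).
  { intros z; apply ccont_plus; [apply ccont_const|].
    apply ccont_mult; [apply ccont_const | apply ccont_id]. }
  assert (I1 := segment_cintegrable f a b H1).
  assert (I2 := segment_cintegrable (fun z => al + be * z)%C a b (fun t _ => Ca _)).
  assert (I3 := cintegrable_scal (- (1))%C _ I2).
  assert (E := CI_plus _ _ I1 I3); rewrite (CI_scal _ _ I2) in E; cbv beta in E.
  match goal with |- Cmod (_ * ?x - _ * ?y) <= _ =>
    replace ((b - a) * x - (b - a) * y)%C with ((b - a) * (x + - (1) * y))%C by ring end.
  rewrite <- E, Cmod_mult; apply Rmult_le_compat_l; [apply Cmod_ge_0|].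
  apply CI_bound; [now apply cintegrable_plus|].
  intros t Ht; specialize (H2 t Ht); cbv zeta in H2.
  eapply Rle_trans; [|exact H2]; right; f_equal; ring.
Qed.

(** Repeated quartering leaves at least [4^-n] of the integral on a triangle of perimeter
    [q = d / 2^n]. Near the limit point [f] differs by at most [5 q eps] from an affine function,
    whose integral vanishes, so the integral over the small triangle is at most [5 q^2 eps]. Since
    [4^n q^2 = d^2], the original integral is at most [5 d^2 eps] for every [eps]. *)
Lemma goursat (s : R) (f : C -> C) (T : triangle) :
  (forall z, left_of s z -> exists l, cderiv f z l) ->
  triangle_in (left_of s) T -> triangle_integral f T = 0%C.
Proof.
  intros Hf HT.
  assert (Cf : forall z, left_of s z -> ccont f z).
  { intros z Hz; destruct (Hf z Hz) as [l Hl]; eapply cderiv_ccont; eauto. }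
  (* A closed half-plane inside the open one: the limit of the nested triangles cannot leave it, and
     so stays where [f] is differentiable. *)
  assert (Hm : exists m, m < s /\ triangle_in (fun z => Re z <= m) T).
  { destruct T as [[a b] c]; destruct HT as [Ha [Hb Hc]]; unfold left_of in *.
    exists (Rmax (Re a) (Rmax (Re b) (Re c))); split.
    - repeat apply Rmax_lub_lt; auto.
    - simpl; repeat split; eauto using Rle_trans, Rmax_l, Rmax_r. }
  destruct Hm as [m [ms Hm]].
  set (Tn := fun n => Nat.iter n (quarter f) T).
  set (d := perimeter T).
  assert (Hre : forall n, triangle_in (fun z => Re z <= m) (Tn n)).
  { induction n as [|n IH]; [exact Hm | apply quarter_re_le; exact IH]. }
  assert (Hleft : forall n, triangle_in (left_of s) (Tn n)).
  { intros n; specialize (Hre n); destruct (Tn n) as [[a b] c]; simpl in *; unfold left_of; lra. }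
  assert (Hper : forall n, perimeter (Tn n) = d / 2 ^ n).
  { induction n as [|n IH]; [unfold d; simpl; field|].
    change (Tn (S n)) with (quarter f (Tn n)); rewrite quarter_perimeter, IH.
    simpl; field; apply pow_nonzero; lra. }
  assert (Hint : forall n, Cmod (triangle_integral f T) <= 4 ^ n * Cmod (triangle_integral f (Tn n))).
  { induction n as [|n IH]; [simpl; lra|].
    eapply Rle_trans; [exact IH|].
    change (Tn (S n)) with (quarter f (Tn n)).
    replace (4 ^ S n) with (4 ^ n * 4) by (simpl; ring).
    rewrite Rmult_assoc; apply Rmult_le_compat_l; [apply pow_le; lra|].
    apply quarter_integral with s; auto. }
  destruct (geometric_limit (fun n => corner (Tn n)) d) as [p Hp].
  { intros n; rewrite <- Hper; apply quarter_corner. }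
  assert (d0 : 0 <= d).
  { unfold d; destruct T as [[a b] c]; simpl.
    assert (H1 := Cmod_ge_0 (b - a)); assert (H2 := Cmod_ge_0 (c - b));
    assert (H3 := Cmod_ge_0 (a - c)); lra. }
  assert (Hsmall : forall e, 0 < e -> exists n, d / 2 ^ n < e).
  { intros e He.
    destruct (Pow_x_infinity 2 ltac:(rewrite Rabs_pos_eq; lra) (d / e + 1)) as [n Hn].
    exists n; specialize (Hn n (le_n n)).
    assert (P : 0 < 2 ^ n) by (apply pow_lt; lra).
    rewrite Rabs_pos_eq in Hn by lra.
    apply Rmult_lt_reg_r with (2 ^ n); auto.
    replace (d / 2 ^ n * 2 ^ n) with d by (field; lra).
    assert (d / e * e = d) by (field; lra). nra. }
  assert (Hpm : left_of s p).
  { unfold left_of; destruct (Rlt_or_le (Re p) s) as [|L]; auto; exfalso.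
    destruct (Hsmall ((s - m) / 4)) as [n Hn]; [lra|].
    assert (A := Hp n). assert (B := Hre n).
    destruct (Tn n) as [[a b] c]; unfold corner in A; simpl in A, B.
    assert (A2 := re_le_Cmod (a - p)).
    unfold Cminus in A2; rewrite re_plus, re_opp in A2; fold (a - p)%C in A2.
    apply Rabs_le_between in A2.
    replace (4 * d / 2 ^ n) with (4 * (d / 2 ^ n)) in A by (field; apply pow_nonzero; lra).
    lra. }
  destruct (Hf p Hpm) as [l Hl].
  assert (Fin : forall eps, 0 < eps -> Cmod (triangle_integral f T) <= 5 * d * d * eps).
  { intros eps He.
    destruct (proj1 (cderiv_eps _ _ _) Hl eps He) as [k [k0 Hk]].
    (* A corner lies within [4 q] of the limit point [p], and the sides lie within [q] of that
       corner; this is the origin of the factor 5. *)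
    destruct (Hsmall (k / 5)) as [n Hn]; [lra|].
    specialize (Hint n); specialize (Hper n); specialize (Hleft n); specialize (Hp n).
    destruct (Tn n) as [[a b] c].
    unfold corner in Hp; simpl in Hp, Hleft, Hper; simpl triangle_integral in Hint at 2.
    set (q := d / 2 ^ n) in *.
    assert (q0 : 0 <= q) by (apply Rmult_le_pos; auto; left; apply Rinv_0_lt_compat, pow_lt; lra).
    replace (4 * d / 2 ^ n) with (4 * q) in Hp by (unfold q; field; apply pow_nonzero; lra).
    assert (S1 := Cmod_ge_0 (b - a)); assert (S2 := Cmod_ge_0 (c - b));
      assert (S3 := Cmod_ge_0 (a - c)).
    assert (Bv : forall x, x = a \/ x = b \/ x = c -> Cmod (x - a) <= q).
    { intros x [-> | [-> | ->]].
      - replace (a - a)%C with (RtoC 0) by ring; rewrite Cmod_0; lra.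
      - lra.
      - rewrite Cmod_minus_sym; lra. }
    set (al := (f p - l * p)%C).
    assert (Close : forall x y, (x = a \/ x = b \/ x = c) -> (y = a \/ y = b \/ y = c) ->
      Cmod (segment_integral f x y - segment_integral (fun z => al + l * z)%C x y)
        <= Cmod (y - x) * (eps * (5 * q))).
    { intros x y Hx Hy; apply segment_integral_close.
      - intros t Ht; apply Cf, left_of_segment; auto;
          [destruct Hx as [-> | [-> | ->]] | destruct Hy as [-> | [-> | ->]]]; tauto.
      - intros t Ht z.
        assert (Hz : Cmod (z - p) <= 5 * q).
        { replace (z - p)%C with ((a - p) + (RtoC (1 - t) * (x - a) + RtoC t * (y - a)))%C
            by (unfold z; rewrite RtoC_minus; ring).
          eapply Rle_trans; [apply Cmod_triangle|].
          assert (Cmod (RtoC (1 - t) * (x - a) + RtoC t * (y - a)) <= q).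
          { eapply Rle_trans; [apply Cmod_triangle|].
            rewrite !Cmod_mult, !Cmod_R, !Rabs_pos_eq by lra.
            assert (X := Bv x Hx); assert (Y := Bv y Hy). nra. }
          lra. }
        specialize (Hk z ltac:(lra)).
        replace (f z - (al + l * z))%C with (f z - f p - l * (z - p))%C by (unfold al; ring).
        nra. }
    assert (C1 := Close a b ltac:(tauto) ltac:(tauto)).
    assert (C2 := Close b c ltac:(tauto) ltac:(tauto)).
    assert (C3 := Close c a ltac:(tauto) ltac:(tauto)).
    assert (Ez : (segment_integral (fun z => al + l * z) a b
                + segment_integral (fun z => al + l * z) b c
                + segment_integral (fun z => al + l * z) c a = 0)%C).
    { rewrite !segment_integral_affine; field; apply C2_neq_0. }
    set (i1 := segment_integral (fun z => al + l * z)%C a b) in *.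
    set (i2 := segment_integral (fun z => al + l * z)%C b c) in *.
    set (i3 := segment_integral (fun z => al + l * z)%C c a) in *.
    assert (B : Cmod (segment_integral f a b + segment_integral f b c + segment_integral f c a)
                <= q * (eps * (5 * q))).
    { replace (segment_integral f a b + segment_integral f b c + segment_integral f c a)%C
        with ((segment_integral f a b - i1) + (segment_integral f b c - i2)
              + (segment_integral f c a - i3) + (i1 + i2 + i3))%C by ring.
      rewrite Ez, Cplus_0_r.
      eapply Rle_trans; [apply Cmod_triangle|].
      eapply Rle_trans; [apply Rplus_le_compat_r, Cmod_triangle|].
      rewrite <- Hper; rewrite (Rmult_plus_distr_r _ (Cmod (a - c))), Rmult_plus_distr_r.
      rewrite Hper; lra. }
    eapply Rle_trans; [exact Hint|].
    apply Rle_trans with (4 ^ n * (q * (eps * (5 * q)))).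
    - apply Rmult_le_compat_l; auto; apply pow_le; lra.
    - right. replace (4 ^ n) with (2 ^ n * 2 ^ n) by (rewrite <- Rpow_mult_distr; f_equal; ring).
      unfold q; field; apply pow_nonzero; lra. }
  apply Cmod_eq_0.
  destruct (Req_dec (Cmod (triangle_integral f T)) 0) as [|N]; auto; exfalso.
  assert (G := Cmod_ge_0 (triangle_integral f T)).
  set (x := Cmod (triangle_integral f T)) in *.
  assert (Q : 0 < 10 * (d * d + 1)) by nra.
  specialize (Fin (x / (10 * (d * d + 1))) ltac:(apply Rdiv_lt_0_compat; lra)).
  assert (E : x / (10 * (d * d + 1)) * (10 * (d * d + 1)) = x) by (field; lra).
  set (y := x / (10 * (d * d + 1))) in *.
  assert (0 < y) by (apply Rdiv_lt_0_compat; lra).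
  nra.
Qed.

(** * Mean values and regularity of holomorphic functions *)

Definition unit_circle (s : R) : C := cexp (0, 2 * PI * s).

Lemma Cmod_unit_circle (s : R) : Cmod (unit_circle s) = 1.
Proof. unfold unit_circle; rewrite Cmod_cexp; apply exp_0. Qed.

Lemma cexp_period (z : C) : cexp (z + (0, 2 * PI)) = cexp z.
Proof.
  rewrite cexp_plus.
  replace (cexp (0, 2 * PI)) with (RtoC 1); [ring|].
  unfold cexp; simpl; rewrite exp_0, cos_2PI, sin_2PI; unfold RtoC; f_equal; ring.
Qed.

Lemma cexp_on_circle (t s : R) :
  0 < t -> cexp (RtoC (ln t) + RtoC s * (0, 2 * PI)) = (RtoC t * unit_circle s)%C.
Proof.
  intros Ht; rewrite cexp_plus; f_equal.
  - unfold cexp; simpl; rewrite exp_ln, cos_0, sin_0 by auto; unfold RtoC; f_equal; ring.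
  - unfold unit_circle; f_equal; unfold RtoC, Cmult; simpl; f_equal; ring.
Qed.

(* In the logarithmic coordinate [z = c + exp w] the circles about [c] become
   vertical segments of length [2 pi], so Cauchy's theorem on triangles in a
   half-plane and periodicity show that the mean of [f] does not depend on the
   radius. *)
Lemma mean_value (f : C -> C) (c L : C) (r t : R) :
  (forall z, 0 < Cmod (z - c) < r -> exists l, cderiv f z l) ->
  (forall eps, 0 < eps -> exists d, 0 < d /\ forall z,
     0 < Cmod (z - c) < d -> Cmod (f z - L) < eps) ->
  0 < t < r ->
  cintegrable (fun s => f (c + RtoC t * unit_circle s)%C) /\
  CI (fun s => f (c + RtoC t * unit_circle s)%C) = L.
Proof.
  intros Hf HL Ht.
  set (g := fun w => f (c + cexp w)%C).
  set (P := (0, 2 * PI) : C).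
  assert (HP : P <> 0%C).
  { unfold P, RtoC; intros E; injection E; assert (T := PI_RGT_0); lra. }
  assert (Hexp : forall w, left_of (ln r) w -> Cmod (c + cexp w - c) < r).
  { intros w Hw; replace (c + cexp w - c)%C with (cexp w) by ring.
    rewrite Cmod_cexp, <- (exp_ln r) by lra; now apply exp_increasing. }
  assert (Hpos : forall w, 0 < Cmod (c + cexp w - c)).
  { intros w; replace (c + cexp w - c)%C with (cexp w) by ring.
    rewrite Cmod_cexp; apply exp_pos. }
  assert (Hg : forall w, left_of (ln r) w -> exists l, cderiv g w l).
  { intros w Hw; destruct (Hf (c + cexp w)%C) as [l Hl]; [split; auto|].
    exists (l * (0 + cexp w))%C.
    apply (cderiv_comp (fun w => c + cexp w)%C f); auto.
    apply cderiv_plus; [apply cderiv_const | apply cderiv_cexp]. }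
  assert (Cg : forall w, left_of (ln r) w -> ccont g w).
  { intros w Hw; destruct (Hg w Hw); eapply cderiv_ccont; eauto. }
  assert (Hper : forall w, g (w + P)%C = g w) by (intros; unfold g, P; now rewrite cexp_period).
  set (J := fun u : R => CI (fun s => g (RtoC u + RtoC s * P)%C)).
  assert (HJ : forall u : R, segment_integral g u (RtoC u + P) = (P * J u)%C).
  { intros u; unfold segment_integral, J; f_equal; [ring|].
    apply CI_ext; intros; f_equal; ring. }
  assert (HlP : forall u : R, left_of (ln r) u -> left_of (ln r) (RtoC u + P)%C).
  { intros u; unfold left_of; rewrite re_plus; unfold P; simpl; lra. }
  assert (Hconst : forall u v : R, u < ln r -> v < ln r -> J u = J v).
  { intros u v Hu Hv.
    assert (Lu : left_of (ln r) u) by exact Hu. assert (Lv : left_of (ln r) v) by exact Hv.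
    (* The two triangles form the parallelogram with vertices [u], [v], [v + P], [u + P]; the
       integrals along its diagonal cancel. *)
    assert (G1 := goursat (ln r) g (RtoC u, RtoC v, RtoC v + P)%C Hg
      (conj Lu (conj Lv (HlP v Lv)))).
    assert (G2 := goursat (ln r) g (RtoC u, RtoC v + P, RtoC u + P)%C Hg
      (conj Lu (conj (HlP v Lv) (HlP u Lu)))).
    assert (HS : forall x y, left_of (ln r) x -> left_of (ln r) y ->
       forall t, 0 <= t <= 1 -> ccont g (x + RtoC t * (y - x))).
    { intros; apply Cg, left_of_segment; auto. }
    simpl in G1, G2.
    rewrite (segment_integral_swap g u (RtoC v + P)) in G1 by auto.
    rewrite (segment_integral_swap g u (RtoC u + P)) in G2 by auto.
    rewrite HJ in G1, G2.
    (* By periodicity the side shifted by [P], run through backwards, cancels the side from [u] to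
       [v]. *)
    replace (segment_integral g (RtoC v + P) (RtoC u + P))
      with (- segment_integral g u v)%C in G2.
    2:{ rewrite <- segment_integral_swap by auto.
        unfold segment_integral; f_equal; [ring|]. apply CI_ext; intros s Hs.
        rewrite <- Hper; f_equal; ring. }
    apply Cminus_eq_0.
    assert (E : (P * (J u - J v) = 0)%C).
    { replace (P * (J u - J v))%C with (P * J u - P * J v)%C by ring.
      set (X := segment_integral g u v) in *.
      set (Y := segment_integral g u (RtoC v + P)) in *.
      replace (P * J u - P * J v)%C
        with (- (X + P * J v + - Y) - (Y + - X + - (P * J u)))%C by ring.
      rewrite G1, G2; ring. }
    apply NNPP; intros N; apply (Cmult_neq_0 _ _ HP N E). }
  assert (Hint : forall u : R, u < ln r -> cintegrable (fun s => g (RtoC u + RtoC s * P)%C)).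
  { intros u Hu; apply rcont_cintegrable; intros s Hs.
    apply (rcont_comp g (fun s => RtoC u + RtoC s * P)%C).
    - eapply rderiv_rcont, rderiv_segment.
    - apply Cg; unfold left_of; rewrite re_plus; unfold P, RtoC, Cmult; simpl; lra. }
  assert (HJL : forall u : R, u < ln r -> J u = L).
  { intros u Hu; apply NNPP; intros N.
    assert (p : 0 < Cmod (J u - L)) by now apply Cmod_gt_0, Cminus_neq_0.
    destruct (HL (Cmod (J u - L) / 2) ltac:(lra)) as [d [d0 Hd]].
    (* On the circle of radius [k] the function is within half of [|J u - L|] of [L], hence so is
       its mean [J (ln k) = J u]. *)
    set (k := Rmin (d / 2) (r / 2)).
    assert (k0 : 0 < k) by (apply Rmin_pos; lra).
    assert (k1 : k <= d / 2) by apply Rmin_l.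
    assert (k2 : k <= r / 2) by apply Rmin_r.
    assert (lk : ln k < ln r) by (apply ln_increasing; lra).
    assert (B : Cmod (J (ln k) - L) <= Cmod (J u - L) / 2).
    { unfold J.
      assert (I := Hint _ lk).
      assert (E := CI_plus _ _ I (cintegrable_const (- L))); rewrite CI_const in E.
      change (Cmod (CI (fun s => g (RtoC (ln k) + RtoC s * P)%C) + - L) <= Cmod (J u - L) / 2).
      rewrite <- E; apply CI_bound.
      - apply cintegrable_plus; auto; apply cintegrable_const.
      - intros s Hs; left; apply Hd; unfold P; rewrite cexp_on_circle by auto.
        replace (c + RtoC k * unit_circle s - c)%C with (RtoC k * unit_circle s)%C by ring.
        rewrite Cmod_mult, Cmod_R, Cmod_unit_circle, Rabs_pos_eq; lra. }
    rewrite (Hconst (ln k) u lk Hu) in B; lra. }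
  assert (lt : ln t < ln r) by (apply ln_increasing; lra).
  assert (Ex : forall s, g (RtoC (ln t) + RtoC s * P)%C = f (c + RtoC t * unit_circle s)%C).
  { intros s; unfold g, P; rewrite cexp_on_circle by lra; reflexivity. }
  split.
  - assert (I := Hint _ lt); destruct I as [I1 I2]; split;
      [revert I1 | revert I2]; apply ex_RInt_ext; intros; now rewrite Ex.
  - rewrite <- (HJL (ln t) lt); apply CI_ext; intros; now rewrite Ex.
Qed.

Lemma circle_point (c : C) (t s : R) :
  0 < t -> Cmod (c + RtoC t * unit_circle s - c) = t.
Proof.
  intros Ht; replace (c + RtoC t * unit_circle s - c)%C with (RtoC t * unit_circle s)%C by ring.
  rewrite Cmod_mult, Cmod_R, Cmod_unit_circle, Rabs_pos_eq; lra.
Qed.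

Definition hol_ball (f : C -> C) (c : C) (r : R) : Prop :=
  forall z, Cmod (z - c) < r -> exists l, cderiv f z l.

Lemma hol_ball_mean (f : C -> C) (c : C) (r t : R) :
  hol_ball f c r -> 0 < t < r ->
  cintegrable (fun s => f (c + RtoC t * unit_circle s)%C) /\
  CI (fun s => f (c + RtoC t * unit_circle s)%C) = f c.
Proof.
  intros Hf Ht; apply mean_value with r; auto.
  - intros z Hz; apply Hf; lra.
  - intros eps He.
    destruct (Hf c) as [l Hl].
    { replace (c - c)%C with (RtoC 0) by ring; rewrite Cmod_0; lra. }
    destruct (cderiv_ccont _ _ _ Hl eps He) as [d [d0 Hd]].
    exists d; split; auto; intros z Hz; apply Hd; lra.
Qed.

(** The mean value property of the difference quotient, whose limit at [c] is [l]. It takes the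
    place of Cauchy's integral formula for the derivative. *)
Lemma derivative_mean (f : C -> C) (c l : C) (r t : R) :
  hol_ball f c r -> cderiv f c l -> 0 < t < r ->
  let q := fun s => ((f (c + RtoC t * unit_circle s) - f c) / (RtoC t * unit_circle s))%C in
  cintegrable q /\ CI q = l.
Proof.
  intros Hf Hl Ht q.
  destruct (mean_value (fun z => (f z - f c) / (z - c))%C c l r t) as [I E]; auto.
  - intros z Hz; destruct (Hf z) as [m Hm]; [lra|].
    assert (n : (z - c <> 0)%C) by now apply Cmod_gt_0.
    eexists; apply cderiv_mult.
    + apply cderiv_minus; [exact Hm | apply cderiv_const].
    + apply cderiv_inv; auto; apply cderiv_minus; [apply cderiv_id | apply cderiv_const].
  - intros eps He.
    destruct (proj1 (cderiv_eps _ _ _) Hl (eps / 2) ltac:(lra)) as [d [d0 Hd]].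
    exists d; split; auto; intros z Hz; specialize (Hd z ltac:(lra)).
    assert (n : (z - c <> 0)%C) by now apply Cmod_gt_0.
    replace ((f z - f c) / (z - c) - l)%C with ((f z - f c - l * (z - c)) / (z - c))%C
      by (field; auto).
    rewrite Cmod_div by auto.
    apply Rle_lt_trans with (eps / 2); [|lra].
    apply Rmult_le_reg_r with (Cmod (z - c)); [lra|].
    unfold Rdiv at 1; rewrite Rmult_assoc, Rinv_l; lra.
  - assert (Eq : forall s, ((f (c + RtoC t * unit_circle s) - f c)
        / (c + RtoC t * unit_circle s - c))%C = q s).
    { intros s; unfold q.
      replace (c + RtoC t * unit_circle s - c)%C with (RtoC t * unit_circle s)%C by ring.
      reflexivity. }
    split.
    + destruct I as [I1 I2]; split; [revert I1 | revert I2]; apply ex_RInt_ext;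
        intros; now rewrite Eq.
    + rewrite <- E; apply CI_ext; intros; now rewrite Eq.
Qed.

(** Cauchy's estimate, in terms of the oscillation of [f] only. *)
Lemma derivative_bound (f : C -> C) (c l : C) (r t M : R) :
  hol_ball f c r -> cderiv f c l -> 0 < t < r ->
  (forall z, Cmod (z - c) = t -> Cmod (f z - f c) <= M) -> Cmod l <= M / t.
Proof.
  intros Hf Hl Ht HM.
  destruct (derivative_mean f c l r t Hf Hl Ht) as [I E].
  rewrite <- E; apply CI_bound; auto; intros s Hs.
  assert (n : (RtoC t * unit_circle s <> 0)%C).
  { apply Cmod_gt_0; rewrite Cmod_mult, Cmod_R, Cmod_unit_circle, Rabs_pos_eq; lra. }
  rewrite Cmod_div, Cmod_mult, Cmod_R, Cmod_unit_circle, Rabs_pos_eq, Rmult_1_r by (auto; lra).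
  apply Rmult_le_compat_r; [left; apply Rinv_0_lt_compat; lra|].
  apply HM, circle_point; lra.
Qed.

Lemma hol_ball_sub (f : C -> C) (c d : C) (r t : R) :
  hol_ball f c r -> Cmod (d - c) + t <= r -> hol_ball f d t.
Proof.
  intros Hf H z Hz; apply Hf.
  replace (z - c)%C with ((z - d) + (d - c))%C by ring.
  eapply Rle_lt_trans; [apply Cmod_triangle|]; lra.
Qed.

Lemma Cmod_self (c : C) : Cmod (c - c) = 0.
Proof. replace (c - c)%C with (RtoC 0) by ring; apply Cmod_0. Qed.

(** Continuity of [f'] is a conclusion here. A first use of Cauchy's estimate bounds [f'] and so
    makes [f] Lipschitz; a second one, for the difference of two translates of [f], passes the
    Lipschitz bound on to [f']. *)
Lemma derivative_locally_lipschitz (f f' : C -> C) (c : C) (r : R) :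
  0 < r -> (forall z, Cmod (z - c) < r -> cderiv f z (f' z)) ->
  exists d K, 0 < d <= r /\ 0 < K /\
    (forall z w, Cmod (z - c) < d -> Cmod (w - c) < d ->
       Cmod (f' z - f' w) <= K * Cmod (z - w)).
Proof.
  intros Hr Hf.
  assert (Hh : hol_ball f c r) by (intros z Hz; eauto).
  assert (Cc : ccont f c).
  { eapply cderiv_ccont, Hf; rewrite Cmod_self; auto. }
  destruct (Cc 1 Rlt_0_1) as [r0 [r00 Hr0]].
  (* A circle of radius [2 k] around a point within [2 k] of [c] stays in the disc of radius [4 k],
     where [f] is defined and varies by less than 1 from [f c]. *)
  set (k := Rmin r r0 / 4).
  assert (k0 : 0 < k) by (apply Rdiv_lt_0_compat; [apply Rmin_pos; auto | lra]).
  assert (k1 : 4 * k <= r) by (unfold k; assert (T := Rmin_l r r0); lra).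
  assert (k2 : 4 * k <= r0) by (unfold k; assert (T := Rmin_r r r0); lra).
  assert (B1 : forall z, Cmod (z - c) < 2 * k -> Cmod (f' z) <= 2 / k).
  { intros z Hz.
    apply derivative_bound with f z (2 * k); [|apply Hf; lra|lra|].
    - apply hol_ball_sub with c r; auto; lra.
    - intros w Hw.
      assert (A := Hr0 z ltac:(lra)).
      assert (B : Cmod (f w - f c) < 1).
      { apply Hr0; replace (w - c)%C with ((w - z) + (z - c))%C by ring.
        eapply Rle_lt_trans; [apply Cmod_triangle|]; lra. }
      replace (f w - f z)%C with ((f w - f c) + - (f z - f c))%C by ring.
      eapply Rle_trans; [apply Cmod_triangle|]; rewrite Cmod_opp; lra. }
  assert (B2 : forall z w, Cmod (z - c) < 2 * k -> Cmod (w - c) < 2 * k ->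
     Cmod (f z - f w) <= 2 / k * Cmod (z - w)).
  { intros z w Hz Hw; apply Cmvt with f'; intros t Ht u.
    assert (Hu : Cmod (u - c) < 2 * k) by now apply ball_segment.
    split; [apply Hf; lra | auto]. }
  assert (p0 : 0 < 2 / k) by (apply Rdiv_lt_0_compat; lra).
  exists k, (2 * (2 / k) / k); repeat split; try lra.
  { apply Rdiv_lt_0_compat; lra. }
  intros z w Hz Hw.
  (* Cauchy's estimate for [x |-> f (x + z) - f (x + w)], which is bounded by
     the Lipschitz constant of [f] times [|z - w|]. *)
  assert (Hd : cderiv (fun x => f (x + z) - f (x + w))%C 0 (f' z * (1 + 0) - f' w * (1 + 0))).
  { apply cderiv_minus.
    - apply (cderiv_comp (fun x => x + z)%C f).
      + apply cderiv_plus; [apply cderiv_id | apply cderiv_const].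
      + replace (0 + z)%C with z by ring; apply Hf; lra.
    - apply (cderiv_comp (fun x => x + w)%C f).
      + apply cderiv_plus; [apply cderiv_id | apply cderiv_const].
      + replace (0 + w)%C with w by ring; apply Hf; lra. }
  replace (f' z * (1 + 0) - f' w * (1 + 0))%C with (f' z - f' w)%C in Hd by ring.
  replace (2 * (2 / k) / k * Cmod (z - w)) with ((2 * (2 / k) * Cmod (z - w)) / k)
    by (field; lra).
  assert (Hin : forall a x, Cmod (a - c) < k -> Cmod x <= k -> Cmod (x + a - c) < 2 * k).
  { intros a x Ha Hx; replace (x + a - c)%C with (x + (a - c))%C by ring.
    eapply Rle_lt_trans; [apply Cmod_triangle|]; lra. }
  apply derivative_bound with (fun x => f (x + z) - f (x + w))%C (RtoC 0) (2 * k); auto; try lra.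
  - intros x Hx; replace (x - 0)%C with x in Hx by ring.
    assert (Hin2 : forall a, Cmod (a - c) < k -> Cmod (x + a - c) < r).
    { intros a Ha; replace (x + a - c)%C with (x + (a - c))%C by ring.
      eapply Rle_lt_trans; [apply Cmod_triangle|]; lra. }
    eexists; apply cderiv_minus.
    + apply (cderiv_comp (fun x => x + z)%C f); [|apply Hf; auto].
      apply cderiv_plus; [apply cderiv_id | apply cderiv_const].
    + apply (cderiv_comp (fun x => x + w)%C f); [|apply Hf; auto].
      apply cderiv_plus; [apply cderiv_id | apply cderiv_const].
  - intros x Hx; replace (x - 0)%C with x in Hx by ring.
    assert (X := B2 (x + z)%C (x + w)%C ltac:(apply Hin; lra) ltac:(apply Hin; lra)).
    assert (Y := B2 (0 + z)%C (0 + w)%C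
      ltac:(apply Hin; rewrite ?Cmod_0; lra) ltac:(apply Hin; rewrite ?Cmod_0; lra)).
    replace (x + z - (x + w))%C with (z - w)%C in X by ring.
    replace (0 + z - (0 + w))%C with (z - w)%C in Y by ring.
    eapply Rle_trans; [apply Cmod_triangle|]; rewrite Cmod_opp; lra.
Qed.

(** The mean value inequality for [f w - f' z * w], whose derivative is at most [K |h|] on the
    segment. *)
Lemma taylor1_bound (f f' : C -> C) (z h : C) (K : R) :
  (forall t, 0 <= t <= 1 -> let w := (z + RtoC t * h)%C in
     cderiv f w (f' w) /\ Cmod (f' w - f' z) <= K * Cmod (w - z)) ->
  0 <= K -> Cmod (f (z + h)%C - f z - h * f' z) <= K * Cmod h * Cmod h.
Proof.
  intros H HK.
  assert (X := Cmvt (fun w => f w - f' z * w)%C (fun w => f' w - f' z * 1)%C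
    z (z + h)%C (K * Cmod h)).
  replace (z + h - z)%C with h in X by ring.
  replace (f (z + h)%C - f z - h * f' z)%C
    with (f (z + h) - f' z * (z + h) - (f z - f' z * z))%C by ring.
  apply X; intros t Ht w; destruct (H t Ht) as [H1 H2]; split.
  - apply cderiv_minus; auto; apply cderiv_scal, cderiv_id.
  - replace (f' w - f' z * 1)%C with (f' w - f' z)%C by ring.
    eapply Rle_trans; [exact H2|].
    replace (z + RtoC t * h - z)%C with (RtoC t * h)%C by ring.
    rewrite Cmod_mult, Cmod_R, Rabs_pos_eq by lra.
    assert (T := Cmod_ge_0 h). apply Rmult_le_compat_l; nra.
Qed.

(** By [derivative_mean], [f' w] is the mean of difference quotients [q w] over a circle of radius
    [t] that does not depend on [w]. Differentiation under the integral gives the derivative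
    [CI q'], and the Lipschitz bound on [f'] makes the error uniform along the circle. *)
Lemma derivative_holomorphic (f f' : C -> C) (c : C) (r : R) :
  0 < r -> (forall z, Cmod (z - c) < r -> cderiv f z (f' z)) ->
  exists l, cderiv f' c l.
Proof.
  intros Hr Hf.
  destruct (derivative_locally_lipschitz f f' c r Hr Hf) as [d [K [Hd [HK HL]]]].
  set (t := d / 4).
  assert (t0 : 0 < t) by (unfold t; lra).
  assert (Hcirc : forall s, Cmod (c + RtoC t * unit_circle s - c) < d / 2).
  { intros s; rewrite circle_point; unfold t; lra. }
  set (e := unit_circle).
  assert (en : forall s, (RtoC t * e s <> 0)%C).
  { intros s; apply Cmod_gt_0; unfold e; rewrite Cmod_mult, Cmod_R, Cmod_unit_circle, Rabs_pos_eq; lra. }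
  assert (em : forall s, Cmod (RtoC t * e s) = t).
  { intros s; unfold e; rewrite Cmod_mult, Cmod_R, Cmod_unit_circle, Rabs_pos_eq; lra. }
  set (q := fun w s => ((f (w + RtoC t * e s) - f w) / (RtoC t * e s))%C).
  set (q' := fun s => ((f' (c + RtoC t * e s) - f' c) / (RtoC t * e s))%C).
  assert (Hq : forall w, Cmod (w - c) < d / 2 -> cintegrable (q w) /\ CI (q w) = f' w).
  { intros w Hw; apply (derivative_mean f w (f' w) (d / 2) t); [|apply Hf; lra|unfold t; lra].
    intros z Hz; exists (f' z); apply Hf.
    replace (z - c)%C with ((z - w) + (w - c))%C by ring.
    eapply Rle_lt_trans; [apply Cmod_triangle|]; lra. }
  assert (Iq' : cintegrable q').
  { apply rcont_cintegrable; intros s _.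
    assert (Ce : rcont (fun s => RtoC t * e s)%C s).
    { apply (rcont_comp (fun z => RtoC t * cexp z)%C (fun s => (0, 2 * PI * s) : C)).
      - apply rderiv_rcont with (0, 2 * PI); split; simpl; auto_derive; auto; ring.
      - apply ccont_mult; [apply ccont_const | eapply cderiv_ccont, cderiv_cexp]. }
    apply (rcont_comp (fun z => (f' (c + z) - f' c) / z)%C _ s Ce).
    apply ccont_mult; [|apply ccont_inv; [apply ccont_id | apply en]].
    apply ccont_minus; [|apply ccont_const].
    apply (ccont_comp (fun z => c + z)%C f').
    - apply ccont_plus; [apply ccont_const | apply ccont_id].
    - intros eps He.
      assert (N := near_and _ _ _ (near_ball c (d / 2) _ (Hcirc s))
        (near_ball_self (c + RtoC t * e s)%C (eps / K) ltac:(apply Rdiv_lt_0_compat; lra))).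
      near_from N; intros y [Y1 Y2].
      eapply Rle_lt_trans; [apply HL; [lra|]|].
      + assert (T := Hcirc s); fold e in T; lra.
      + apply Rmult_lt_compat_r with (r := K) in Y2; [|lra].
        replace (eps / K * K) with eps in Y2 by (field; lra). lra. }
  exists (CI q'); apply cderiv_eps; intros eps He.
  (* The integrand is the difference of two first-order Taylor remainders, each at most [K |h|^2],
     divided by a number of modulus [t]. *)
  set (A := 2 * K / t).
  assert (A0 : 0 < A) by (apply Rdiv_lt_0_compat; lra).
  assert (N := near_and _ _ _ (near_ball_self c (d / 2) ltac:(lra))
        (near_ball_self c (eps / A) ltac:(apply Rdiv_lt_0_compat; lra))).
  near_from N; intros y [Y1 Y2].
  set (h := (y - c)%C) in *.
  destruct (Hq y Y1) as [I1 E1].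
  destruct (Hq c ltac:(rewrite Cmod_self; lra)) as [I2 E2].
  assert (J2 := cintegrable_scal (- (1))%C _ I2).
  assert (J3 := cintegrable_scal (- h)%C _ Iq').
  assert (E := CI_plus _ _ (cintegrable_plus _ _ I1 J2) J3).
  cbv beta in E; rewrite (CI_plus _ _ I1 J2), (CI_scal _ _ I2), (CI_scal _ _ Iq'), E1, E2 in E.
  replace (f' y - f' c - CI q' * h)%C with (f' y + - (1) * f' c + - h * CI q')%C by ring.
  rewrite <- E.
  apply Rle_trans with (A * Cmod h * Cmod h).
  - apply CI_bound; [exact (cintegrable_plus _ _ (cintegrable_plus _ _ I1 J2) J3)|].
    intros s _; unfold q, q'.
    assert (TB : forall z, Cmod (z - c) < d / 2 ->
       Cmod (f (z + h)%C - f z - h * f' z) <= K * Cmod h * Cmod h).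
    { intros z Hz; apply taylor1_bound; [|lra]; intros u Hu w.
      assert (Hw : Cmod (w - c) < d).
      { unfold w; replace (z + RtoC u * h - c)%C with ((z - c) + RtoC u * h)%C by ring.
        eapply Rle_lt_trans; [apply Cmod_triangle|].
        rewrite Cmod_mult, Cmod_R, Rabs_pos_eq by lra.
        assert (T := Cmod_ge_0 h). nra. }
      split; [apply Hf; lra | apply HL; lra]. }
    assert (T1 := TB (c + RtoC t * e s)%C (Hcirc s)).
    assert (T2 := TB c ltac:(rewrite Cmod_self; lra)).
    set (p := (RtoC t * e s)%C) in *.
    replace (c + p + h)%C with (y + p)%C in T1 by (unfold h; ring).
    replace (c + h)%C with y in T2 by (unfold h; ring).
    replace ((f (y + p) - f y) / p + - (1) * ((f (c + p) - f c) / p)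
             + - h * ((f' (c + p) - f' c) / p))%C
      with (((f (y + p) - f (c + p) - h * f' (c + p)) - (f y - f c - h * f' c)) / p)%C
      by (field; apply en).
    rewrite Cmod_div by apply en; unfold p at 4; rewrite em.
    replace (A * Cmod h * Cmod h) with ((2 * (K * Cmod h * Cmod h)) / t)
      by (unfold A; field; lra).
    apply Rmult_le_compat_r; [left; apply Rinv_0_lt_compat; lra|].
    eapply Rle_trans; [apply Cmod_triangle|]; rewrite Cmod_opp; lra.
  - apply Rmult_le_compat_r; [apply Cmod_ge_0|].
    apply Rmult_lt_compat_r with (r := A) in Y2; [|lra].
    replace (eps / A * A) with eps in Y2 by (field; lra). lra.
Qed.

(** * The maximum principle *)

(* Compactness: the largest of the values [v y] over a finite subcover would be
   smaller than another one of them. *)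
Lemma no_local_domination (X : C -> Prop) (v : C -> R) (B : R) :
  (forall z, X z -> Cmod z <= B) ->
  (forall p, exists y, X y /\ near p (fun z => X z -> v z < v y)) -> False.
Proof.
  intros HB H.
  assert (H' : forall p, exists yd : C * R, X (fst yd) /\ 0 < snd yd /\
     forall z, Cmod (z - p) < snd yd -> X z -> v z < v (fst yd)).
  { intros p; destruct (H p) as [y [Hy [d [d0 Hd]]]]; exists (y, d); auto. }
  set (yd := fun p => proj1_sig (constructive_indefinite_description _ (H' p))).
  assert (Hyd : forall p, X (fst (yd p)) /\ 0 < snd (yd p) /\
     forall z, Cmod (z - p) < snd (yd p) -> X z -> v z < v (fst (yd p))).
  { intros p; unfold yd; exact (proj2_sig (constructive_indefinite_description _ (H' p))). }
  set (pt := fun t : Compactness.Tn 2 R => (fst t, fst (snd t)) : C).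
  (* Halved because compactness gives closeness in each coordinate, and [Cmod] is bounded by the sum
     of the two. *)
  assert (dp : forall t, 0 < snd (yd (pt t)) / 2) by (intros t; destruct (Hyd (pt t)); lra).
  apply (compactness_list 2 (- B, (- B, tt)) (B, (B, tt)) (fun t => mkposreal _ (dp t))).
  intros [l Hl].
  assert (Max : exists y, X y /\ forall t, In t l -> v (fst (yd (pt t))) <= v y).
  { clear Hl; induction l as [|t l [y [Hy Hm]]].
    - exists (fst (yd 0)); split; [apply Hyd|]; simpl; tauto.
    - destruct (Rle_dec (v (fst (yd (pt t)))) (v y)) as [L|L].
      + exists y; split; auto; intros u [<-|Hu]; auto.
      + exists (fst (yd (pt t))); split; [apply Hyd|]; intros u [<-|Hu]; [lra|].
        specialize (Hm u Hu); lra. }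
  destruct Max as [y [Hy Hm]].
  assert (Yr := re_le_Cmod y); assert (Yi := im_le_Cmod y); assert (YB := HB y Hy).
  destruct (Hl (Re y, (Im y, tt))) as [t [Ht [_ Hc]]].
  { apply Rabs_le_between in Yr; apply Rabs_le_between in Yi.
    repeat split; lra. }
  destruct t as [t1 [t2 []]].
  destruct Hc as [C1 [C2 _]]; simpl in C1, C2.
  destruct (Hyd (pt (t1, (t2, tt)))) as [_ [_ K]].
  specialize (Hm _ Ht).
  apply (Rlt_irrefl (v y)); eapply Rlt_le_trans; [|exact Hm].
  apply K; auto.
  eapply Rle_lt_trans; [apply Cmod_le_abs|].
  change (Rabs (Re y - t1) + Rabs (Im y - t2) < snd (yd (pt (t1, (t2, tt))))).
  lra.
Qed.

(** If [h] were unbounded, then near each [p] of the disc its modulus would stay below [|h p| + 1]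
    and hence below some value taken elsewhere, against [no_local_domination]. Points outside have a
    neighbourhood that misses the disc. *)
Lemma closed_disc_bound (h : C -> C) (c : C) (r : R) :
  (forall z, Cmod (z - c) <= r -> ccont h z) ->
  exists M, forall z, Cmod (z - c) <= r -> Cmod (h z) <= M.
Proof.
  intros Hc; apply NNPP; intros N.
  assert (U : forall M, exists z, Cmod (z - c) <= r /\ M < Cmod (h z)).
  { intros M; apply NNPP; intros N'; apply N; exists M; intros z Hz.
    apply Rnot_lt_le; intros L; apply N'; eauto. }
  apply (no_local_domination (fun z => Cmod (z - c) <= r) (fun z => Cmod (h z)) (r + Cmod c)).
  - intros z Hz; replace z with ((z - c) + c)%C by ring.
    eapply Rle_trans; [apply Cmod_triangle|]; lra.
  - intros p; destruct (Rle_dec (Cmod (p - c)) r) as [L|L].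
    + destruct (U (Cmod (h p) + 1)) as [y [Hy Ly]].
      exists y; split; auto.
      near_from (ccont_mod_lt h p (Cmod (h p) + 1) (Hc p L) ltac:(lra)); intros; lra.
    + destruct (U 0) as [y [Hy _]]; exists y; split; auto.
      assert (Cp : ccont (fun z => z - c)%C p)
        by (apply ccont_minus; [apply ccont_id | apply ccont_const]).
      near_from (ccont_mod_gt _ p r Cp ltac:(lra)); intros; lra.
Qed.

Lemma CI_re_le (phi : R -> C) (M : R) :
  cintegrable phi -> (forall t, 0 <= t <= 1 -> Re (phi t) <= M) -> Re (CI phi) <= M.
Proof.
  intros [I _] H; unfold CI, Re at 1; cbn [fst].
  apply (is_RInt_le (fun t => Re (phi t)) (fun _ => M) 0 1); [lra| | |].
  - exact (RInt_correct (V := R_CompleteNormedModule) _ _ _ I).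
  - assert (B := is_RInt_const (V := R_NormedModule) 0 1 M).
    change (is_RInt (fun _ : R => M) 0 1 ((1 - 0) * M)) in B.
    replace ((1 - 0) * M) with M in B by ring; exact B.
  - intros t Ht; apply H; lra.
Qed.

Lemma unit_multiplier (w : C) : exists u, Cmod u <= 1 /\ (u * w = RtoC (Cmod w))%C.
Proof.
  destruct (classic (w = 0%C)) as [->|n].
  - exists 1%C; rewrite Cmod_1, Cmod_0; split; [lra | ring].
  - assert (p : 0 < Cmod w) by now apply Cmod_gt_0.
    assert (n' : RtoC (Cmod w) <> 0%C) by (intros E; apply RtoC_inj in E; lra).
    exists (RtoC (Cmod w) / w)%C; split.
    + rewrite Cmod_div, Cmod_R, Rabs_pos_eq by (auto; lra); right; field; lra.
    + field; auto.
Qed.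

Lemma Cmod_sqr (z : C) : Cmod z * Cmod z = Re z * Re z + Im z * Im z.
Proof. assert (H := Cmod2_alt z); lra. Qed.

(* The quadratic term makes the mean inequality on small circles strict. *)
Lemma no_local_maximum (Q : C -> C) (p : C) (r de eps : R) :
  0 < r -> hol_ball Q p r -> 0 < de -> 0 < eps ->
  exists y, Cmod (y - p) < eps /\
    Cmod (Q p) + de * (Cmod p * Cmod p) < Cmod (Q y) + de * (Cmod y * Cmod y).
Proof.
  intros Hr HQ Hde Heps; apply NNPP; intros N.
  set (t := Rmin r eps / 2).
  assert (t0 : 0 < t) by (apply Rdiv_lt_0_compat; [apply Rmin_pos; auto | lra]).
  assert (t1 : t < r) by (unfold t; assert (T := Rmin_l r eps); lra).
  assert (t2 : t < eps) by (unfold t; assert (T := Rmin_r r eps); lra).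
  assert (H : forall y, Cmod (y - p) = t ->
    Cmod (Q y) + de * (Cmod y * Cmod y) <= Cmod (Q p) + de * (Cmod p * Cmod p)).
  { intros y Hy; apply Rnot_lt_le; intros L; apply N; exists y; split; auto; lra. }
  destruct (unit_multiplier (Q p)) as [u [Hu Eu]].
  destruct (hol_ball_mean Q p r t HQ ltac:(lra)) as [I1 E1].
  destruct (hol_ball_mean (fun z => z) p r t) as [I2 E2].
  { intros z _; exists (RtoC 1); apply cderiv_id. }
  { lra. }
  assert (J1 := cintegrable_scal u _ I1).
  (* On the circle the real part of [2 de conj(p) y] equals [de (|y|^2 + |p|^2 - t^2)], while its
     mean is [2 de |p|^2]; the term [de t^2] is the strict gap. *)
  assert (J2 := cintegrable_scal (RtoC (2 * de) * Cconj p)%C _ I2).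
  assert (E := CI_plus _ _ J1 J2).
  rewrite (CI_scal _ _ I1), (CI_scal _ _ I2), E1, E2, Eu in E.
  assert (B : Re (RtoC (Cmod (Q p)) + RtoC (2 * de) * Cconj p * p)
     <= Cmod (Q p) + 2 * de * (Cmod p * Cmod p) - de * t * t).
  { rewrite <- E; apply CI_re_le; [exact (cintegrable_plus _ _ J1 J2)|].
    intros s _; set (y := (p + RtoC t * unit_circle s)%C).
    assert (Hy : Cmod (y - p) = t) by now apply circle_point.
    specialize (H y Hy).
    assert (A1 : Re (u * Q y) <= Cmod (Q y)).
    { eapply Rle_trans; [apply Rle_abs|]. eapply Rle_trans; [apply re_le_Cmod|].
      rewrite Cmod_mult. assert (T := Cmod_ge_0 (Q y)). nra. }
    rewrite re_plus.
    assert (A2 : 2 * Re (Cconj p * y) = Cmod y * Cmod y + Cmod p * Cmod p - t * t).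
    { rewrite <- Hy, !Cmod_sqr. unfold Cconj, Cmult, Cminus, Cplus, Copp, Re, Im; simpl; ring. }
    assert (A3 : Re (RtoC (2 * de) * Cconj p * y) = 2 * de * Re (Cconj p * y)).
    { rewrite <- Cmult_assoc, re_scal_l; reflexivity. }
    rewrite A3.
    replace (2 * de * Re (Cconj p * y)) with (de * (2 * Re (Cconj p * y))) by ring.
    rewrite A2. nra. }
  rewrite re_plus, re_RtoC, <- Cmult_assoc, re_scal_l in B.
  replace (Re (Cconj p * p)) with (Cmod p * Cmod p) in B.
  2:{ rewrite Cmod_sqr; unfold Cconj, Cmult, Re, Im; simpl; ring. }
  assert (0 < de * t * t) by (apply Rmult_lt_0_compat; auto; apply Rmult_lt_0_compat; auto).
  lra.
Qed.

(** The alternative is required at every point of the plane, so no closure or boundary of [X] has to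
    be described; away from the closure the second case is vacuous. Were [|k z0| > B], the function
    [|k| + de |z|^2] would be locally dominated everywhere: by a nearby value at interior points, by
    its value at [z0] at all others. *)
Lemma maximum_principle (X : C -> Prop) (k : C -> C) (B D : R) :
  (forall z, X z -> Cmod z <= D) ->
  (forall p,
     (exists r, 0 < r /\ hol_ball k p r /\ forall z, Cmod (z - p) < r -> X z) \/
     (forall eps, 0 < eps -> near p (fun z => X z -> Cmod (k z) < B + eps))) ->
  forall z, X z -> Cmod (k z) <= B.
Proof.
  intros HD H z0 H0; apply Rnot_lt_le; intros L.
  set (eta := (Cmod (k z0) - B) / 2).
  assert (eta0 : 0 < eta) by (unfold eta; lra).
  (* The quadratic term stays below [eta], half of the excess of [|k z0|] over [B]; the other half
     absorbs the [eps] of the boundary condition. *)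
  set (de := eta / (D * D + 1)).
  assert (de0 : 0 < de) by (apply Rdiv_lt_0_compat; nra).
  assert (deD : de * (D * D + 1) = eta) by (unfold de; field; nra).
  set (v := fun z => Cmod (k z) + de * (Cmod z * Cmod z)).
  apply (no_local_domination X v D HD).
  intros p; destruct (H p) as [[r [r0 [Hh HX]]] | Hb].
  - destruct (no_local_maximum k p r de r r0 Hh de0 r0) as [y [Hy Ly]].
    exists y; split; auto.
    change (v p < v y) in Ly.
    set (g := (v y - v p) / 2).
    destruct (Hh p) as [l Hl]; [rewrite Cmod_self; auto|].
    assert (Cq : ccont (fun z => RtoC de * (z * z))%C p).
    { apply ccont_mult; [apply ccont_const | apply ccont_mult; apply ccont_id]. }
    assert (Eq : forall z, Cmod (RtoC de * (z * z)) = de * (Cmod z * Cmod z)).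
    { intros z; rewrite !Cmod_mult, Cmod_R, Rabs_pos_eq; lra. }
    assert (Ng := near_and _ _ _
      (ccont_mod_lt k p (Cmod (k p) + g) (cderiv_ccont _ _ _ Hl) ltac:(unfold g; lra))
      (ccont_mod_lt _ p (de * (Cmod p * Cmod p) + g) Cq ltac:(cbv beta; rewrite Eq; unfold g; lra))).
    near_from Ng; intros z [Z1 Z2] _; rewrite Eq in Z2.
    unfold v at 1; unfold g, v in *; lra.
  - exists z0; split; auto.
    near_from (Hb eta eta0); intros z Hz Xz; specialize (Hz Xz); specialize (HD z Xz).
    assert (T := Cmod_ge_0 z); assert (T0 := Cmod_ge_0 z0).
    unfold v.
    assert (de * (Cmod z * Cmod z) <= de * (D * D)) by (apply Rmult_le_compat_l; nra).
    assert (0 <= de * (Cmod z0 * Cmod z0)) by (apply Rmult_le_pos; nra).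
    assert (Cmod (k z0) = B + 2 * eta) by (unfold eta; lra).
    lra.
Qed.

Lemma near_outside (c p : C) (r : R) :
  r < Cmod (p - c) -> near p (fun z => r < Cmod (z - c)).
Proof.
  intros H.
  apply (ccont_mod_gt (fun z => z - c)%C); auto.
  apply ccont_minus; [apply ccont_id | apply ccont_const].
Qed.

Lemma maximum_principle_disc (k : C -> C) (c : C) (r B : R) :
  hol_ball k c r ->
  (forall z, Cmod (z - c) = r -> ccont k z /\ Cmod (k z) <= B) ->
  forall z, Cmod (z - c) < r -> Cmod (k z) <= B.
Proof.
  intros Hk HB.
  apply (maximum_principle (fun z => Cmod (z - c) < r) k B (r + Cmod c)).
  - intros z Hz; replace z with ((z - c) + c)%C by ring.
    eapply Rle_trans; [apply Cmod_triangle|]; lra.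
  - intros p; destruct (Rtotal_order (Cmod (p - c)) r) as [L|[L|L]].
    + left; exists (r - Cmod (p - c)); repeat split; [lra| |].
      * apply hol_ball_sub with c r; auto; lra.
      * intros z Hz; replace (z - c)%C with ((z - p) + (p - c))%C by ring.
        eapply Rle_lt_trans; [apply Cmod_triangle|]; lra.
    + right; intros eps He; destruct (HB p L) as [Cp Bp].
      near_from (ccont_mod_lt k p (B + eps) Cp ltac:(lra)); auto.
    + right; intros eps He.
      near_from (near_outside c p r L); intros; lra.
Qed.

Lemma hol_ball_derivative (f : C -> C) (c : C) (r : R) :
  hol_ball f c r -> exists f', (forall z, Cmod (z - c) < r -> cderiv f z (f' z)) /\ hol_ball f' c r.
Proof.
  intros Hf.
  assert (H : forall z, exists l, Cmod (z - c) < r -> cderiv f z l).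
  { intros z; destruct (Rlt_dec (Cmod (z - c)) r) as [L|L].
    - destruct (Hf z L) as [l Hl]; exists l; auto.
    - exists 0%C; tauto. }
  set (f' := fun z => proj1_sig (constructive_indefinite_description _ (H z))).
  assert (Hf' : forall z, Cmod (z - c) < r -> cderiv f z (f' z)).
  { intros z; unfold f'; exact (proj2_sig (constructive_indefinite_description _ (H z))). }
  exists f'; split; auto.
  intros z Hz; apply (derivative_holomorphic f f' z (r - Cmod (z - c))); [lra|].
  intros w Hw; apply Hf'.
  replace (w - c)%C with ((w - z) + (z - c))%C by ring.
  eapply Rle_lt_trans; [apply Cmod_triangle|]; lra.
Qed.

(** * Zeros and injectivity *)

(** The quotient takes the value [h' c] at [c], and its derivative there is [l / 2] with [l] the
    second derivative of [h]. Indeed the second-order remainder [F] has a derivative of size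
    [o(|w - c|)], so [F] is [o(|w - c|^2)] by the mean value inequality. *)
Lemma hol_ball_divide (h : C -> C) (c : C) (r : R) :
  0 < r -> hol_ball h c r -> h c = 0%C ->
  exists k, hol_ball k c r /\ forall z, Cmod (z - c) < r -> (h z = (z - c) * k z)%C.
Proof.
  intros Hr Hh H0.
  destruct (hol_ball_derivative h c r Hh) as [h' [Hd Hh']].
  assert (Hdec : forall y, {y = c} + {y <> c}) by (intros; apply excluded_middle_informative).
  set (k := fun z => if Hdec z then h' c else (h z / (z - c))%C).
  assert (kc : k c = h' c) by (unfold k; destruct (Hdec c); congruence).
  assert (kz : forall z, z <> c -> k z = (h z / (z - c))%C)
    by (intros z n; unfold k; destruct (Hdec z); congruence).
  exists k; split.
  - intros z Hz; destruct (Hdec z) as [->|n].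
    + destruct (Hh' c Hz) as [l Hl].
      assert (n2 := C2_neq_0).
      exists (l / 2)%C; apply cderiv_eps; intros eps He.
      assert (N := near_and _ _ _ (near_ball_self c r Hr) (proj1 (cderiv_eps _ _ _) Hl eps He)).
      destruct N as [d [d0 Hdd]]; exists d; split; auto.
      intros y Hy; destruct (Hdec y) as [->|ny].
      { replace (k c - k c - l / 2 * (c - c))%C with (RtoC 0) by ring.
        rewrite Cmod_0, Cmod_self; lra. }
      rewrite kz, kc by auto.
      assert (ny' := Cminus_neq_0 _ _ ny).
      assert (py : 0 < Cmod (y - c)) by now apply Cmod_gt_0.
      replace (h y / (y - c) - h' c - l / 2 * (y - c))%C
        with ((h y - h' c * (y - c) - l / 2 * ((y - c) * (y - c))) / (y - c))%C
        by (field; auto).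
      rewrite Cmod_div by auto.
      apply Rmult_le_reg_r with (Cmod (y - c)); auto.
      unfold Rdiv; rewrite Rmult_assoc, Rinv_l, Rmult_1_r by lra.
      set (F := fun w => (h w - h' c * (w - c) - l / 2 * ((w - c) * (w - c)))%C).
      assert (Fc : F c = 0%C) by (unfold F; rewrite H0; ring).
      change (Cmod (F y) <= eps * Cmod (y - c) * Cmod (y - c)).
      replace (F y) with (F y - F c)%C by (rewrite Fc; ring).
      apply (Cmvt F (fun w => h' w - h' c - l * (w - c))%C).
      intros t Ht w.
      assert (Ew : Cmod (w - c) <= Cmod (y - c)).
      { replace (w - c)%C with (RtoC t * (y - c))%C by (unfold w; ring).
        rewrite Cmod_mult, Cmod_R, Rabs_pos_eq by lra; nra. }
      destruct (Hdd w ltac:(lra)) as [W1 W2]; split.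
      * replace (h' w - h' c - l * (w - c))%C
          with (h' w - h' c * (1 - 0) - l / 2 * ((1 - 0) * (w - c) + (w - c) * (1 - 0)))%C
          by (field; auto).
        assert (Dw : cderiv (fun x => x - c)%C w (1 - 0))
          by (apply cderiv_minus; [apply cderiv_id | apply cderiv_const]).
        apply cderiv_minus; [apply cderiv_minus|]; auto.
        -- now apply cderiv_scal.
        -- apply cderiv_scal. exact (cderiv_mult _ _ _ _ _ Dw Dw).
      * eapply Rle_trans; [exact W2|]. apply Rmult_le_compat_l; lra.
    + destruct (Hh z Hz) as [l Hl].
      eexists; apply cderiv_ext with (fun z => h z * / (z - c))%C.
      * near_from (ccont_near_neq (fun y => y) z c (ccont_id z) n).
        intros y Hy; now rewrite kz.
      * apply cderiv_mult; [exact Hl|].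
        apply cderiv_inv; [|now apply Cminus_neq_0].
        apply cderiv_minus; [apply cderiv_id | apply cderiv_const].
  - intros z Hz; destruct (Hdec z) as [->|n].
    + rewrite H0; ring.
    + rewrite kz by auto; field; now apply Cminus_neq_0.
Qed.

Lemma hol_ball_cont (h : C -> C) (c : C) (r : R) (z : C) :
  hol_ball h c r -> Cmod (z - c) < r -> ccont h z.
Proof. intros H Hz; destruct (H z Hz); eapply cderiv_ccont; eauto. Qed.

(** The identity theorem in quantitative form. If division by [z - c] stops after [n] steps, the
    nonzero last quotient gives the lower bound. If it never stops, the [n]-th quotient is at most
    [M / rho^n] on the circle of radius [rho], hence also inside, so [|h z| <= M (|z - c| / rho)^n]
    for all [n]. *)
Lemma hol_ball_zero_or_lower_bound (h : C -> C) (c : C) (r : R) :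
  0 < r -> hol_ball h c r ->
  (forall z, Cmod (z - c) < r -> h z = 0%C) \/
  (exists n A d, 0 < A /\ 0 < d /\
     forall z, Cmod (z - c) < d -> A * Cmod (z - c) ^ n <= Cmod (h z)).
Proof.
  intros Hr Hh.
  destruct (classic (exists n k, hol_ball k c r /\ k c <> 0%C /\
    forall z, Cmod (z - c) < r -> (h z = (z - c) ^ n * k z)%C)) as [[n [k [Hk [k0 E]]]] | N].
  - right.
    assert (p : 0 < Cmod (k c)) by now apply Cmod_gt_0.
    assert (Ck : ccont k c) by (apply hol_ball_cont with c r; auto; rewrite Cmod_self; auto).
    destruct (near_and _ _ _ (near_ball_self c r Hr)
      (ccont_mod_gt k c (Cmod (k c) / 2) Ck ltac:(lra))) as [d [d0 Hd]].
    exists n, (Cmod (k c) / 2), d; repeat split; auto; [lra|].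
    intros z Hz; destruct (Hd z Hz) as [Z1 Z2].
    rewrite E, Cmod_mult, Cmod_pow by auto.
    rewrite Rmult_comm; apply Rmult_le_compat_l; [apply pow_le, Cmod_ge_0 | lra].
  - left.
    assert (Hn : forall n, exists k, hol_ball k c r /\
      forall z, Cmod (z - c) < r -> (h z = (z - c) ^ n * k z)%C).
    { induction n as [|n [k [Hk E]]].
      - exists h; split; auto; intros; simpl; ring.
      - destruct (classic (k c = 0%C)) as [Z|Z]; [|exfalso; apply N; eauto].
        destruct (hol_ball_divide k c r Hr Hk Z) as [k' [Hk' E']].
        exists k'; split; auto.
        intros z Hz; rewrite E, E' by auto; simpl; ring. }
    intros z Hz; apply NNPP; intros NZ.
    assert (pz : 0 < Cmod (h z)) by now apply Cmod_gt_0.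
    set (rho := (Cmod (z - c) + r) / 2).
    assert (G := Cmod_ge_0 (z - c)).
    assert (rho0 : Cmod (z - c) < rho < r) by (unfold rho; lra).
    destruct (closed_disc_bound h c rho) as [M HM].
    { intros w Hw; apply hol_ball_cont with c r; auto; lra. }
    assert (M0 : 0 < M) by (eapply Rlt_le_trans; [exact pz | apply HM; lra]).
    set (x := Cmod (z - c) / rho).
    assert (x0 : 0 <= x < 1).
    { unfold x; split; [apply Rmult_le_pos; auto; left; apply Rinv_0_lt_compat; lra|].
      apply Rmult_lt_reg_r with rho; [lra|]. unfold Rdiv; rewrite Rmult_assoc, Rinv_l; lra. }
    destruct (pow_lt_1_zero x ltac:(rewrite Rabs_pos_eq; lra) (Cmod (h z) / M)
      ltac:(apply Rdiv_lt_0_compat; lra)) as [n Hx].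
    specialize (Hx n (le_n n)).
    rewrite Rabs_pos_eq in Hx by (apply pow_le; lra).
    destruct (Hn n) as [k [Hk E]].
    assert (rn : 0 < rho ^ n) by (apply pow_lt; lra).
    assert (Bk : Cmod (k z) <= M / rho ^ n).
    { apply (maximum_principle_disc k c rho); [|intros w Hw|lra].
      - intros w Hw; apply Hk; lra.
      - split; [apply hol_ball_cont with c r; auto; lra|].
        assert (Hw' := HM w ltac:(lra)).
        rewrite E, Cmod_mult, Cmod_pow, Hw in Hw' by lra.
        apply Rmult_le_reg_l with (rho ^ n); auto.
        replace (rho ^ n * (M / rho ^ n)) with M by (field; lra); exact Hw'. }
    assert (Bh : Cmod (h z) <= x ^ n * M).
    { rewrite E, Cmod_mult, Cmod_pow by lra.
      replace (x ^ n * M) with (Cmod (z - c) ^ n * (M / rho ^ n)).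
      - apply Rmult_le_compat_l; auto; apply pow_le; lra.
      - unfold x, Rdiv; rewrite Rpow_mult_distr, pow_inv; ring. }
    apply Rmult_lt_compat_r with (r := M) in Hx; auto.
    replace (Cmod (h z) / M * M) with (Cmod (h z)) in Hx by (field; lra). lra.
Qed.

Definition injective_on (A : C -> Prop) (f : C -> C) : Prop :=
  forall z w, A z -> A w -> f z = f w -> z = w.

(* Hurwitz: by injectivity the difference quotients [(f (z + e) - f z) / e] have
   no zeros, so by the minimum principle neither does their limit [f']. *)
Lemma injective_derivative_neq_0 (f f' : C -> C) (c : C) (r : R) :
  0 < r -> (forall z, Cmod (z - c) < r -> cderiv f z (f' z)) ->
  injective_on (fun z => Cmod (z - c) < r) f -> f' c <> 0%C.
Proof.
  intros Hr Hf Hinj H0.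
  assert (Hh : hol_ball f' c r).
  { intros z Hz; apply (derivative_holomorphic f f' z (r - Cmod (z - c))); [lra|].
    intros w Hw; apply Hf.
    replace (w - c)%C with ((w - z) + (z - c))%C by ring.
    eapply Rle_lt_trans; [apply Cmod_triangle|]; lra. }
  destruct (derivative_locally_lipschitz f f' c r Hr Hf) as [d [K [Hd [HK HL]]]].
  destruct (hol_ball_zero_or_lower_bound f' c r Hr Hh) as [Z | [n [A [d2 [A0 [d20 HA]]]]]].
  (* A derivative that vanishes identically makes [f] constant, against injectivity. *)
  - set (b := (c + RtoC (r / 2))%C).
    assert (Eb : Cmod (b - c) = r / 2).
    { unfold b; replace (c + RtoC (r / 2) - c)%C with (RtoC (r / 2)) by ring.
      rewrite Cmod_R, Rabs_pos_eq; lra. }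
    assert (E : Cmod (f b - f c) <= 0 * Cmod (b - c)).
    { apply Cmvt with f'; intros t Ht w.
      assert (Hw : Cmod (w - c) < r) by (apply ball_segment; rewrite ?Cmod_self; lra).
      split; auto; rewrite Z, Cmod_0 by auto; lra. }
    assert (E2 : Cmod (f b - f c) = 0) by (assert (T := Cmod_ge_0 (f b - f c)); lra).
    apply Cmod_eq_0, Cminus_eq_0, Hinj in E2; rewrite ?Cmod_self; try lra.
    rewrite E2, Cmod_self in Eb; lra.
  - set (s := Rmin d d2 / 4).
    assert (s0 : 0 < s) by (apply Rdiv_lt_0_compat; [apply Rmin_pos; lra | lra]).
    assert (s1 : 4 * s <= d) by (unfold s; assert (T := Rmin_l d d2); lra).
    assert (s2 : 4 * s <= d2) by (unfold s; assert (T := Rmin_r d d2); lra).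
    set (m := A * s ^ n).
    assert (m0 : 0 < m) by (apply Rmult_lt_0_compat; auto; apply pow_lt; auto).
    (* On the circle of radius [s] one has [|f'| >= m], and [q] is within [K e <= m / 4] of [f'].
       The minimum principle then gives [|q c| >= m - K e], whereas [f' c = 0] gives
       [|q c| <= K e]. *)
    set (e := Rmin s (m / (4 * K))).
    assert (e0 : 0 < e) by (apply Rmin_pos; auto; apply Rdiv_lt_0_compat; lra).
    assert (e1 : e <= s) by apply Rmin_l.
    assert (e2 : 4 * (K * e) <= m).
    { replace m with (4 * K * (m / (4 * K))) by (field; lra).
      assert (e <= m / (4 * K)) by apply Rmin_r.
      replace (4 * (K * e)) with (4 * K * e) by ring. apply Rmult_le_compat_l; lra. }
    assert (en : RtoC e <> 0%C) by (intros X; apply RtoC_inj in X; lra).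
    assert (Hze : forall z, Cmod (z - c) <= s -> Cmod (z + RtoC e - c) < d).
    { intros z Hz; replace (z + RtoC e - c)%C with ((z - c) + RtoC e)%C by ring.
      eapply Rle_lt_trans; [apply Cmod_triangle|].
      rewrite Cmod_R, Rabs_pos_eq; lra. }
    set (q := fun z => ((f (z + RtoC e) - f z) * / RtoC e)%C).
    assert (qn : forall z, Cmod (z - c) <= s -> q z <> 0%C).
    { intros z Hz; assert (T := Hze z Hz); apply Cmult_neq_0.
      - apply Cminus_neq_0; intros X; apply Hinj in X; try lra.
        apply en; replace (RtoC e) with (z + RtoC e - z)%C by ring.
        rewrite X at 1; ring.
      - apply Cmod_gt_0; rewrite Cmod_inv by auto; apply Rinv_0_lt_compat.
        rewrite Cmod_R, Rabs_pos_eq; lra. }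
    assert (qd : forall z, Cmod (z - c) <= s -> exists l, cderiv q z l).
    { intros z Hz; assert (T := Hze z Hz).
      eexists; apply cderiv_mult; [|apply cderiv_const].
      apply cderiv_minus; [|apply Hf; lra].
      apply (cderiv_comp (fun z => z + RtoC e)%C f); [|apply Hf; lra].
      apply cderiv_plus; [apply cderiv_id | apply cderiv_const]. }
    assert (qc : forall z, Cmod (z - c) <= s -> Cmod (q z - f' z) <= K * e).
    { intros z Hz.
      assert (T : Cmod (f (z + RtoC e)%C - f z - RtoC e * f' z)
                  <= K * Cmod (RtoC e) * Cmod (RtoC e)).
      { apply taylor1_bound; [|lra]; intros t Ht w.
        assert (Hw : Cmod (w - c) < d).
        { unfold w; replace (RtoC e) with (z + RtoC e - z)%C by ring.
          apply ball_segment; auto; lra. }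
        split; [apply Hf; lra|apply HL; lra]. }
      replace (q z - f' z)%C with ((f (z + RtoC e)%C - f z - RtoC e * f' z) / RtoC e)%C
        by (unfold q; field; auto).
      rewrite Cmod_R, Rabs_pos_eq in T by lra.
      rewrite Cmod_div, Cmod_R, Rabs_pos_eq by (auto; lra).
      apply Rmult_le_reg_r with e; auto.
      unfold Rdiv; rewrite Rmult_assoc, Rinv_l, Rmult_1_r by lra; exact T. }
    assert (Bc : Cmod (/ q c) <= / (m - K * e)).
    { apply (maximum_principle_disc (fun z => / q z)%C c s).
      - intros z Hz; destruct (qd z ltac:(lra)) as [l Hl].
        eexists; apply cderiv_inv; [exact Hl | apply qn; lra].
      - intros z Hz; destruct (qd z ltac:(lra)) as [l Hl]; split.
        + apply ccont_inv; [eapply cderiv_ccont; eauto | apply qn; lra].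
        + rewrite Cmod_inv by (apply qn; lra).
          apply Rinv_le_contravar; [nra|].
          assert (T := qc z ltac:(lra)); assert (T2 := HA z ltac:(lra)).
          rewrite Hz in T2; fold m in T2.
          assert (T3 := Cmod_triangle (f' z - q z) (q z)).
          replace (f' z - q z + q z)%C with (f' z) in T3 by ring.
          rewrite Cmod_minus_sym in T3; lra.
      - rewrite Cmod_self; auto. }
    assert (qc0 := qn c ltac:(rewrite Cmod_self; lra)).
    assert (T := qc c ltac:(rewrite Cmod_self; lra)).
    rewrite H0 in T; replace (q c - 0)%C with (q c) in T by ring.
    assert (p : 0 < Cmod (q c)) by now apply Cmod_gt_0.
    rewrite Cmod_inv in Bc by auto.
    assert (Kp : 0 < K * e) by nra.
    apply Rinv_le_contravar in Bc; [|now apply Rinv_0_lt_compat].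
    rewrite !Rinv_inv in Bc. lra.
Qed.

(** Continuity of the inverse, valid even for preimages far from [c] in [A]. On a small circle
    [|f z - f c| >= m]. If a value [w] within [m / 2] of [f c] had its preimage outside, then
    [1 / (f z - w)] would be holomorphic inside, at most [2 / m] on the circle and larger than that
    at the centre. *)
Lemma injective_preimage_close (A : C -> Prop) (f : C -> C) (c : C) (r s : R) :
  0 < r -> (forall z, Cmod (z - c) < r -> A z) -> hol_ball f c r ->
  injective_on A f -> 0 < s ->
  exists m, 0 < m /\ forall z, A z -> Cmod (f z - f c) < m -> Cmod (z - c) < s.
Proof.
  intros Hr HA Hf Hinj Hs.
  destruct (hol_ball_derivative f c r Hf) as [f' [Hd _]].
  assert (n : f' c <> 0%C).
  { apply injective_derivative_neq_0 with f r; auto. intros z w Hz Hw; auto. }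
  assert (p : 0 < Cmod (f' c)) by now apply Cmod_gt_0.
  destruct (proj1 (cderiv_eps _ _ _) (Hd c ltac:(rewrite Cmod_self; auto))
     (Cmod (f' c) / 2) ltac:(lra)) as [d [d0 Hdd]].
  set (k := Rmin s (Rmin r d) / 2).
  assert (k0 : 0 < k) by (apply Rdiv_lt_0_compat; [|lra]; apply Rmin_pos; auto; apply Rmin_pos; auto).
  assert (k1 : k < s) by (unfold k; assert (T := Rmin_l s (Rmin r d)); lra).
  assert (k2 : k < r) by (unfold k; assert (T := Rmin_r s (Rmin r d)); assert (T2 := Rmin_l r d); lra).
  assert (k3 : k < d) by (unfold k; assert (T := Rmin_r s (Rmin r d)); assert (T2 := Rmin_r r d); lra).
  set (m := Cmod (f' c) / 2 * k).
  assert (m0 : 0 < m) by (apply Rmult_lt_0_compat; lra).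
  assert (Hm : forall z, Cmod (z - c) = k -> m <= Cmod (f z - f c)).
  { intros z Hz; specialize (Hdd z ltac:(lra)).
    assert (T := Cmod_triangle (f' c * (z - c) - (f z - f c)) (f z - f c)).
    replace (f' c * (z - c) - (f z - f c) + (f z - f c))%C with (f' c * (z - c))%C in T by ring.
    replace (f' c * (z - c) - (f z - f c))%C with (- (f z - f c - f' c * (z - c)))%C in T by ring.
    rewrite Cmod_opp, Cmod_mult, Hz in T; rewrite Hz in Hdd. unfold m; lra. }
  exists (m / 2); split; [lra|].
  intros z1 Hz1 Hw; apply Rnot_le_lt; intros L.
  set (w := f z1) in *.
  assert (Hn : forall z, Cmod (z - c) < r -> Cmod (z - c) <= k -> (f z - w <> 0)%C).
  { intros z Hzr Hz; apply Cminus_neq_0; intros E; apply Hinj in E; auto.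
    subst z; lra. }
  assert (B : Cmod (/ (f c - w)) <= / (m / 2)).
  { apply (maximum_principle_disc (fun z => / (f z - w))%C c k).
    - intros z Hz; eexists; apply cderiv_inv; [|apply Hn; lra].
      apply cderiv_minus; [apply Hd; lra | apply cderiv_const].
    - intros z Hz; split.
      + apply ccont_inv; [|apply Hn; lra].
        apply ccont_minus; [|apply ccont_const].
        apply hol_ball_cont with c r; auto; lra.
      + rewrite Cmod_inv by (apply Hn; lra).
        apply Rinv_le_contravar; [lra|].
        assert (T := Hm z Hz).
        assert (T2 := Cmod_triangle (f z - w) (w - f c)).
        replace (f z - w + (w - f c))%C with (f z - f c)%C in T2 by ring. lra.
    - rewrite Cmod_self; auto. }
  assert (nc : (f c - w <> 0)%C) by (apply Hn; rewrite Cmod_self; lra).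
  rewrite Cmod_inv in B by auto.
  apply Rinv_le_contravar in B; [|apply Rinv_0_lt_compat; now apply Cmod_gt_0].
  rewrite !Rinv_inv in B. rewrite Cmod_minus_sym in B. lra.
Qed.

Lemma cderiv_inverse (A : C -> Prop) (f F : C -> C) (w l : C) (r : R) :
  0 < r -> (forall z, Cmod (z - F w) < r -> A z) -> hol_ball f (F w) r ->
  injective_on A f -> near w (fun y => A (F y) /\ f (F y) = y) ->
  cderiv f (F w) l -> cderiv F w (/ l).
Proof.
  intros Hr HA Hf Hinj HF Hl.
  destruct (near_at _ _ HF) as [_ Ew].
  assert (CF : ccont F w).
  { intros eps He.
    destruct (injective_preimage_close A f (F w) r eps) as [m [m0 Hm]]; auto.
    rewrite Ew in Hm.
    near_from (near_and _ _ _ HF (near_ball_self w m m0)).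
    intros y [[Y1 Y2] Y3]; apply Hm; auto; rewrite Y2; auto. }
  assert (ln : l <> 0%C).
  { destruct (hol_ball_derivative f (F w) r Hf) as [f' [Hd _]].
    replace l with (f' (F w)).
    - apply injective_derivative_neq_0 with f r; auto; intros z1 z2 H1 H2; auto.
    - apply cderiv_unique with f (F w); auto; apply Hd; rewrite Cmod_self; auto. }
  destruct Hl as [phi [p1 [p2 p3]]].
  assert (Cp : ccont (fun y => phi (F y)) w) by (apply ccont_comp; auto).
  assert (pn : phi (F w) <> 0%C) by (rewrite p2; auto).
  exists (fun y => / phi (F y))%C; repeat split.
  - apply ccont_inv; auto.
  - now rewrite p2.
  - near_from (near_and _ _ _ HF (near_and _ _ _ (near_comp _ _ _ CF p3)
      (ccont_near_neq _ _ 0%C Cp pn))).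
    intros y [[Y1 Y2] [Y3 Y4]].
    rewrite Y2, Ew in Y3.
    rewrite Y3 at 3. field; auto.
Qed.

(** * Symmetry and reflection *)

(** All that the symmetry arguments use about the conformal map and its inverse; the last clause is
    the inverse function theorem. Values of [F] off [Omega] are arbitrary. *)
Definition inverse_pair (Omega : C -> Prop) (f F : C -> C) : Prop :=
  (forall z, Cmod z < 1 -> Omega (f z) /\ F (f z) = z /\ exists l, cderiv f z l) /\
  (forall w, Omega w -> Cmod (F w) < 1 /\ f (F w) = w) /\
  (forall z l, Cmod z < 1 -> cderiv f z l -> l <> 0%C /\ cderiv F (f z) (/ l)).

Lemma conformal_map_inverse (Omega : C -> Prop) (f : C -> C) :
  open Omega -> conformal_map f unit_disk Omega -> exists F, inverse_pair Omega f F.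
Proof.
  intros HO [Hh [Hin [Hinj Hsurj]]].
  assert (Hd : forall z, Cmod z < 1 -> exists l, cderiv f z l).
  { intros z Hz; destruct (Hh z Hz) as [l Hl]; exists l; now apply is_derive_cderiv. }
  assert (H : forall w, exists z, Omega w -> Cmod z < 1 /\ f z = w).
  { intros w; destruct (classic (Omega w)) as [O|O].
    - destruct (Hsurj w O) as [z Hz]; exists z; intros _; exact Hz.
    - exists 0%C; tauto. }
  set (F := fun w => proj1_sig (constructive_indefinite_description _ (H w))).
  assert (HF : forall w, Omega w -> Cmod (F w) < 1 /\ f (F w) = w).
  { intros w; unfold F; exact (proj2_sig (constructive_indefinite_description _ (H w))). }
  assert (HFf : forall z, Cmod z < 1 -> F (f z) = z).
  { intros z Hz; destruct (HF (f z) (Hin z Hz)); apply Hinj; auto. }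
  assert (Hball : forall z y, Cmod z < 1 -> Cmod (y - z) < 1 - Cmod z -> Cmod y < 1).
  { intros z y Hz Hy; replace y with ((y - z) + z)%C by ring.
    eapply Rle_lt_trans; [apply Cmod_triangle|]; lra. }
  exists F; repeat split; auto; try (now apply HF).
  - assert (Hb : hol_ball f z (1 - Cmod z)) by (intros y Hy; eauto).
    destruct (hol_ball_derivative _ _ _ Hb) as [f' [Hf' _]].
    replace l with (f' z).
    + apply injective_derivative_neq_0 with f (1 - Cmod z); auto; [lra|].
      intros x y Hx Hy; apply Hinj; eapply Hball; eauto.
    + apply cderiv_unique with f z; auto; apply Hf'; rewrite Cmod_self; lra.
  - apply cderiv_inverse with (fun z => Cmod z < 1) f (1 - Cmod z);
      rewrite ?HFf; auto; try lra.
    + intros y Hy; eauto.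
    + intros y Hy; eauto.
    + near_from (near_open Omega (f z) HO (Hin z H0)); intros y Hy; auto.
Qed.

Lemma inverse_pair_derivable (Omega : C -> Prop) (f F : C -> C) (w : C) :
  inverse_pair Omega f F -> Omega w -> exists l, cderiv F w l.
Proof.
  intros [H1 [H2 H3]] Hw; destruct (H2 w Hw) as [W1 W2].
  destruct (H1 _ W1) as [_ [_ [l Hl]]]; destruct (H3 _ _ W1 Hl) as [_ D].
  rewrite W2 in D; eauto.
Qed.

(** Controls the quotient [h z / z] at its removable singularity. *)
Lemma cderiv_0_bound (h : C -> C) (l : C) (eps : R) :
  cderiv h 0 l -> h 0%C = 0%C -> Cmod l = 1 -> 0 < eps ->
  near 0 (fun z => z <> 0%C -> Cmod (h z) < (1 + eps) * Cmod z).
Proof.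
  intros Hd H0 Hl He.
  near_from (proj1 (cderiv_eps _ _ _) Hd (eps / 2) ltac:(lra)).
  intros z Hz n; rewrite H0 in Hz.
  replace (h z - 0 - l * (z - 0))%C with (h z - l * z)%C in Hz by ring.
  replace (z - 0)%C with z in Hz by ring.
  assert (p : 0 < Cmod z) by now apply Cmod_gt_0.
  replace (h z) with ((h z - l * z) + l * z)%C by ring.
  eapply Rle_lt_trans; [apply Cmod_triangle|].
  rewrite Cmod_mult, Hl; nra.
Qed.

(** Schwarz's lemma on a part [U] of the disk: the maximum principle for [h z / z]. Towards the unit
    circle [|h| < 1] bounds the quotient by [1 / |z|]; at the remaining points off [U] the bound is
    a hypothesis. *)
Lemma schwarz_quotient (U : C -> Prop) (h : C -> C) :
  (forall z, U z -> Cmod z < 1 /\ z <> 0%C /\ Cmod (h z) < 1) ->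
  (forall z, U z -> near z U /\ exists l, cderiv h z l) ->
  (forall p, Cmod p < 1 -> ~ U p -> forall eps, 0 < eps ->
     near p (fun z => U z -> Cmod (h z) < (1 + eps) * Cmod z)) ->
  forall z, U z -> Cmod (h z) <= Cmod z.
Proof.
  intros H1 H2 H3.
  assert (K : forall z, U z -> Cmod (h z * / z) <= 1).
  { apply (maximum_principle U (fun z => h z * / z)%C 1 1).
    - intros z Hz; destruct (H1 z Hz); lra.
    - intros p; destruct (classic (U p)) as [Up|Up]; [left | right].
      + destruct (H2 p Up) as [[r [r0 Hr]] _]; exists r; repeat split; auto.
        intros z Hz; destruct (H2 z (Hr z Hz)) as [_ [l Hl]].
        destruct (H1 z (Hr z Hz)) as [_ [n _]].
        eexists; apply cderiv_mult; [exact Hl|].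
        apply cderiv_inv; auto; apply cderiv_id.
      + intros eps He; destruct (Rlt_or_le (Cmod p) 1) as [L|L].
        * near_from (H3 p L Up eps He); intros z Hz Uz; specialize (Hz Uz).
          destruct (H1 z Uz) as [_ [n _]].
          assert (pz : 0 < Cmod z) by now apply Cmod_gt_0.
          rewrite Cmod_mult, Cmod_inv by auto.
          apply Rmult_lt_reg_r with (Cmod z); auto.
          rewrite Rmult_assoc, Rinv_l by lra; lra.
        * assert (I : / (1 + eps) < Cmod p).
          { apply Rlt_le_trans with 1; auto; rewrite <- Rinv_1; apply Rinv_lt_contravar; lra. }
          near_from (ccont_mod_gt (fun z => z) p _ (ccont_id p) I); intros z Hz Uz.
          destruct (H1 z Uz) as [_ [n B]].
          assert (pz : 0 < Cmod z) by now apply Cmod_gt_0.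
          rewrite Cmod_mult, Cmod_inv by auto.
          apply Rmult_lt_reg_r with (Cmod z); auto.
          rewrite Rmult_assoc, Rinv_l by lra.
          apply Rmult_lt_compat_l with (r := 1 + eps) in Hz; [|lra].
          rewrite Rinv_r in Hz by lra; lra. }
  intros z Uz; specialize (K z Uz); destruct (H1 z Uz) as [_ [n _]].
  assert (pz : 0 < Cmod z) by now apply Cmod_gt_0.
  rewrite Cmod_mult, Cmod_inv in K by auto.
  apply Rmult_le_compat_r with (r := Cmod z) in K; [|lra].
  rewrite Rmult_assoc, Rinv_l in K by lra; lra.
Qed.

(** The direction [v] is chosen so that [|k|^2] has derivative [2 |l|^2] along it, and this is zero
    as the modulus is constant. *)
Lemma constant_modulus_derivative (k : C -> C) (z l : C) :
  cderiv k z l -> near z (fun y => Cmod (k y) = 1) -> l = 0%C.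
Proof.
  intros Hk Hm.
  set (v := Cconj (Cconj (k z) * l)).
  set (gam := fun t : R => (z + RtoC t * v)%C).
  assert (g0 : gam 0 = z) by (unfold gam; ring).
  assert (Hg : rderiv (fun t => k (gam t)) 0 (l * v)%C).
  { apply rderiv_comp; [rewrite g0; exact Hk | apply rderiv_segment]. }
  destruct Hg as [HR HI].
  assert (D : is_derive (fun t => Re (k (gam t)) * Re (k (gam t)) + Im (k (gam t)) * Im (k (gam t))) 0
     (2 * (Re (k z) * Re (l * v) + Im (k z) * Im (l * v)))).
  { assert (A := is_derive_mult (fun t => Re (k (gam t))) (fun t => Re (k (gam t))) 0 _ _ HR HR Rmult_comm).
    assert (B := is_derive_mult (fun t => Im (k (gam t))) (fun t => Im (k (gam t))) 0 _ _ HI HI Rmult_comm).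
    assert (E := is_derive_plus _ _ _ _ _ A B).
    cbv beta in E; rewrite g0 in E.
    match type of E with is_derive _ _ ?x =>
      replace (2 * (Re (k z) * Re (l * v) + Im (k z) * Im (l * v))) with x; [exact E|] end.
    unfold plus, mult; simpl; unfold mult; simpl; ring. }
  assert (D2 : is_derive (fun t => Re (k (gam t)) * Re (k (gam t)) + Im (k (gam t)) * Im (k (gam t))) 0 0).
  { apply is_derive_ext_loc with (fun _ => 1); [|apply (is_derive_const (V := R_NormedModule))].
    destruct Hm as [d [d0 Hd]].
    assert (Cg : rcont gam 0) by (eapply rderiv_rcont, rderiv_segment).
    destruct (Cg d d0) as [e [e0 He]].
    exists (mkposreal e e0); intros t Ht.
    rewrite <- Cmod_sqr, Hd; [symmetry; apply Rmult_1_r|]. rewrite <- g0; apply He; exact Ht. }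
  assert (E := is_derive_unique _ _ _ D); rewrite (is_derive_unique _ _ _ D2) in E.
  assert (M := near_at _ _ Hm); cbv beta in M.
  assert (S : Cmod v * Cmod v = 0).
  { rewrite Cmod_sqr; unfold v, Cconj, Cmult, Re, Im in *; simpl in *. lra. }
  assert (V : Cmod v = Cmod l).
  { unfold v; rewrite Cmod_conj, Cmod_mult, Cmod_conj, M; ring. }
  apply Cmod_eq_0; rewrite <- V; nra.
Qed.

(** The equality case of Schwarz's lemma: [h z / z] has constant modulus, hence derivative zero, and
    along the segment towards 0 it keeps the value that it approaches there, which is 1. *)
Lemma rotation_identity (h : C -> C) :
  (forall z, Cmod z < 1 -> exists l, cderiv h z l) ->
  (forall z, Cmod z < 1 -> Cmod (h z) = Cmod z) ->
  cderiv h 0 1 -> forall z, Cmod z < 1 -> h z = z.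
Proof.
  intros Hh Hm H1 z Hz.
  destruct (classic (z = 0%C)) as [->|n].
  { apply Cmod_eq_0; rewrite Hm by auto; apply Cmod_0. }
  assert (h0 : h 0%C = 0%C) by (apply Cmod_eq_0; rewrite (Hm 0%C), Cmod_0; auto; rewrite Cmod_0; lra).
  set (k := fun z => (h z * / z)%C).
  assert (pz : 0 < Cmod z) by now apply Cmod_gt_0.
  assert (Hmod : forall w : C, w <> 0%C -> Cmod w < 1 -> Cmod (k w) = 1).
  { intros w nw Hw; unfold k; rewrite Cmod_mult, Cmod_inv, Hm by auto.
    apply Rinv_r; apply Cmod_gt_0 in nw; lra. }
  assert (Hk0 : forall w : C, w <> 0%C -> Cmod w < 1 -> cderiv k w 0).
  { intros w nw Hw; destruct (Hh w Hw) as [l Hl].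
    assert (D : exists m, cderiv k w m).
    { eexists; apply cderiv_mult; [exact Hl|]; apply cderiv_inv; auto; apply cderiv_id. }
    destruct D as [m D].
    replace (RtoC 0) with m; auto.
    apply constant_modulus_derivative with k w; auto.
    near_from (near_and _ _ _ (ccont_near_neq _ w 0%C (ccont_id w) nw)
                 (ccont_mod_lt _ w 1 (ccont_id w) Hw)).
    intros y [Y1 Y2]; auto. }
  assert (Hk : forall s, 0 < s <= 1 -> k z = k (RtoC s * z)%C).
  { intros s Hs; apply Cminus_eq_0, Cmod_eq_0.
    apply Rle_antisym; [|apply Cmod_ge_0].
    replace 0 with (0 * Cmod (z - RtoC s * z)) by ring.
    apply Cmvt with (fun _ => RtoC 0); intros t Ht w; split; [|rewrite Cmod_0; lra].
    assert (Ew : w = (RtoC (s + t * (1 - s)) * z)%C).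
    { unfold w; rewrite RtoC_plus, RtoC_mult, RtoC_minus; ring. }
    assert (0 < s + t * (1 - s) <= 1) by nra.
    apply Hk0.
    - rewrite Ew; apply Cmult_neq_0; auto; intros E; apply RtoC_inj in E; lra.
    - rewrite Ew, Cmod_mult, Cmod_R, Rabs_pos_eq by lra; nra. }
  assert (k1 : k z = 1%C).
  { apply NNPP; intros N.
    assert (p : 0 < Cmod (k z - 1)) by now apply Cmod_gt_0, Cminus_neq_0.
    destruct (proj1 (cderiv_eps _ _ _) H1 (Cmod (k z - 1) / 2) ltac:(lra)) as [d [d0 Hd]].
    set (s := Rmin 1 (d / 2)).
    assert (s0 : 0 < s) by (apply Rmin_pos; lra).
    assert (s1 : s <= 1) by apply Rmin_l.
    assert (s2 : s <= d / 2) by apply Rmin_r.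
    set (w := (RtoC s * z)%C).
    assert (nw : w <> 0%C) by (apply Cmult_neq_0; auto; intros E; apply RtoC_inj in E; lra).
    assert (pw : 0 < Cmod w) by now apply Cmod_gt_0.
    assert (lw : Cmod w < d).
    { unfold w; rewrite Cmod_mult, Cmod_R, Rabs_pos_eq by lra; nra. }
    specialize (Hd w); replace (w - 0)%C with w in Hd by ring; specialize (Hd lw).
    rewrite h0 in Hd.
    rewrite (Hk s) in Hd, p by lra; fold w in Hd, p.
    replace (h w - 0 - 1 * w)%C with ((k w - 1) * w)%C in Hd by (unfold k; field; auto).
    rewrite Cmod_mult in Hd; nra. }
  replace (h z) with (k z * z)%C by (unfold k; field; auto).
  rewrite k1; ring.
Qed.

Lemma polar_mult (r s t u : R) : (polar r t * polar s u)%C = polar (r * s) (t + u).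
Proof. unfold polar, Cmult; simpl; rewrite cos_plus, sin_plus; f_equal; ring. Qed.

Lemma Cmod_polar (r t : R) : 0 <= r -> Cmod (polar r t) = r.
Proof.
  intros Hr; unfold polar, Cmod; simpl.
  replace (_ + _) with (r * r * (Rsqr (sin t) + Rsqr (cos t))) by (unfold Rsqr; ring).
  rewrite sin2_cos2, Rmult_1_r; now apply sqrt_square.
Qed.

Lemma polar_conj (r t : R) : Cconj (polar r t) = polar r (- t).
Proof. unfold polar, Cconj; simpl; rewrite cos_neg, sin_neg; f_equal; ring. Qed.

Lemma polar_period (r t : R) : polar r (t + 2 * PI) = polar r t.
Proof. unfold polar; rewrite cos_plus, sin_plus, cos_2PI, sin_2PI; f_equal; ring. Qed.

Lemma ccont_polar (r t eps : R) :
  0 < eps -> exists d, 0 < d /\ forall s, Rabs (s - t) < d -> Cmod (polar r s - polar r t) < eps.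
Proof.
  intros He.
  assert (H : rcont (polar r) t).
  { apply rderiv_rcont with (- r * sin t, r * cos t); split; simpl; auto_derive; auto; ring. }
  exact (H eps He).
Qed.

(** Conjugation changes the sign of the angle, so only the endpoints of an arc are in question. For
    [al < PI] openness keeps them out of [Omega]; for [al = PI] both are the point [-r]. *)
Lemma circularly_symmetric_conj (Omega : C -> Prop) (w : C) :
  circularly_symmetric Omega -> open Omega -> Omega w -> Omega (Cconj w).
Proof.
  intros Hc HO Hw.
  destruct (classic (w = 0%C)) as [->|n].
  { replace (Cconj 0) with (RtoC 0); auto.
    unfold Cconj, RtoC; simpl; f_equal; ring. }
  assert (r0 : 0 < Cmod w) by now apply Cmod_gt_0.
  set (r := Cmod w) in *.
  destruct (Hc r r0) as [N | [A | [al [Hal [A1 A2]]]]].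
  - exfalso; now apply (N w).
  - apply A; now rewrite Cmod_conj.
  - destruct (A2 w (conj eq_refl Hw)) as [t [Ht Et]].
    rewrite Et, polar_conj.
    destruct (Rlt_or_le (Rabs t) al) as [L|L].
    + apply A1; now rewrite Rabs_Ropp.
    + assert (Ha : Rabs t = al) by lra.
      destruct (Rlt_or_le al PI) as [Lp|Lp].
      * exfalso.
        (* an endpoint of the arc lying in the open set [Omega] could be passed *)
        destruct (near_open Omega w HO Hw) as [d [d0 Hd]].
        destruct (ccont_polar r t d d0) as [e [e0 He]].
        (* The bound [PI - al] keeps the angle [al + b] in the range where cosine is injective, so
           that it cannot name a point of the arc. *)
        set (b := Rmin (e / 2) (PI - al)).
        assert (b0 : 0 < b) by (apply Rmin_pos; lra).
        assert (b1 : b <= e / 2) by apply Rmin_l.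
        assert (b2 : b <= PI - al) by apply Rmin_r.
        assert (Hs : exists s, Rabs (s - t) < e /\ Rabs s = al + b).
        { destruct (Rle_dec 0 t) as [P|P].
          - rewrite Rabs_pos_eq in Ha by auto.
            exists (t + b); split; [rewrite Rabs_pos_eq; lra | rewrite Rabs_pos_eq; lra].
          - rewrite Rabs_left in Ha by lra.
            exists (t - b); split; [rewrite Rabs_left; lra | rewrite Rabs_left; lra]. }
        destruct Hs as [s [S1 S2]].
        assert (Os : Omega (polar r s)) by (apply Hd; rewrite Et; apply He; exact S1).
        destruct (A2 (polar r s)) as [t' [Ht' Et']].
        { split; auto; apply Cmod_polar; lra. }
        assert (Ecos : cos (Rabs s) = cos (Rabs t')).
        { assert (X : forall x, cos (Rabs x) = cos x).
          { intros x; unfold Rabs; destruct Rcase_abs; auto; apply cos_neg. }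
          rewrite !X; apply Rmult_eq_reg_l with r; [|lra].
          exact (f_equal fst Et'). }
        assert (P0 := Rabs_pos t').
        assert (L2 : cos (Rabs s) < cos (Rabs t')) by (apply cos_decreasing_1; lra).
        lra.
      * assert (Ha2 : al = PI) by lra.
        rewrite <- (polar_period r (- t)).
        assert (Ht2 : t = PI \/ t = - PI).
        { unfold Rabs in Ha; destruct Rcase_abs; lra. }
        destruct Ht2 as [-> | ->].
        -- replace (- PI + 2 * PI) with PI by ring; rewrite <- Et; exact Hw.
        -- rewrite polar_period.
           replace (- - PI) with (- PI + 2 * PI) by ring; rewrite polar_period, <- Et; exact Hw.
Qed.

(** A point strictly beyond the line at angle [phi] gets strictly closer in angle to the positive
    axis when turned by [-2 phi]. It therefore lands in the open arc, whichever endpoints the arc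
    contains. *)
Lemma circularly_symmetric_rotate (Omega : C -> Prop) (w : C) (phi : R) :
  circularly_symmetric Omega -> Omega w -> 0 < phi <= PI / 2 ->
  0 < Im (polar 1 (- phi) * w) -> Omega (polar 1 (- (2 * phi)) * w)%C.
Proof.
  intros Hc Hw Hphi HI.
  assert (n : w <> 0%C).
  { intros ->; rewrite Cmult_0_r in HI; simpl in HI; lra. }
  assert (r0 : 0 < Cmod w) by now apply Cmod_gt_0.
  set (r := Cmod w) in *.
  assert (Hm : Cmod (polar 1 (- (2 * phi)) * w) = r).
  { rewrite Cmod_mult, Cmod_polar; fold r; lra. }
  destruct (Hc r r0) as [N | [A | [al [Hal [A1 A2]]]]].
  - exfalso; now apply (N w).
  - now apply A.
  - destruct (A2 w (conj eq_refl Hw)) as [t [Ht Et]].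
    rewrite Et, polar_mult, Rmult_1_l in *.
    assert (Hsin : 0 < sin (- phi + t)).
    { unfold polar, Im in HI; simpl in HI. nra. }
    apply Rabs_le_between in Ht.
    destruct (Rlt_or_le phi t) as [L|L].
    + apply A1.
      apply Rabs_lt_between; lra.
    (* Here [w] is below the negative axis and the turn crosses that axis, so the new angle is read
       modulo [2 PI]. *)
    + destruct (Rlt_or_le t (phi - PI)) as [L2|L2].
      * rewrite <- polar_period; apply A1. apply Rabs_lt_between; lra.
      * exfalso.
        assert (S := sin_ge_0 (phi - t) ltac:(lra) ltac:(lra)).
        replace (- phi + t) with (- (phi - t)) in Hsin by ring.
        rewrite sin_neg in Hsin; lra.
Qed.

(** The map [h] is a self-map of the disk with [h 0 = 0] and [h' 0 = 1], so [|h z| <= |z|] by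
    Schwarz. Its inverse is its own conjugate: [h (conj (h z)) = conj z]. The same bound at
    [conj (h z)] is thus the reverse inequality, and [h] is the identity. *)
Lemma conformal_symmetric (Omega : C -> Prop) (f F : C -> C) (a : R) :
  inverse_pair Omega f F -> (forall w, Omega w -> Omega (Cconj w)) ->
  f 0%C = 0%C -> cderiv f 0 (RtoC a) -> a <> 0 ->
  forall z, Cmod z < 1 -> f (Cconj z) = Cconj (f z).
Proof.
  intros HP Hconj f0 fa a0.
  assert (HP' := HP); destruct HP' as [H1 [H2 H3]].
  set (h := fun z => F (Cconj (f (Cconj z)))).
  assert (Hcm : forall z, Cmod z < 1 -> Cmod (Cconj z) < 1) by (intros; now rewrite Cmod_conj).
  assert (HO : forall z, Cmod z < 1 -> Omega (Cconj (f (Cconj z)))).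
  { intros z Hz; apply Hconj, H1; auto. }
  assert (hd : forall z l, Cmod z < 1 -> cderiv f (Cconj z) l ->
     forall m, cderiv F (Cconj (f (Cconj z))) m -> cderiv h z (m * Cconj l)).
  { intros z l Hz Hl m Hm.
    apply (cderiv_comp (fun z => Cconj (f (Cconj z))) F); auto.
    now apply cderiv_conj. }
  assert (hD : forall z, Cmod z < 1 -> exists l, cderiv h z l).
  { intros z Hz; destruct (H1 _ (Hcm z Hz)) as [_ [_ [l Hl]]].
    destruct (inverse_pair_derivable _ _ _ _ HP (HO z Hz)) as [m Hm].
    eauto. }
  assert (Z1 : Cmod 0 < 1) by (rewrite Cmod_0; lra).
  assert (conj0 : forall x : R, Cconj (RtoC x) = RtoC x).
  { intros x; unfold Cconj, RtoC; simpl; f_equal; ring. }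
  assert (ha : cderiv h 0 1).
  { replace (RtoC 1) with (/ RtoC a * Cconj (RtoC a))%C.
    - apply hd; auto.
      + rewrite conj0; exact fa.
      + rewrite conj0, f0, conj0, <- f0; apply H3; auto.
    - rewrite conj0; field; intros E; apply RtoC_inj in E; auto. }
  assert (h0 : h 0%C = 0%C).
  { unfold h; rewrite conj0, f0, conj0; rewrite <- f0 at 1; apply H1; auto. }
  assert (L : forall z, Cmod z < 1 -> Cmod (h z) <= Cmod z).
  { intros z Hz; destruct (classic (z = 0%C)) as [->|n].
    { rewrite h0; lra. }
    apply (schwarz_quotient (fun z => Cmod z < 1 /\ z <> 0%C)); auto.
    - intros w [W1 W2]; repeat split; auto; apply H2; auto.
    - intros w [W1 W2]; split; auto.
      apply near_and; [apply ccont_mod_lt with (f := fun z => z); auto; apply ccont_id|].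
      apply ccont_near_neq with (f := fun z => z); auto; apply ccont_id.
    - intros p Hp Np eps He.
      assert (p = 0%C) by (apply NNPP; intros X; apply Np; auto). subst p.
      near_from (cderiv_0_bound h 1 eps ha h0 Cmod_1 He); intros w Hw [_ nw]; auto. }
  assert (E : forall z, Cmod z < 1 -> Cmod (h z) = Cmod z).
  { intros z Hz; apply Rle_antisym; auto.
    destruct (H2 _ (HO z Hz)) as [B1 B2]; fold (h z) in B1, B2.
    assert (B3 := L (Cconj (h z)) (Hcm _ B1)).
    unfold h at 1 in B3; rewrite Cconj_conj, B2, Cconj_conj in B3.
    destruct (H1 _ (Hcm z Hz)) as [_ [B4 _]].
    rewrite B4, !Cmod_conj in B3; exact B3. }
  intros z Hz.
  assert (I := rotation_identity h hD E ha z Hz).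
  destruct (H2 _ (HO z Hz)) as [_ B2]; fold (h z) in B2; rewrite I in B2.
  rewrite B2, Cconj_conj; reflexivity.
Qed.

(* Comparison of Green's functions: in the half-plane [Im (e^{-i phi} w) > 0]
   the map [w |-> e^{-2 i phi} w] agrees in modulus of [F] with the reflection
   across the boundary line, so the quotient [F (e^{-2 i phi} w) / F w] has
   modulus at most 1 on the whole boundary. *)
Lemma reflected_green_le (Omega : C -> Prop) (f F : C -> C) (a phi : R) :
  inverse_pair Omega f F -> circularly_symmetric Omega ->
  (forall w, Omega w -> Omega (Cconj w)) ->
  f 0%C = 0%C -> cderiv f 0 (RtoC a) -> a <> 0 -> 0 < phi <= PI / 2 ->
  forall z, Cmod z < 1 -> 0 < Im (polar 1 (- phi) * f z) ->
  Cmod (F (polar 1 (- (2 * phi)) * f z)%C) <= Cmod z.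
Proof.
  intros HP Hcirc Hconj f0 fa a0 Hphi.
  assert (Sym := conformal_symmetric Omega f F a HP Hconj f0 fa a0).
  assert (HP' := HP); destruct HP' as [H1 [H2 H3]].
  set (u := polar 1 (- phi)); set (c := polar 1 (- (2 * phi))).
  assert (cu : c = (u * u)%C).
  { unfold c, u; rewrite polar_mult; f_equal; ring. }
  assert (um : Cmod u = 1) by (apply Cmod_polar; lra).
  assert (cm : Cmod c = 1) by (apply Cmod_polar; lra).
  assert (Cf : forall z, Cmod z < 1 -> ccont f z).
  { intros z Hz; destruct (H1 z Hz) as [_ [_ [l Hl]]]; eapply cderiv_ccont; eauto. }
  set (h := fun z => F (c * f z)%C).
  set (U := fun z => Cmod z < 1 /\ 0 < Im (u * f z)).
  assert (Cim : forall z, Cmod z < 1 -> forall eps, 0 < eps ->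
     near z (fun y => Rabs (Im (u * f y) - Im (u * f z)) < eps)).
  { intros z Hz eps He.
    assert (Cu : ccont (fun z => u * f z)%C z) by (apply ccont_mult; auto; apply ccont_const).
    near_from (Cu eps He); intros y Hy.
    eapply Rle_lt_trans; [|exact Hy]; eapply Rle_trans; [|apply im_le_Cmod]; right; reflexivity. }
  assert (HOU : forall z, U z -> Omega (c * f z)%C).
  { intros z [Hz Hi]; apply circularly_symmetric_rotate; auto; apply H1; auto. }
  assert (hd : forall z, Cmod z < 1 -> Omega (c * f z)%C -> exists l, cderiv h z l).
  { intros z Hz Ho; destruct (H1 z Hz) as [_ [_ [l Hl]]].
    destruct (inverse_pair_derivable _ _ _ _ HP Ho) as [m Hm].
    eexists; apply (cderiv_comp (fun z => c * f z)%C F); [|exact Hm].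
    apply cderiv_scal; exact Hl. }
  intros z Hz Hi; apply (schwarz_quotient U h); [| | |split; auto].
  - intros w Hw; assert (Hw' := Hw); destruct Hw' as [W1 W2]; repeat split; auto.
    + intros ->; rewrite f0, Cmult_0_r in W2; simpl in W2; lra.
    + apply H2, HOU; auto.
  - intros w Hw; assert (Hw' := Hw); destruct Hw' as [W1 W2]; split.
    + apply near_and; [apply ccont_mod_lt with (f := fun z => z); auto; apply ccont_id|].
      near_from (Cim w W1 _ W2); intros y Hy; apply Rabs_lt_between in Hy; lra.
    + exact (hd w W1 (HOU w Hw)).
  - intros p Hp Np eps He.
    assert (Hle : Im (u * f p) <= 0) by (apply Rnot_lt_le; intros L; apply Np; split; auto).
    destruct (Rle_lt_or_eq_dec _ _ Hle) as [L|E].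
    + near_from (Cim p Hp (- Im (u * f p)) ltac:(lra)); intros y Hy [_ Hy2].
      apply Rabs_lt_between in Hy; lra.
    (* On the line, turning by [-2 phi] agrees with conjugation, so [h p = conj p] and the quotient
       has modulus one at [p <> 0]. *)
    + assert (Er : (c * f p = f (Cconj p))%C).
      { rewrite Sym by auto.
        assert (Ec : Cconj (u * f p) = (u * f p)%C).
        { apply C_ext; [apply re_conj|]. rewrite im_conj, E; ring. }
        rewrite Cmult_conj in Ec.
        rewrite cu, <- Cmult_assoc, <- Ec, Cmult_assoc.
        rewrite <- Cmod2_conj, um; replace (1 ^ 2) with 1 by ring; ring. }
      assert (Hcp : Cmod (Cconj p) < 1) by now rewrite Cmod_conj.
      destruct (H1 _ Hcp) as [O1 [O2 _]].
      assert (Ep : h p = Cconj p) by (unfold h; rewrite Er; exact O2).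
      destruct (classic (p = 0%C)) as [->|n].
      (* At the origin the quotient is undefined, but [h] has there the derivative [c], of modulus
         one. *)
      * assert (D : cderiv h 0 c).
        { replace c with (/ RtoC a * (c * RtoC a))%C
            by (field; intros X; apply RtoC_inj in X; auto).
          apply (cderiv_comp (fun z => c * f z)%C F); [now apply cderiv_scal|].
          rewrite f0, Cmult_0_r, <- f0; apply H3; auto. }
        assert (h0 : h 0%C = 0%C).
        { unfold h; rewrite f0, Cmult_0_r; rewrite <- f0 at 1; apply H1; auto. }
        near_from (cderiv_0_bound h c eps D h0 cm He); intros w Hw [_ Uw]; apply Hw.
        intros ->; rewrite f0, Cmult_0_r in Uw; simpl in Uw; lra.
      * assert (pp : 0 < Cmod p) by now apply Cmod_gt_0.
        destruct (hd p Hp ltac:(rewrite Er; exact O1)) as [l Hl].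
        assert (Ck : ccont (fun z => h z * / z)%C p).
        { apply ccont_mult; [eapply cderiv_ccont; eauto|].
          apply ccont_inv; auto; apply ccont_id. }
        assert (N := near_and _ _ _ (ccont_near_neq _ p 0%C (ccont_id p) n)
          (ccont_mod_lt _ p (1 + eps) Ck ltac:(cbv beta;
             rewrite Ep, Cmod_mult, Cmod_conj, Cmod_inv, Rinv_r by (auto; lra); lra))).
        near_from N; intros w [W1 W2] _.
        assert (pw : 0 < Cmod w) by now apply Cmod_gt_0.
        rewrite Cmod_mult, Cmod_inv in W2 by auto.
        apply Rmult_lt_compat_r with (r := Cmod w) in W2; auto.
        rewrite Rmult_assoc, Rinv_l in W2 by lra; lra.
Qed.

(** * Convexity along the real axis *)

Lemma mean_value_R (g g1 : R -> R) (x y : R) :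
  x < y -> (forall z, x <= z <= y -> is_derive g z (g1 z)) ->
  exists c, x < c < y /\ g y - g x = g1 c * (y - x).
Proof.
  intros L H.
  destruct (MVT_cor2 g g1 x y L) as [c [E Hc]]; [|exists c; auto].
  intros z Hz; now apply is_derive_Reals, H.
Qed.

Lemma second_derivative_at_maximum (N N1 : R -> R) (L : R) :
  (forall t, is_derive N t (N1 t)) -> is_derive N1 0 L -> N1 0 = 0 ->
  (forall t, N t <= N 0) -> L <= 0.
Proof.
  intros HN HL H0 Hmax; apply Rnot_lt_le; intros P.
  destruct (proj1 (is_derive_eps _ _ _) HL (L / 2) ltac:(lra)) as [d [d0 Hd]].
  destruct (mean_value_R N N1 0 (d / 2)) as [c [Hc E]]; [lra | auto |].
  specialize (Hd c ltac:(rewrite Rminus_0_r, Rabs_pos_eq; lra)).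
  rewrite H0, !Rminus_0_r, (Rabs_pos_eq c) in Hd by lra.
  apply Rabs_le_between in Hd.
  specialize (Hmax (d / 2)).
  assert (0 < N1 c) by nra. nra.
Qed.

(* [q = r g' / g - 1] is nondecreasing by the differential inequality and tends
   to 0 at 0. *)
Lemma log_slope_ge_1 (g g1 g2 : R -> R) :
  (forall x, -1 < x < 1 -> is_derive g x (g1 x)) ->
  (forall x, -1 < x < 1 -> is_derive g1 x (g2 x)) ->
  g 0 = 0 -> (forall x, -1 < x < 1 -> 0 < g1 x) ->
  (forall r, 0 < r < 1 -> g1 r * (r * g1 r - g r) <= r * (g r * g2 r)) ->
  (forall r, 0 < r < 1 -> 0 < g r) /\
  (forall r s, 0 < r -> r <= s -> s < 1 ->
     (r * g1 r - g r) / g r <= (s * g1 s - g s) / g s) /\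
  (forall r, 0 < r < 1 -> 0 <= r * g1 r - g r).
Proof.
  intros D1 D2 g0 P1 I.
  assert (gp : forall r, 0 < r < 1 -> 0 < g r).
  { intros r Hr; destruct (mean_value_R g g1 0 r) as [c [Hc E]]; [lra | |].
    - intros; apply D1; lra.
    - assert (T := P1 c ltac:(lra)). rewrite g0 in E; nra. }
  set (q := fun r => (r * g1 r - g r) / g r).
  assert (qm : forall r s, 0 < r -> r <= s -> s < 1 -> q r <= q s).
  { intros r s Hr Hrs Hs; destruct (Req_dec r s) as [->|n]; [lra|].
    destruct (mean_value_R q (fun r => (r * g2 r * g r - (r * g1 r - g r) * g1 r) / (g r) ^ 2) r s)
      as [c [Hc E]]; [lra | |].
    - intros z Hz.
      assert (Dz := D1 z ltac:(lra)); assert (Dz2 := D2 z ltac:(lra));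
        assert (T := gp z ltac:(lra)).
      apply (is_derive_div (fun r => r * g1 r - g r) g z (z * g2 z) (g1 z)); [|exact Dz|lra].
      assert (A := is_derive_mult (fun x => x) g1 z 1 (g2 z) (is_derive_id z) Dz2 Rmult_comm).
      assert (B := is_derive_minus _ _ _ _ _ A Dz).
      replace (z * g2 z) with (minus (plus (mult 1 (g1 z)) (mult z (g2 z))) (g1 z)).
      + exact B.
      + unfold minus, plus, opp, mult; simpl; unfold mult; simpl; ring.
    - assert (T := gp c ltac:(lra)); assert (T2 := I c ltac:(lra)).
      assert (0 <= (c * g2 c * g c - (c * g1 c - g c) * g1 c) / g c ^ 2).
      { apply Rmult_le_pos; [lra|]; left; apply Rinv_0_lt_compat, pow_lt; auto. }
      nra. }
  repeat split; auto.
  intros r0 Hr0; apply Rnot_lt_le; intros L.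
  assert (T0 := gp r0 Hr0).
  set (eta := - q r0).
  assert (eta0 : 0 < eta).
  { unfold eta, q. replace (- ((r0 * g1 r0 - g r0) / g r0)) with (- (r0 * g1 r0 - g r0) / g r0)
      by (field; lra). apply Rdiv_lt_0_compat; lra. }
  set (a := g1 0).
  assert (a0 : 0 < a) by (apply P1; lra).
  (* If [q <= - eta] near 0, the approximations [g r <= (a + e) r] and [g1 r > a - e] give
     [a - e < (1 - Rmin eta 1) (a + e)], which this [e] makes impossible. The minimum with 1 keeps
     the factor nonnegative. *)
  set (e := Rmin eta 1 * a / 4).
  assert (m0 : 0 < Rmin eta 1) by (apply Rmin_pos; lra).
  assert (m1 : Rmin eta 1 <= 1) by apply Rmin_r.
  assert (m2 : Rmin eta 1 <= eta) by apply Rmin_l.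
  assert (e0 : 0 < e) by (unfold e; nra).
  destruct (proj1 (is_derive_eps _ _ _) (D1 0 ltac:(lra)) e e0) as [d [d0 Hd]].
  assert (C1 : continuity_pt g1 0) by (eapply is_derive_continuity_pt, D2; lra).
  destruct (C1 e e0) as [k [k0 Hk]].
  set (r := Rmin r0 (Rmin d k) / 2).
  assert (r1 : 0 < r) by (apply Rdiv_lt_0_compat; [repeat apply Rmin_pos; lra | lra]).
  assert (T1 := Rmin_l r0 (Rmin d k)); assert (T2 := Rmin_r r0 (Rmin d k)).
  assert (T3 := Rmin_l d k); assert (T4 := Rmin_r d k).
  specialize (Hd r ltac:(rewrite Rminus_0_r, Rabs_pos_eq; unfold r in *; lra)).
  rewrite g0, !Rminus_0_r, (Rabs_pos_eq r) in Hd by lra; fold a in Hd.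
  apply Rabs_le_between in Hd.
  assert (Hk' : Rabs (g1 r - a) < e).
  { apply (Hk r); split; [split; [exact Logic.I | lra]|].
    simpl; unfold Rdist; rewrite Rminus_0_r, Rabs_pos_eq; unfold r in *; lra. }
  apply Rabs_lt_between in Hk'.
  assert (Hq := qm r r0 ltac:(lra) ltac:(unfold r in *; lra) ltac:(lra)).
  assert (gr := gp r ltac:(unfold r in *; lra)).
  assert (Hq2 : r * g1 r - g r <= - eta * g r).
  { replace (r * g1 r - g r) with (q r * g r) by (unfold q; field; lra).
    apply Rmult_le_compat_r; unfold eta; lra. }
  assert (Hq3 : r * g1 r <= (1 - Rmin eta 1) * g r) by nra.
  assert (Hq4 : (1 - Rmin eta 1) * g r <= (1 - Rmin eta 1) * ((a + e) * r))
    by (apply Rmult_le_compat_l; lra).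
  assert (Hq5 : (a - e) * r < r * g1 r) by nra.
  assert (Hq6 : (a - e) * r < (1 - Rmin eta 1) * (a + e) * r) by lra.
  apply Rmult_lt_reg_r in Hq6; [|exact r1].
  unfold e in *; nra.
Qed.

Lemma log_convex_derivative (g g1 g2 : R -> R) :
  (forall x, -1 < x < 1 -> is_derive g x (g1 x)) ->
  (forall x, -1 < x < 1 -> is_derive g1 x (g2 x)) ->
  g 0 = 0 -> (forall x, -1 < x < 1 -> 0 < g1 x) ->
  (forall r, 0 < r < 1 -> g1 r * (r * g1 r - g r) <= r * (g r * g2 r)) ->
  (forall x y, 0 <= x -> x <= y -> y < 1 -> g1 x <= g1 y) /\
  (forall x y, 0 <= x -> x < y -> y < 1 -> g1 x = g1 y ->
     exists m c, 0 < m < 1 /\ 0 < c /\ forall r, 0 < r <= m -> g r = c * r).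
Proof.
  intros D1 D2 g0 P1 I.
  destruct (log_slope_ge_1 g g1 g2 D1 D2 g0 P1 I) as [gp [qm W0]].
  assert (g2p : forall r, 0 < r < 1 -> 0 <= g2 r).
  { intros r Hr; assert (T1 := I r Hr); assert (T2 := W0 r Hr); assert (T3 := gp r Hr);
      assert (T4 := P1 r ltac:(lra)).
    assert (0 <= g1 r * (r * g1 r - g r)) by (apply Rmult_le_pos; lra).
    apply Rnot_lt_le; intros L.
    assert (0 < r * g r) by (apply Rmult_lt_0_compat; lra). nra. }
  assert (mono : forall x y, 0 <= x -> x <= y -> y < 1 -> g1 x <= g1 y).
  { intros x y Hx Hxy Hy; destruct (Req_dec x y) as [->|n]; [lra|].
    destruct (mean_value_R g1 g2 x y) as [c [Hc E]]; [lra | |].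
    - intros; apply D2; lra.
    - assert (T := g2p c ltac:(lra)); nra. }
  split; auto.
  intros x y Hx Hxy Hy E.
  set (m := (x + y) / 2).
  assert (Hm : x < m < y) by (unfold m; lra).
  (* Being monotone, [g1] is constant between [x] and [y], so [g2] vanishes at the midpoint. The
     differential inequality then annihilates the nonnegative [m g1 m - g m], and monotonicity of
     the quotient does the same on all of [(0, m]]. *)
  assert (Z : g2 m = 0).
  { assert (T := is_derive_unique _ _ _ (D2 m ltac:(lra))).
    rewrite <- T; apply is_derive_unique.
    apply is_derive_ext_loc with (fun _ => g1 x); [|apply (is_derive_const (V := R_NormedModule))].
    exists (mkposreal (m - x) ltac:(lra)); intros t Ht.
    change (Rabs (t - m) < m - x) in Ht; apply Rabs_lt_between in Ht.
    assert (U1 := mono x t ltac:(lra) ltac:(lra) ltac:(unfold m in *; lra)).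
    assert (U2 := mono t y ltac:(lra) ltac:(unfold m in *; lra) ltac:(lra)).
    lra. }
  assert (Wm : m * g1 m - g m = 0).
  { assert (T1 := I m ltac:(lra)); assert (T2 := W0 m ltac:(lra)); assert (T4 := P1 m ltac:(lra)).
    rewrite Z in T1. nra. }
  assert (Wz : forall r, 0 < r <= m -> r * g1 r - g r = 0).
  { intros r Hr; assert (T1 := qm r m ltac:(lra) ltac:(lra) ltac:(lra)).
    assert (T2 := W0 r ltac:(lra)); assert (T3 := gp r ltac:(lra)).
    rewrite Wm in T1; unfold Rdiv in T1; rewrite Rmult_0_l in T1.
    assert (0 < / g r) by now apply Rinv_0_lt_compat. nra. }
  exists m, (g m / m); repeat split; try lra.
  { apply Rdiv_lt_0_compat; [apply gp|]; lra. }
  intros r Hr; destruct (Req_dec r m) as [->|n]; [field; lra|].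
  destruct (mean_value_R (fun r => g r / r) (fun r => (g1 r * r - g r * 1) / r ^ 2) r m)
    as [c [Hc Ec]]; [lra | |].
  - intros z Hz; apply (is_derive_div g (fun r => r) z (g1 z) 1); [apply D1; lra | apply (is_derive_id (K := R_AbsRing)) | lra].
  - assert (T := Wz c ltac:(lra)).
    replace (g1 c * c - g c * 1) with 0 in Ec by lra.
    unfold Rdiv in Ec at 3; rewrite !Rmult_0_l in Ec.
    replace (g m / m) with (g r / r) by lra. field; lra.
Qed.

(** The mean value theorem on both sides of the intermediate point; it turns monotonicity of [g1]
    into convexity and strict monotonicity into strict convexity. *)
Lemma secant_defect (g g1 : R -> R) (x y t : R) :
  (forall z, -1 < z < 1 -> is_derive g z (g1 z)) ->
  -1 < x -> x < y -> y < 1 -> 0 < t < 1 ->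
  exists c1 c2, x < c1 /\ c1 < c2 /\ c2 < y /\
    (1 - t) * g x + t * g y - g ((1 - t) * x + t * y)
      = t * (1 - t) * (y - x) * (g1 c2 - g1 c1).
Proof.
  intros D Hx Hxy Hy Ht.
  set (z := (1 - t) * x + t * y).
  assert (z1 : z - x = t * (y - x)) by (unfold z; ring).
  assert (z2 : y - z = (1 - t) * (y - x)) by (unfold z; ring).
  assert (Hz : x < z < y) by nra.
  destruct (mean_value_R g g1 x z) as [c1 [H1 E1]]; [lra | intros; apply D; lra |].
  destruct (mean_value_R g g1 z y) as [c2 [H2 E2]]; [lra | intros; apply D; lra |].
  exists c1, c2; repeat split; try lra.
  rewrite z1 in E1; rewrite z2 in E2.
  replace (g y) with (g z + g1 c2 * ((1 - t) * (y - x))) by lra.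
  replace (g x) with (g z - g1 c1 * (t * (y - x))) by lra.
  ring.
Qed.

Lemma real_of_conj (z : C) : Cconj z = z -> z = RtoC (Re z).
Proof.
  intros E; apply C_ext; [reflexivity|].
  assert (T := im_conj z); rewrite E in T.
  change (Im z = 0); lra.
Qed.

Lemma conj_RtoC (x : R) : Cconj (RtoC x) = RtoC x.
Proof. unfold Cconj, RtoC; simpl; f_equal; ring. Qed.

Lemma derivative_conj (f f' : C -> C) :
  (forall z, Cmod z < 1 -> f (Cconj z) = Cconj (f z)) ->
  (forall z, Cmod z < 1 -> cderiv f z (f' z)) ->
  forall z, Cmod z < 1 -> f' (Cconj z) = Cconj (f' z).
Proof.
  intros Hs Hf z Hz.
  apply cderiv_unique with f (Cconj z); [apply Hf; now rewrite Cmod_conj|].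
  assert (D : cderiv (fun y => Cconj (f (Cconj y))) (Cconj z) (Cconj (f' z))).
  { apply cderiv_conj; rewrite Cconj_conj; auto. }
  revert D; apply cderiv_ext.
  assert (Hz' : Cmod (Cconj z) < 1) by now rewrite Cmod_conj.
  near_from (ccont_mod_lt _ _ 1 (ccont_id (Cconj z)) Hz').
  intros y Hy; rewrite Hs, Cconj_conj by auto; reflexivity.
Qed.

Lemma restriction_derivative (f : C -> C) (x : R) (l : C) :
  cderiv f (RtoC x) l -> is_derive (fun t => Re (f (RtoC t))) x (Re l).
Proof.
  intros D.
  assert (H : rderiv RtoC x 1) by (split; simpl; auto_derive; auto).
  destruct (rderiv_comp f RtoC x l 1 D H) as [A _].
  rewrite Cmult_1_r in A; exact A.
Qed.

Lemma rderiv_polar (r t : R) : rderiv (polar r) t (Ci * polar r t).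
Proof.
  split; unfold polar, Ci, Cmult, Re, Im; simpl; auto_derive; auto; ring.
Qed.

(* Second-order condition for [|f (r e^{i t})|^2] to be maximal at [t = 0]. *)
Lemma second_order_inequality (f f' f'' : C -> C) (r : R) :
  (forall z, Cmod z < 1 -> cderiv f z (f' z)) ->
  (forall z, Cmod z < 1 -> cderiv f' z (f'' z)) ->
  0 < r < 1 -> Im (f r) = 0 -> Im (f' r) = 0 ->
  (forall z, Cmod z = r -> Cmod (f z) <= Cmod (f r)) ->
  r * Re (f' r) * (r * Re (f' r)) <= Re (f r) * (r * Re (f' r) + r * r * Re (f'' r)).
Proof.
  intros Hf Hf' Hr I0 I1 Hmax.
  assert (Hp : forall t, Cmod (polar r t) < 1) by (intros; rewrite Cmod_polar; lra).
  assert (p0 : polar r 0 = RtoC r).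
  { unfold polar, RtoC; rewrite cos_0, sin_0; f_equal; ring. }
  set (Phi := fun t => f (polar r t)).
  set (Psi := fun t => (f' (polar r t) * (Ci * polar r t))%C).
  set (dPsi := ((f'' r * (Ci * r) + f' r * (Ci * 1)) * (Ci * r))%C).
  assert (DPhi : forall t, rderiv Phi t (Psi t)).
  { intros t; apply rderiv_comp; [apply Hf; auto | apply rderiv_polar]. }
  assert (DPsi : rderiv Psi 0 dPsi).
  { unfold dPsi; rewrite <- p0.
    apply (rderiv_comp (fun z => f' z * (Ci * z))%C (polar r)); [|apply rderiv_polar].
    apply cderiv_mult; [apply Hf'; auto | apply cderiv_scal, cderiv_id]. }
  assert (L : 2 * (Re (Psi 0) * Re (Psi 0) + Im (Psi 0) * Im (Psi 0)
                   + Re (Phi 0) * Re dPsi + Im (Phi 0) * Im dPsi) <= 0).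
  { apply (second_derivative_at_maximum
      (fun t => Re (Phi t) * Re (Phi t) + Im (Phi t) * Im (Phi t))
      (fun t => 2 * (Re (Phi t) * Re (Psi t) + Im (Phi t) * Im (Psi t)))).
    - intros t; destruct (DPhi t) as [A B].
      assert (A2 := is_derive_mult _ _ _ _ _ A A Rmult_comm).
      assert (B2 := is_derive_mult _ _ _ _ _ B B Rmult_comm).
      assert (E := is_derive_plus _ _ _ _ _ A2 B2).
      match type of E with is_derive _ _ ?x =>
        replace (2 * (Re (Phi t) * Re (Psi t) + Im (Phi t) * Im (Psi t))) with x; [exact E|] end.
      unfold plus, mult; simpl; unfold mult; simpl; ring.
    - destruct (DPhi 0) as [A B]; destruct DPsi as [A' B'].
      assert (A2 := is_derive_mult _ _ _ _ _ A A' Rmult_comm).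
      assert (B2 := is_derive_mult _ _ _ _ _ B B' Rmult_comm).
      assert (E := is_derive_scal _ _ 2 _ (is_derive_plus _ _ _ _ _ A2 B2)).
      match type of E with is_derive _ _ ?x =>
        match goal with |- is_derive _ _ ?y => replace y with x; [exact E|] end end.
      unfold plus, mult; simpl; unfold mult; simpl; ring.
    (* The first derivative vanishes because [f r] is real while [f' r * (i r)] is purely
       imaginary. *)
    - unfold Phi, Psi; rewrite p0, I0.
      rewrite re_mult, I1. unfold Ci, Cmult, RtoC, Re, Im; simpl; ring.
    - intros t; rewrite <- !Cmod_sqr.
      assert (T := Hmax (polar r t) ltac:(apply Cmod_polar; lra)).
      unfold Phi; rewrite p0.
      assert (T2 := Cmod_ge_0 (f (polar r t))). nra. }
  unfold Phi, Psi, dPsi in L; rewrite p0, I0 in L.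
  destruct (f' r) as [u v], (f'' r) as [u2 v2], (f r) as [u0 v0].
  unfold Re, Im in *; simpl in *; subst v v0. nra.
Qed.

Lemma polar_of_upper (w : C) :
  w <> 0%C -> 0 <= Im w -> exists t, 0 <= t <= PI /\ w = polar (Cmod w) t.
Proof.
  intros n HI.
  assert (p : 0 < Cmod w) by now apply Cmod_gt_0.
  assert (S := Cmod_sqr w).
  set (x := Re w / Cmod w).
  assert (Ex : Re w = Cmod w * x) by (unfold x; field; lra).
  assert (Bx : -1 <= x <= 1).
  { assert (T := re_le_Cmod w); apply Rabs_le_between in T.
    split; apply Rmult_le_reg_l with (Cmod w); lra. }
  exists (acos x); split; [apply acos_bound|].
  unfold polar; rewrite cos_acos, sin_acos by exact Bx.
  apply C_ext; [exact Ex|]. simpl.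
  replace (sqrt (1 - x²)) with (Im w / Cmod w); [field; lra|].
  symmetry; apply sqrt_lem_1.
  - unfold Rsqr; nra.
  - apply Rmult_le_pos; auto; left; now apply Rinv_0_lt_compat.
  - unfold Rsqr. apply Rmult_eq_reg_l with (Cmod w * Cmod w); [|nra].
    replace (Cmod w * Cmod w * (Im w / Cmod w * (Im w / Cmod w))) with (Im w * Im w) by (field; lra).
    replace (Cmod w * Cmod w * (1 - x * x)) with (Cmod w * Cmod w - Cmod w * x * (Cmod w * x)) by ring.
    rewrite <- Ex; lra.
Qed.

(** For [f z] of angle [t] in the upper half-plane, the choice [phi = t / 2] rotates it onto the
    positive axis, and [reflected_green_le] puts the preimage [x] of the rotated point within
    [|x| <= |z|]. By symmetry [x] is real, of either sign a priori, which is why monotonicity is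
    asked for on the whole diameter. Conjugation settles the lower half-plane. *)
Lemma modulus_maximal_on_positive_axis (Omega : C -> Prop) (f F : C -> C) (a : R) :
  inverse_pair Omega f F -> circularly_symmetric Omega ->
  (forall w, Omega w -> Omega (Cconj w)) ->
  f 0%C = 0%C -> cderiv f 0 (RtoC a) -> a <> 0 ->
  (forall x y, -1 < x -> x <= y -> y < 1 -> Re (f x) <= Re (f y)) ->
  forall z, Cmod z < 1 -> Cmod (f z) <= Re (f (RtoC (Cmod z))).
Proof.
  intros HP Hcirc Hconj f0 fa a0 Hmono.
  assert (Sym := conformal_symmetric Omega f F a HP Hconj f0 fa a0).
  assert (HP' := HP); destruct HP' as [H1 [H2 H3]].
  assert (Real : forall z x, Cmod z < 1 -> f z = RtoC x -> z = RtoC (Re z)).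
  { intros z x Hz E; apply real_of_conj.
    destruct (H1 z Hz) as [_ [E1 _]].
    destruct (H1 (Cconj z)) as [_ [E2 _]]; [now rewrite Cmod_conj|].
    transitivity (F (f (Cconj z))); [now symmetry|].
    rewrite Sym, E, conj_RtoC, <- E by auto; exact E1. }
  assert (Key : forall z x, Cmod z < 1 -> Cmod x <= Cmod z -> f x = RtoC (Cmod (f z)) ->
     Cmod (f z) <= Re (f (RtoC (Cmod z)))).
  { intros z x Hz Hx E.
    assert (Ex := Real x _ ltac:(lra) E).
    assert (B := re_le_Cmod x); apply Rabs_le_between in B.
    assert (T := Hmono (Re x) (Cmod z) ltac:(lra) ltac:(lra) Hz).
    rewrite <- Ex, E, re_RtoC in T; exact T. }
  assert (Upper : forall z, Cmod z < 1 -> 0 <= Im (f z) -> Cmod (f z) <= Re (f (RtoC (Cmod z)))).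
  { intros z Hz HI.
    destruct (H1 z Hz) as [O _].
    destruct (classic (f z = 0%C)) as [E|n].
    { apply Key with (RtoC 0); auto; rewrite ?E, ?Cmod_0; auto; apply Cmod_ge_0. }
    assert (p : 0 < Cmod (f z)) by now apply Cmod_gt_0.
    destruct (polar_of_upper (f z) n HI) as [t [Ht Et]].
    destruct (Req_dec t 0) as [->|nt].
    - apply Key with z; auto; [lra|].
      rewrite Et at 1; unfold polar, RtoC; rewrite cos_0, sin_0; f_equal; ring.
    - assert (PI0 := PI_RGT_0).
      assert (Him : 0 < Im (polar 1 (- (t / 2)) * f z)).
      { rewrite Et, polar_mult; unfold polar, Im; simpl; rewrite Rmult_1_l.
        replace (- (t / 2) + t) with (t / 2) by field.
        apply Rmult_lt_0_compat; auto; apply sin_gt_0; lra. }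
      assert (G := reflected_green_le Omega f F a (t / 2) HP Hcirc Hconj f0 fa a0
                    ltac:(lra) z Hz Him).
      assert (Oc := circularly_symmetric_rotate Omega (f z) (t / 2) Hcirc O ltac:(lra) Him).
      destruct (H2 _ Oc) as [B1 B2].
      apply (Key z _ Hz G); rewrite B2, Et at 1.
      rewrite polar_mult, Rmult_1_l.
      replace (- (2 * (t / 2)) + t) with 0 by field.
      unfold polar, RtoC; rewrite cos_0, sin_0; f_equal; ring. }
  intros z Hz; destruct (Rle_dec 0 (Im (f z))) as [L|L]; auto.
  assert (Hz' : Cmod (Cconj z) < 1) by now rewrite Cmod_conj.
  assert (T := Upper (Cconj z) Hz').
  rewrite Sym, im_conj, !Cmod_conj in T by auto. apply T; lra.
Qed.

Theorem theorem4p1 (Omega : C -> Prop) (f : C -> C)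
  (hcirc : circularly_symmetric Omega)
  (hsc : simply_connected_domain Omega)
  (hproper : proper Omega)
  (h0 : Omega (RtoC 0))
  (hf : conformal_map f unit_disk Omega)
  (hf0 : f (RtoC 0) = RtoC 0)
  (hf'0 : exists a : R, 0 < a /\
     is_derive (K := C_AbsRing) (V := C_NormedModule) f (RtoC 0) (RtoC a)) :
  let I := fun x : R => 0 <= x < 1 in
  let g := fun x : R => Re (f (RtoC x)) in
  (forall x, I x -> f (RtoC x) = RtoC (g x)) /\
  (forall x, 0 < x < 1 -> 0 < g x) /\
  strictly_increasing_on I g /\
  convex_on I g /\
  (~ disk_centred_at_0 Omega -> strictly_convex_on I g).
Proof.
  intros I g.
  destruct hsc as [[_ [HO _]] _].
  destruct hf'0 as [a [a0 fa]]; apply is_derive_cderiv in fa.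
  destruct (conformal_map_inverse Omega f HO hf) as [F HP].
  assert (Hconj : forall w, Omega w -> Omega (Cconj w))
    by (intros; now apply circularly_symmetric_conj).
  assert (Sym := conformal_symmetric Omega f F a HP Hconj hf0 fa ltac:(lra)).
  assert (HP' := HP); destruct HP' as [H1 [H2 H3]].
  assert (Hb : hol_ball f 0 1).
  { intros z Hz; replace (z - 0)%C with z in Hz by ring; now apply H1. }
  destruct (hol_ball_derivative f 0 1 Hb) as [f' [Df Hb']].
  destruct (hol_ball_derivative f' 0 1 Hb') as [f'' [Df' _]].
  assert (Df1 : forall z, Cmod z < 1 -> cderiv f z (f' z)).
  { intros z Hz; apply Df; now replace (z - 0)%C with z by ring. }
  assert (Df2 : forall z, Cmod z < 1 -> cderiv f' z (f'' z)).
  { intros z Hz; apply Df'; now replace (z - 0)%C with z by ring. }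
  assert (Sym' := derivative_conj f f' Sym Df1).
  assert (Hx : forall x : R, -1 < x < 1 -> Cmod (RtoC x) < 1).
  { intros x Hx; rewrite Cmod_R; now apply Rabs_lt_between. }
  assert (Rf : forall x : R, -1 < x < 1 -> f (RtoC x) = RtoC (g x)).
  { intros x Hxx; apply real_of_conj; rewrite <- Sym, conj_RtoC by auto; reflexivity. }
  set (g1 := fun x : R => Re (f' (RtoC x))).
  set (g2 := fun x : R => Re (f'' (RtoC x))).
  assert (Rf' : forall x : R, -1 < x < 1 -> f' (RtoC x) = RtoC (g1 x)).
  { intros x Hxx; apply real_of_conj; rewrite <- Sym', conj_RtoC by auto; reflexivity. }
  assert (D1 : forall x, -1 < x < 1 -> is_derive g x (g1 x)).
  { intros x Hxx; apply restriction_derivative; auto. }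
  assert (D2 : forall x, -1 < x < 1 -> is_derive g1 x (g2 x)).
  { intros x Hxx; apply restriction_derivative; auto. }
  assert (g10 : 0 < g1 0).
  { unfold g1; rewrite (cderiv_unique f 0 (f' 0%C) (RtoC a)); auto.
    apply Df1, Hx; lra. }
  assert (gn : forall x, -1 < x < 1 -> g1 x <> 0).
  { intros x Hxx E.
    destruct (H3 (RtoC x) (f' (RtoC x)) (Hx x Hxx) (Df1 _ (Hx x Hxx))) as [n _].
    apply n; rewrite Rf', E by auto; reflexivity. }
  assert (C1 : forall x, -1 < x < 1 -> continuity_pt g1 x).
  { intros x Hxx; eapply is_derive_continuity_pt; auto. }
  (* On the diameter [f'] is real, continuous and never zero, so it keeps the sign that it has at
     0. *)
  assert (gpos : forall x, -1 < x < 1 -> 0 < g1 x).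
  { intros x Hxx; apply Rnot_le_lt; intros L.
    assert (N := gn x Hxx).
    destruct (Rtotal_order x 0) as [S|[S|S]].
    - destruct (IVT_interv g1 x 0) as [z [Z1 Z2]]; try lra.
      + intros; apply C1; lra.
      + apply (gn z); auto; lra.
    - subst x; lra.
    - destruct (IVT_interv (fun x => - g1 x) 0 x) as [z [Z1 Z2]]; try lra.
      + intros; apply continuity_pt_opp, C1; lra.
      + apply (gn z); auto; lra. }
  assert (incr : forall x y, -1 < x -> x < y -> y < 1 -> g x < g y).
  { intros x y Hx1 Hxy Hy; destruct (mean_value_R g g1 x y Hxy) as [c [Hc E]].
    - intros; apply D1; lra.
    - assert (T := gpos c ltac:(lra)); nra. }
  assert (g0 : g 0 = 0) by (unfold g; rewrite hf0; reflexivity).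
  assert (Max := modulus_maximal_on_positive_axis Omega f F a HP hcirc Hconj hf0 fa ltac:(lra)
    ltac:(intros x y A B D; destruct (Req_dec x y) as [->|n];
          [apply Rle_refl | left; apply incr; lra])).
  assert (Ineq : forall r, 0 < r < 1 -> g1 r * (r * g1 r - g r) <= r * (g r * g2 r)).
  { intros r Hr.
    assert (T := second_order_inequality f f' f'' r Df1 Df2 Hr
      ltac:(rewrite Rf by lra; reflexivity) ltac:(rewrite Rf' by lra; reflexivity)).
    change (Re (f r)) with (g r) in T; change (Re (f' r)) with (g1 r) in T;
      change (Re (f'' r)) with (g2 r) in T.
    apply Rmult_le_reg_l with r; [lra|].
    assert (T2 : r * g1 r * (r * g1 r) <= g r * (r * g1 r + r * r * g2 r)).
    { apply T; intros z Hz; eapply Rle_trans; [apply Max; lra|].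
      rewrite Hz; eapply Rle_trans; [apply Rle_abs | apply re_le_Cmod]. }
    nra. }
  destruct (log_convex_derivative g g1 g2 D1 D2 g0 gpos Ineq) as [mono eqcase].
  repeat split.
  - intros x [A B]; apply Rf; lra.
  - intros x [A B]; rewrite <- g0; apply incr; lra.
  - intros x y [A B] [A' B'] L; apply incr; lra.
  - intros x y t [A B] [A' B'] Ht.
    destruct (Req_dec t 0) as [->|t0].
    { replace ((1 - 0) * x + 0 * y) with x by ring; lra. }
    destruct (Req_dec t 1) as [->|t1].
    { replace ((1 - 1) * x + 1 * y) with y by ring; lra. }
    destruct (Rtotal_order x y) as [L|[->|L]].
    + destruct (secant_defect g g1 x y t D1) as [c1 [c2 [P1 [P2 [P3 E]]]]]; try lra.
      assert (M := mono c1 c2 ltac:(lra) ltac:(lra) ltac:(lra)).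
      assert (0 <= t * (1 - t) * (y - x) * (g1 c2 - g1 c1)) by (repeat apply Rmult_le_pos; lra).
      lra.
    + replace ((1 - t) * y + t * y) with y by ring; lra.
    (* The endpoints are exchanged together with their weights. *)
    + destruct (secant_defect g g1 y x (1 - t) D1) as [c1 [c2 [P1 [P2 [P3 E]]]]]; try lra.
      assert (M := mono c1 c2 ltac:(lra) ltac:(lra) ltac:(lra)).
      assert (0 <= (1 - t) * (1 - (1 - t)) * (x - y) * (g1 c2 - g1 c1))
        by (repeat apply Rmult_le_pos; lra).
      replace ((1 - (1 - t)) * y + (1 - t) * x) with ((1 - t) * x + t * y) in E by ring. lra.
  - intros ND.
    assert (smono : forall x y, 0 <= x -> x < y -> y < 1 -> g1 x < g1 y).
    { intros x y A L B; destruct (mono x y A (Rlt_le _ _ L) B) as [M|M]; auto; exfalso.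
      destruct (eqcase x y A L B M) as [m [c [Hm [Hc Hlin]]]].
      assert (cn : RtoC c <> 0%C) by (intros E; apply RtoC_inj in E; lra).
      assert (Hid : forall z, Cmod z < 1 -> f z = (RtoC c * z)%C).
      { destruct (hol_ball_zero_or_lower_bound (fun z => f z - RtoC c * z)%C 0 1 Rlt_0_1)
          as [Z | [n [A' [d [A0 [d0 Hlow]]]]]].
        - intros z Hz; destruct (Hb z Hz) as [l Hl].
          eexists; apply cderiv_minus; [exact Hl | apply cderiv_scal, cderiv_id].
        - intros z Hz; apply Cminus_eq_0, Z; now replace (z - 0)%C with z by ring.
        - exfalso.
          set (r := Rmin m (d / 2)).
          assert (r0 : 0 < r) by (apply Rmin_pos; lra).
          assert (r1 : r <= m) by apply Rmin_l.
          assert (r2 : r <= d / 2) by apply Rmin_r.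
          specialize (Hlow (RtoC r)).
          replace (RtoC r - 0)%C with (RtoC r) in Hlow by ring.
          rewrite Cmod_R, Rabs_pos_eq in Hlow by lra.
          specialize (Hlow ltac:(lra)).
          rewrite Rf, Hlin, RtoC_mult, Cmod_self in Hlow by lra.
          assert (0 < A' * r ^ n) by (apply Rmult_lt_0_compat; auto; apply pow_lt; auto).
          lra. }
      apply ND; exists c; split; auto; intros w; split.
      - intros Hw; destruct (H2 w Hw) as [B1 B2].
        rewrite <- B2, Hid, Cmod_mult, Cmod_R, Rabs_pos_eq by (auto; lra). nra.
      - intros Hw.
        assert (Hq : Cmod (w / RtoC c) < 1).
        { rewrite Cmod_div, Cmod_R, Rabs_pos_eq by (auto; lra).
          apply Rmult_lt_reg_r with c; auto.
          unfold Rdiv; rewrite Rmult_assoc, Rinv_l; lra. }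
        destruct (H1 _ Hq) as [O _]; rewrite Hid in O by auto.
        replace (RtoC c * (w / RtoC c))%C with w in O by (field; auto); exact O. }
    intros x y t [A B] [A' B'] nxy Ht.
    destruct (Rtotal_order x y) as [L|[->|L]]; [|contradiction|].
    + destruct (secant_defect g g1 x y t D1) as [c1 [c2 [P1 [P2 [P3 E]]]]]; try lra.
      assert (M := smono c1 c2 ltac:(lra) ltac:(lra) ltac:(lra)).
      assert (0 < t * (1 - t) * (y - x) * (g1 c2 - g1 c1)) by (repeat apply Rmult_lt_0_compat; lra).
      lra.
    + destruct (secant_defect g g1 y x (1 - t) D1) as [c1 [c2 [P1 [P2 [P3 E]]]]]; try lra.
      assert (M := smono c1 c2 ltac:(lra) ltac:(lra) ltac:(lra)).
      assert (0 < (1 - t) * (1 - (1 - t)) * (x - y) * (g1 c2 - g1 c1))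
        by (repeat apply Rmult_lt_0_compat; lra).
      replace ((1 - (1 - t)) * y + (1 - t) * x) with ((1 - t) * x + t * y) in E by ring. lra.
Qed.
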